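(* Let $F_1$ and $F_2$ be two complete Finsler structures on a connected smooth manifold $M$ and let $t\in[0,1]$. Then the Finsler metric $d(\max\{(1-t)F_1,tF_2\})$ induced by $\max\{(1-t)F_1,tF_2\}$ coincides with the metric $\max\{(1-t)d(F_1),t\,d(F_2)\}$ if the following condition ( * ) holds. ( * ) For any two points $x,y\in M$ there is an absolutely continuous path $\gamma\colon[0,1]\to M$ joining $x$ to $y$ satisfying one of the three properties below. (a) $\gamma$ is a geodesic with respect to both $F_1$ and $F_2$, and $(1-t)F_1(\gamma(s),\dot\gamma(s))-tF_2(\gamma(s),\dot\gamma(s))$ is either non-negative for almost all $s\in[0,1]$ or non-positive for almost all $s\in[0,1]$. (b) $\gamma$ is a geodesic with respect to $F_1$, and $(1-t)F_1(\gamma(s),\dot\gamma(s))\ge tF_2(\gamma(s),\dot\gamma(s))$ for almost all $s\in[0,1]$. (c) $\gamma$ is a geodesic with respect to $F_2$, and $tF_2(\gamma(s),\dot\gamma(s))\ge(1-t)F_1(\gamma(s),\dot\gamma(s))$ for almost all $s\in[0,1]$. If both $F_1$ and $F_2$ are complete $C^\infty$-Finsler structures, then ( * ) is also a necessary condition for the equality $d(\max\{(1-t)F_1,tF_2\})=\max\{(1-t)d(F_1),t\,d(F_2)\}$.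
   Context: A Finsler structure on a smooth manifold $M$ is a continuous function $F\colon TM\to[0,\infty)$ such that for every $x\in M$ the restriction $F(x,\cdot)$ to $T_xM$ is a weak norm, i.e. $F(x,v_1+v_2)\le F(x,v_1)+F(x,v_2)$ for all $v_1,v_2\in T_xM$; $F(x,\lambda v)=\lambda F(x,v)$ for all $\lambda\ge 0$ and $v\in T_xM$; and $F(x,v)=0$ if and only if $v=0$. (No symmetry is assumed.) It is a $C^\infty$-Finsler structure if in addition $F$ is $C^\infty$ on the complement of the zero section of $TM$. The length of a piecewise $C^1$-path $\beta\colon[a,b]\to M$ is $l_F(\beta)=\int_a^bF(\beta(s),\dot\beta(s))\,ds$. The induced (possibly non-symmetric) metric $d(F)(x,y)$ is the infimum of $l_F(\beta)$ over all piecewise $C^1$-paths $\beta$ from $x$ to $y$. For a continuous path $\gamma\colon[a,b]\to M$, $l(d(F))(\gamma)$ is the supremum of $\sum_{i=0}^n d(F)(\gamma(t_i),\gamma(t_{i+1}))$ over all finite partitions $a=t_0\le t_1\le\dots\le t_{n+1}=b$. The path is a geodesic with respect to $F$ if it is continuous, $l(d(F))(\gamma)<\infty$ and $l(d(F))(\gamma)=d(F)(\gamma(a),\gamma(b))$. A path $\gamma\colon[a,b]\to M$ is absolutely continuous if, for the distance $d$ of a Riemannian metric on $M$ (the notion does not depend on its choice), for every $\epsilon>0$ there is $\delta>0$ such that for any disjoint intervals $(a_1,b_1),\dots,(a_n,b_n)$ in $[a,b]$ of total length less than $\delta$ one has $\sum_i d(\gamma(a_i),\gamma(b_i))<\epsilon$.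 Such a path has a derivative $\dot\gamma(s)$ for almost every $s$. A sequence $(x_i)$ is Cauchy for $d(F)$ if for every $\epsilon>0$ there is $N$ such that $d(F)(x_m,x_n)<\epsilon$ for all $n\ge m\ge N$. $F$ is complete if for every such Cauchy sequence there is $x\in M$ with $d(F)(x_i,x)\to0$. $(\max\{(1-t)F_1,tF_2\})(x,v)=\max\{(1-t)F_1(x,v),tF_2(x,v)\}$, which is again a Finsler structure. *)

(* Defs.v *)
From HB Require Import structures.
From mathcomp Require Import all_boot all_order all_algebra.
From mathcomp Require Import all_classical all_reals all_analysis.
Import Order.TTheory GRing.Theory Num.Theory.
Import numFieldNormedType.Exports.

Set Implicit Arguments.
Unset Strict Implicit.
Unset Printing Implicit Defensive.

Local Open Scope classical_set_scope.
Local Open Scope ring_scope.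

Section Smooth.
Context {R : realType} {V W : normedModType R}.

Fixpoint Ck_on (k : nat) (U : set V) (f : V -> W) : Prop :=
  if k is k'.+1 then
    (forall x, U x -> differentiable f x) /\
    (forall v : V, Ck_on k' U (fun x => 'D_v f x))
  else forall x, U x -> {for x, continuous f}.

(* For open U and finite-dimensional V this is the usual notion; only the
   germs of f at the points of U matter, so f may be arbitrary off U. *)
Definition smooth_on (U : set V) (f : V -> W) : Prop :=
  forall k, Ck_on k U f.

End Smooth.

(* Smooth n-manifolds without boundary, presented by a smooth atlas
   (U_i, phi_i)_i; the values of phi_i off U_i and of its inverse off
   phi_i(U_i) are irrelevant. *)
Record smoothManifold (R : realType) (n : nat) := SmoothManifold {
  carrier :> topologicalType;
  chart : Type;
  dom : chart -> set carrier;
  cod : chart -> set 'rV[R]_n;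
  phi : chart -> carrier -> 'rV[R]_n;
  phi_inv : chart -> 'rV[R]_n -> carrier;
  open_dom : forall i, open (dom i);
  open_cod : forall i, open (cod i);
  phi_cod : forall i x, dom i x -> cod i (phi i x);
  phi_inv_dom : forall i p, cod i p -> dom i (phi_inv i p);
  phiK : forall i x, dom i x -> phi_inv i (phi i x) = x;
  phi_invK : forall i p, cod i p -> phi i (phi_inv i p) = p;
  phi_continuous : forall i x, dom i x -> {for x, continuous (phi i)};
  phi_inv_continuous :
    forall i p, cod i p -> {for p, continuous (phi_inv i)};
  dom_cover : forall x, exists i, dom i x;
  transition_smooth : forall i j,
    smooth_on (phi i @` (dom i `&` dom j)) (phi j \o phi_inv i);
  manifold_hausdorff : hausdorff_space carrier;
  manifold_second_countable : @second_countable carrier }.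

Section Tangent.
Context {R : realType} {n : nat} {M : smoothManifold R n}.
Implicit Type x : M.

(* A tangent vector at x is the family of its coordinate vectors in the
   charts around x, which are related by the differentials of the transition
   maps; the coordinates in the other charts are set to 0, so that equality
   of families is equality of tangent vectors. *)
Definition tangent_family x : {pred chart M -> 'rV[R]_n} :=
  fun v => `[< (forall i j, dom i x -> dom j x ->
                  v j = 'd (phi j \o phi_inv i) (phi i x) (v i)) /\
               (forall i, ~ dom i x -> v i = 0) >].

Fact tangent_family_closed x : submod_closed (tangent_family x).
Proof.
split=> [|a u v /asboolP[u1 u0] /asboolP[v1 v0]]; apply/asboolP; split.
- by move=> i j _ _; rewrite !fctE linear0.
- by [].
- move=> i j xi xj.
  have E k : (a *: u + v) k = a *: u k + v k by [].
  by rewrite !E linearP (u1 i j) // (v1 i j).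
- move=> i xi.
  have E k : (a *: u + v) k = a *: u k + v k by [].
  by rewrite E u0 // v0 // scaler0 addr0.
Qed.

HB.instance Definition _ x :=
  GRing.isSubmodClosed.Build R (chart M -> 'rV[R]_n) (tangent_family x)
    (tangent_family_closed x).

Record tangent x := Tangent {
  coord :> chart M -> 'rV[R]_n;
  coordP : coord \in tangent_family x }.

HB.instance Definition _ x := [isSub for @coord x].
HB.instance Definition _ x := [Choice of tangent x by <:].
HB.instance Definition _ x := [SubChoice_isSubLmodule of tangent x by <:].

End Tangent.

Section Curves.
Context {R : realType} {n : nat} {M : smoothManifold R n}.
Implicit Types (gamma beta g : R -> M) (s a b : R).

(* Continuity is required because the value of phi i off dom i is arbitrary. *)
Definition has_velocity gamma s (v : tangent (gamma s)) : Prop :=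
  {for s, continuous gamma} /\
  forall i, dom i (gamma s) -> is_derive s 1 (phi i \o gamma) (v i).

(* The derivative of gamma at s, and 0 where gamma has no derivative. *)
Definition velocity gamma s : tangent (gamma s) :=
  xget 0 [set v | has_velocity v].

Definition C1_near g s : Prop :=
  \forall u \near s, {for u, continuous g} /\
    forall i, dom i (g u) ->
      derivable (phi i \o g) u 1 /\ {for u, continuous (derive1 (phi i \o g))}.

(* C^1 at the points of a set A that need not be open (here a closed interval)
   means, as usual, existence of local C^1 extensions. *)
Definition C1_within (A : set R) beta s : Prop :=
  exists2 g, C1_near g s & \forall u \near s, A u -> g u = beta u.

(* Paths [a, b] -> M are functions on R of which only the restriction to
   [a, b] matters. *)
Definition piecewise_C1 a b beta : Prop :=
  exists k (t : nat -> R), [/\ t 0%N = a, t k = b,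
    forall j, (j < k)%N -> t j < t j.+1 &
    forall j, (j < k)%N -> forall s, `[t j, t j.+1]%classic s ->
      C1_within `[t j, t j.+1] beta s].

End Curves.

Section Finsler.
Context {R : realType} {n : nat} {M : smoothManifold R n}.
Local Notation mu := (@lebesgue_measure R).
Implicit Types F : forall x : M, tangent x -> R.

Definition weak_norm (V : lmodType R) (N : V -> R) : Prop :=
  [/\ forall v, 0 <= N v,
      forall v1 v2, N (v1 + v2) <= N v1 + N v2,
      forall lambda v, 0 <= lambda -> N (lambda *: v) = lambda * N v &
      forall v, N v = 0 <-> v = 0].

(* f is the expression of F in the chart (x, v) |-> (phi i x, v i) of the
   tangent bundle. *)
Definition local_expr F (i : chart M) (f : 'rV[R]_n * 'rV[R]_n -> R) : Prop :=
  forall x (v : tangent x), dom i x -> F x v = f (phi i x, v i).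

Definition finsler F : Prop :=
  (forall i, exists2 f, local_expr F i f &
     forall p, cod i p.1 -> {for p, continuous f}) /\
  (forall x, weak_norm (F x)).

Definition smooth_finsler F : Prop :=
  finsler F /\
  forall i, exists2 f, local_expr F i f &
    smooth_on [set p | cod i p.1 /\ p.2 <> 0] f.

Local Open Scope ereal_scope.

Definition finsler_length F (a b : R) (beta : R -> M) : \bar R :=
  \int[mu]_(s in `[a, b]) (F (beta s) (velocity beta s))%:E.

Definition finsler_dist F (x y : M) : \bar R :=
  ereal_inf [set L | exists a b beta, [/\ (a <= b)%R, piecewise_C1 a b beta,
    beta a = x, beta b = y & L = finsler_length F a b beta]].

Definition metric_length (d : M -> M -> \bar R) (a b : R) (gamma : R -> M) :
    \bar R :=
  ereal_sup [set L | exists k (t : nat -> R), [/\ t 0%N = a, t k.+1 = b,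
    forall i, (i <= k)%N -> (t i <= t i.+1)%R &
    L = \sum_(i < k.+1) d (gamma (t i)) (gamma (t i.+1))]].

Definition geodesic F (a b : R) (gamma : R -> M) : Prop :=
  [/\ {within `[a, b], continuous gamma},
      metric_length (finsler_dist F) a b gamma < +oo &
      metric_length (finsler_dist F) a b gamma =
        finsler_dist F (gamma a) (gamma b)].

Definition cauchy_for (d : M -> M -> \bar R) (x : nat -> M) : Prop :=
  forall e : R, (0 < e)%R -> exists N, forall m k,
    (N <= m)%N -> (m <= k)%N -> d (x m) (x k) < e%:E.

Definition finsler_complete F : Prop :=
  forall x : nat -> M, cauchy_for (finsler_dist F) x ->
    exists y : M, finsler_dist F (x i) y @[i --> \oo] --> 0.

Local Close Scope ereal_scope.

(* G p is the matrix (g_ij) in local coordinates; its existence includes the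
   bilinearity of g x. *)
Definition riemannian (g : forall x : M, tangent x -> tangent x -> R) : Prop :=
  [/\ forall i : chart M, exists2 G : 'rV[R]_n -> 'M[R]_n,
        smooth_on (cod i) G &
        forall x (v w : tangent x), dom i x ->
          g x v w = (v i *m G (phi i x) *m (w i)^T) 0 0,
      forall x (v w : tangent x), g x v w = g x w v &
      forall x (v : tangent x), v <> 0 -> 0 < g x v v].

Definition riemannian_norm (g : forall x : M, tangent x -> tangent x -> R)
    (x : M) (v : tangent x) : R := Num.sqrt (g x v v).

(* The notion does not depend on the choice of the Riemannian metric g. *)
Definition absolutely_continuous (a b : R) (gamma : R -> M) : Prop :=
  exists2 g, riemannian g &
  forall e : R, 0 < e -> exists2 delta : R, 0 < delta &
  forall (k : nat) (l r : 'I_k -> R),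
    (forall i, a <= l i /\ l i <= r i /\ r i <= b) ->
    trivIset [set: 'I_k] (fun i => `]l i, r i[%classic) ->
    \sum_(i < k) (r i - l i) < delta ->
    (\sum_(i < k) finsler_dist (riemannian_norm g) (gamma (l i)) (gamma (r i))
       < e%:E)%E.

Definition max_finsler (t : R) F1 F2 (x : M) (v : tangent x) : R :=
  Num.max ((1 - t) * F1 x v) (t * F2 x v).

Definition condition_star (t : R) F1 F2 : Prop :=
  forall x y : M, exists gamma : R -> M,
    let dF s := (1 - t) * F1 (gamma s) (velocity gamma s)
                - t * F2 (gamma s) (velocity gamma s) in
  [/\ absolutely_continuous 0 1 gamma, gamma 0 = x, gamma 1 = y &
   [\/ [/\ geodesic F1 0 1 gamma, geodesic F2 0 1 gamma &
          (\forall s \ae mu, `[0, 1]%classic s -> 0 <= dF s) \/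
          (\forall s \ae mu, `[0, 1]%classic s -> dF s <= 0)],
       geodesic F1 0 1 gamma /\
          \forall s \ae mu, `[0, 1]%classic s ->
            t * F2 (gamma s) (velocity gamma s)
            <= (1 - t) * F1 (gamma s) (velocity gamma s) |
       geodesic F2 0 1 gamma /\
          \forall s \ae mu, `[0, 1]%classic s ->
            (1 - t) * F1 (gamma s) (velocity gamma s)
            <= t * F2 (gamma s) (velocity gamma s)]].

End Finsler.

(* Main.v *)
Require Import Defs.
From HB Require Import structures.
From mathcomp Require Import all_boot all_order all_algebra.
From mathcomp Require Import all_classical all_reals all_analysis.
From mathcomp Require Import ring lra.
From mathcomp Require Import measurable_realfun.
Import Order.TTheory GRing.Theory Num.Theory.
Import numFieldNormedType.Exports.

Set Implicit Arguments.
Unset Strict Implicit.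
Unset Printing Implicit Defensive.

Local Open Scope classical_set_scope.
Local Open Scope ring_scope.

(** Write F for max((1-t) F1, t F2). Lengths are monotone in the Finsler
    structure, so max((1-t) d(F1), t d(F2)) <= d(F) always holds
    ([le_finsler_dist]); only the reverse inequality depends on the paths.

    The common tool is a local description of the metric of a continuous Finsler
    structure. Near a point p0 such a structure lies within a factor 1 +- e of
    the norm N that it has at p0. Straight segments then bound the distance from
    above, and truncations of the functions q |-> N(q - p) bound it from below,
    since they grow along a path at most at its speed ([barrier_subspeed],
    [frame_dist]). Hence the metric is finite on a connected manifold, it induces
    the topology, it is bi-Lipschitz to the coordinate norm in small charts
    ([rdist_bilipschitz]), and along a path with a velocity at s the quotient
    d(F)(gamma s, gamma (s + h)) / h tends to F(gamma s, gamma' s) as h decreases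
    to 0 ([metric_derivative]).

    Condition (a) implies (b) or (c), and these two are symmetric. Under (b),
    consider s |-> d(F)(x, gamma s) - (1-t) d(F1)(x, gamma s). In charts it is an
    absolutely continuous function. Distances from x add up along a geodesic of
    F1, so by [metric_derivative] its derivative is almost everywhere at most
    F(gamma') - (1-t) F1(gamma') = 0. Hence it decreases, by the fundamental
    theorem of calculus for absolutely continuous functions
    ([ac_fun_decreasing]), and its value at 1 is at most 0
    ([dist_le_of_geodesic]). The theorem of calculus is obtained by writing the
    function as a difference of monotone ones with the help of its variation,
    and by applying the theorems of Radon-Nikodym and of Lebesgue to the
    Stieltjes measures of these.

    Conversely F is complete, so x and y are joined by a path gamma with
    d(F)(gamma u, gamma v) = (v - u) d(F)(x, y) for u <= v ([minimizer_exists]):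
    almost shortest paths of constant speed have a limit along an ultrafilter,
    where local compactness and completeness provide the limit points. This path
    is Lipschitz for every Riemannian metric, hence absolutely continuous; a
    Riemannian metric exists by a locally finite sum of Euclidean metrics of
    charts ([riemannian_exists]). If the two metrics coincide, then d(F)(x, y) =
    c d(G)(x, y) with (c, G) one of (1-t, F1) and (t, F2). As c d(G) <= d(F), the
    triangle inequality forces c d(G) = d(F) between all points of gamma
    ([calibrated_dist]). Thus gamma is a geodesic of G, and c G(gamma') =
    F(gamma') by comparison of the metric derivatives ([calibrated_speed]), which
    is (b) or (c). *)

(** * Real induction *)

Section RealInduction.
Context {R : realType}.
Implicit Types a b s u v : R.

(** The supremum of the points up to which S holds belongs to that set by the
    last hypothesis, and the one before would extend the set beyond a supremum
    smaller than b. *)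
Lemma real_induction a b (S : R -> Prop) : a <= b -> S a ->
  (forall s, a <= s < b -> S s ->
     exists2 s', s < s' <= b & forall u, s < u <= s' -> S u) ->
  (forall s, a < s <= b -> (forall u, a <= u < s -> S u) -> S s) ->
  S b.
Proof.
move=> ab Sa stp lim.
pose A := [set s | a <= s <= b /\ forall u, a <= u <= s -> S u].
have Aa : A a by split; [rewrite lexx ab|move=> u /le_anti <-].
have Aub : ubound A b by move=> s [/andP[]].
have hsA : has_sup A by split; [exists a|exists b].
set m := sup A.
have hub : has_ubound A by exists b.
have am : a <= m by exact: ub_le_sup hub _ Aa.
have mb : m <= b by apply: ge_sup => //; exists a.
have Sm : forall u, a <= u < m -> S u.
  move=> u /andP[au um].
  have e0 : 0 < m - u by rewrite subr_gt0.
  have [v [_ Av] uv] := sup_adherent e0 hsA.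
  by apply: Av; rewrite au/=; move: uv; rewrite -/m; lra.
have Am : A m.
  split; first by rewrite am mb.
  move=> u /andP[au]; rewrite le_eqVlt => /predU1P[->|um]; last first.
    by apply: Sm; rewrite au um.
  move: am; rewrite le_eqVlt => /predU1P[<-//|am].
  by apply: lim => //; rewrite am mb.
move: mb; rewrite le_eqVlt => /predU1P[<-|mb].
  by apply: (Am.2 m); rewrite am lexx.
have [s' /andP[ms' s'b] Ss'] := stp m (introT andP (conj am mb)) (Am.2 m (introT andP (conj am (lexx _)))).
have : A s'.
  split; first by rewrite s'b (le_trans am (ltW ms')).
  move=> u /andP[au us']; have [um|um] := leP u m.
    by apply: Am.2; rewrite au um.
  by apply: Ss'; rewrite um us'.
by move=> /(ub_le_sup hub); rewrite -/m leNgt ms'.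
Qed.

(** A transitive relation can be prolonged across each short interval, so that
    real induction applies to [P a]. Local estimates in charts become global
    along a path in this way. *)
Lemma chain_local a b (P : R -> R -> Prop) : a <= b ->
  (forall s u v, a <= s <= u -> u <= v <= b -> P s u -> P u v -> P s v) ->
  (forall s, a <= s <= b -> exists2 d, 0 < d &
    forall u v, a <= u -> v <= b -> s - d < u -> u <= v -> v < s + d -> P u v) ->
  P a b.
Proof.
move=> ab tr loc; apply: (@real_induction a b (P a)) => //.
- have [|d d0 H] := loc a; first by rewrite lexx.
  by apply: H => //; lra.
- move=> s /andP[as_ sb] Ps.
  have [|d d0 H] := loc s; first by rewrite as_ ltW.
  exists (Num.min b (s + d / 2)); first by rewrite lt_min ge_min lexx sb /=; lra.
  move=> u /andP[su]; rewrite le_min => /andP[ub us].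
  by apply: (tr _ s) => //; [lra|lra|apply: H => //; lra].
- move=> s /andP[as_ sb] IH.
  have [|d d0 H] := loc s; first by rewrite sb ltW.
  pose u := Num.max a (s - d / 2).
  have au : a <= u by rewrite le_max lexx.
  have us : u < s by rewrite gt_max as_ /=; lra.
  have su : s - d < u by rewrite lt_max; apply/orP; right; lra.
  apply: (tr _ u); [by rewrite lexx|by rewrite sb ltW|apply: IH; lra|apply: H => //; lra].
Qed.

End RealInduction.

(** * Absolutely continuous real functions *)

Section AbsolutelyContinuousFunctions.
Context {R : realType}.
Implicit Types (a b : R) (f h : R -> R).
Local Notation mu := (@lebesgue_measure R).

Definition ac_fun a b f := forall e, 0 < e -> exists2 d, 0 < d &
  forall (k : nat) (l r : 'I_k -> R),
    (forall i, a <= l i /\ l i <= r i /\ r i <= b) ->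
    trivIset [set: 'I_k] (fun i => `]l i, r i[%classic) ->
    \sum_(i < k) (r i - l i) < d -> \sum_(i < k) `|f (r i) - f (l i)| < e.

(** Partitioning each interval of a family gives a family that is naturally
    indexed by dependent pairs, hence the other index types. *)
Lemma ac_funT a b f e : ac_fun a b f -> 0 < e -> exists2 d, 0 < d &
  forall (T : finType) (l r : T -> R),
    (forall i, a <= l i /\ l i <= r i /\ r i <= b) ->
    (forall i j, i != j -> `]l i, r i[ `&` `]l j, r j[ = set0) ->
    \sum_(i : T) (r i - l i) < d -> \sum_(i : T) `|f (r i) - f (l i)| < e.
Proof.
move=> acf e0; have [d d0 H] := acf e e0; exists d => // T l r lr tr.
rewrite (reindex (@enum_val T T)) /=; last first.
  by exists enum_rank => i _; rewrite ?enum_valK ?enum_rankK.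
rewrite [in X in _ -> X](reindex (@enum_val T T)) /=; last first.
  by exists enum_rank => i _; rewrite ?enum_valK ?enum_rankK.
apply: (H _ (l \o enum_val) (r \o enum_val)) => [i|]; first exact: lr.
apply/trivIsetP => i j _ _ ij; apply: tr.
by apply: contra ij => /eqP/enum_val_inj ->.
Qed.

Lemma partition_pieces a b s : itv_partition a b s ->
  let l (j : 'I_(size s)) := nth b (a :: s) j in
  let r (j : 'I_(size s)) := nth b (a :: s) j.+1 in
  [/\ forall j, a <= l j /\ l j <= r j /\ r j <= b,
      forall i j, i != j -> `]l i, r i[ `&` `]l j, r j[ = set0 &
      \sum_j (r j - l j) = b - a].
Proof.
move=> abs l r; have [pas /eqP lasb] := abs.
have srt : sorted <=%R (a :: s) by apply: (@sub_path _ <%R <=%R) pas => x y /ltW.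
have mono i j : (i <= j)%N -> (j < (size s).+1)%N ->
    nth b (a :: s) i <= nth b (a :: s) j.
  move=> ij js; apply: (sorted_leq_nth le_trans lexx b srt) => //=.
  by rewrite inE (leq_ltn_trans ij).
split.
- move=> j; split; [|split].
  + by rewrite -[leLHS]/(nth b (a :: s) 0); apply: mono => //; rewrite ltnW// ltnS.
  + by apply: mono => //; rewrite ltnS.
  + have -> : b = nth b (a :: s) (size s) by rewrite -[in LHS]lasb (last_nth b).
    by apply: mono.
- move=> i j; wlog ij : i j / (i < j)%N.
    move=> W; rewrite neq_ltn => /orP[ij|ji].
      by apply: W => //; rewrite neq_ltn ij.
    by rewrite setIC; apply: W => //; rewrite neq_ltn ji.
  move=> _; apply/seteqP; split => // x /= [].
  rewrite !in_itv /= => /andP[_ xr] /andP[lx _].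
  have : r i <= l j by apply: mono => //; rewrite ltnW// ltnS.
  by lra.
- rewrite /r /l -(big_mkord xpredT (fun j => nth b (a :: s) j.+1 - nth b (a :: s) j)).
  by rewrite telescope_sumr// -(last_nth b) lasb.
Qed.

Lemma variation_fin a b f s :
  variation a b f s = \sum_(j < size s) `|f (nth b (a :: s) j.+1) - f (nth b (a :: s) j)|.
Proof. by rewrite /variation big_mkord. Qed.

Lemma ac_fun_bv a b f : a <= b -> ac_fun a b f -> bounded_variation a b f.
Proof.
move=> ab acf; have [d d0 H] := ac_funT acf ltr01.
apply/bounded_variationP => //.
apply: (@chain_local _ a b (fun u v => total_variation u v f \is a fin_num)) => //.
- move=> s u v /andP[_ su] /andP[uv _] Psu Puv.
  by rewrite (total_variationD f su uv) fin_numD Psu Puv.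
- move=> s /andP[as_ sb]; exists (d / 2); first by rewrite divr_gt0.
  move=> u v au vb su uv vs; apply/bounded_variationP => //.
  exists 1 => _ [p /[dup] uvp /partition_pieces[lr dj tot] <-].
  rewrite variation_fin; apply/ltW/(H _ (fun j : 'I_(size p) => nth v (u :: p) j) (fun j : 'I_(size p) => nth v (u :: p) j.+1)) => //.
    by move=> i; have [? [? ?]] := lr i; split; [exact: le_trans au _|split => //; exact: le_trans vb].
  by rewrite tot; lra.
Qed.

(** Partitions of the given intervals that nearly attain the variations form a
    single family of intervals with the same total length, to which the
    absolute continuity of f applies. *)
Lemma ac_fun_tv a b f : a <= b -> ac_fun a b f ->
  ac_fun a b (fun s => fine (total_variation a s f)).
Proof.
move=> ab acf e e0.
have bv := ac_fun_bv ab acf.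
have e20 : 0 < e / 2 by rewrite divr_gt0.
have [d d0 H] := ac_funT acf e20; exists d => // k l r lr tr sd.
have fin u v : a <= u -> u <= v -> v <= b -> total_variation u v f \is a fin_num.
  move=> au uv vb; apply/bounded_variationP => //.
  by apply: (bounded_variationl uv vb); apply: bounded_variationr bv => //; exact: le_trans vb.
have E i : `|fine (total_variation a (r i) f) - fine (total_variation a (l i) f)|
   = fine (total_variation (l i) (r i) f).
  have [al [lri rb]] := lr i.
  rewrite (total_variationD f al lri) fineD ?fin//; last exact: le_trans rb.
  by rewrite addrAC subrr add0r ger0_norm// fine_ge0// total_variation_ge0.
rewrite (eq_bigr _ (fun i _ => E i)).
suff : \sum_(i < k) fine (total_variation (l i) (r i) f) <= e / 2 by lra.
apply/ler_addgt0Pr => eta eta0.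
pose eta' := eta / k.+1%:R.
have eta'0 : 0 < eta' by rewrite divr_gt0.
have [s sP] : {s : 'I_k -> seq R & forall i, itv_partition (l i) (r i) (s i) /\
    fine (total_variation (l i) (r i) f) <= variation (l i) (r i) f (s i) + eta'}.
  apply: (@choice _ _ (fun i s => itv_partition (l i) (r i) s /\
    fine (total_variation (l i) (r i) f) <= variation (l i) (r i) f s + eta')) => i.
  have [al [lri rb]] := lr i.
  have fi := fin _ _ al lri rb.
  have [_ [x [p pP <-] <-] xlt] := ub_ereal_sup_adherent eta'0 fi.
  exists p; split => //; move: xlt.
  rewrite -[ereal_sup _]/(total_variation (l i) (r i) f) -(fineK fi) -EFinB lte_fin.
  by rewrite ltrBlDr => /ltW.
pose T := {i : 'I_k & 'I_(size (s i))}.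
pose L (t : T) := nth (r (tag t)) (l (tag t) :: s (tag t)) (tagged t).
pose U (t : T) := nth (r (tag t)) (l (tag t) :: s (tag t)) (tagged t).+1.
have pp i := partition_pieces (sP i).1.
have LU (t : T) : l (tag t) <= L t /\ L t <= U t /\ U t <= r (tag t).
  by case: t => i j; have [+ _ _] := pp i; exact.
have {H} : \sum_(t : T) `|f (U t) - f (L t)| < e / 2.
  apply: H => [t|[i j] [i' j'] tt'|].
  - have [lt [LUt Ut]] := LU t; have [at_ [_ rb]] := lr (tag t).
    by split; [exact: le_trans at_ lt|split => //; exact: le_trans Ut rb].
  - have [ii'|ii'] := eqVneq i i'.
      move: j' tt'; rewrite -{}ii' => j' tt'; have [_ + _] := pp i; apply.
      by apply: contra tt'; move=> /eqP /= ->.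
    apply/seteqP; split => // x [].
    have [/= li [_ ri]] := LU (existT _ i j).
    have [/= li' [_ ri']] := LU (existT _ i' j').
    rewrite /= !in_itv /= => /andP[x1 x2] /andP[x3 x4].
    move/trivIsetP : tr => /(_ i i' I I ii')/seteqP[+ _] => /(_ x) /=; apply.
    split; rewrite /= in_itv /=; apply/andP; split.
    + exact: le_lt_trans li x1.
    + exact: lt_le_trans x2 ri.
    + exact: le_lt_trans li' x3.
    + exact: lt_le_trans x4 ri'.
  - rewrite -(sig_big_dep (fun=> true) (fun i j => true)
      (fun i (j : 'I_(size (s i))) => nth (r i) (l i :: s i) j.+1 - nth (r i) (l i :: s i) j)) /=.
    by under eq_bigr => i _ do rewrite (let: And3 _ _ E := pp i in E).
rewrite -(sig_big_dep (fun=> true) (fun i j => true)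
  (fun i (j : 'I_(size (s i))) => `|f (nth (r i) (l i :: s i) j.+1) - f (nth (r i) (l i :: s i) j)|)) /=.
under eq_bigr => i _ do rewrite -variation_fin.
move=> lte; apply: (@le_trans _ _ (\sum_(i < k) (variation (l i) (r i) f (s i) + eta'))).
  by apply: ler_sum => i _; have [] := sP i.
rewrite big_split /= lerD ?(ltW lte)// sumr_const card_ord /eta' -mulrnAr.
apply: ler_piMr; first exact: ltW.
by rewrite -[leLHS]mulr_natl ler_pdivrMr ?ltr0n// mul1r ler_nat leqnSn.
Qed.

(** Components of open sets come as intervals of unspecified shape, while
    absolute continuity speaks of explicit endpoints. *)
Lemma open_interval_bounds (I : set R) : open I -> is_interval I -> (mu I < +oo)%E ->
  exists l r : R, [/\ l <= r, `]l, r[ `<=` I, I `<=` `]l, r] & (mu I = (r - l)%:E)%E].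
Proof.
move=> oI /is_intervalP IE; move: oI; rewrite {}IE; move: (Rhull I) => i oI iI.
have I0 : [set x | x \in i] = set0 -> exists l r : R, [/\ l <= r, `]l, r[ `<=` [set` i],
    [set` i] `<=` `]l, r] & (mu [set` i] = (r - l)%:E)%E].
  move=> ->; exists 0, 0.
  by rewrite measure0 subrr; split => // x; rewrite /= in_itv/=; lra.
have [i0|i21] := boolP (i.1 < i.2)%O; last first.
  apply: I0; apply/seteqP; split => // x /=.
  by case: i i21 {oI iI} => i1 i2 i21; rewrite itv_ge.
move: i i0 oI iI I0 => [[bl l|[]] [br r|[]]] // i0 oI; rewrite lebesgue_measure_itv /=
  -?[(_ < _)%O]/(_ < _)%E ?ltry ?ltNyr ?ltNyy //= => iI I0.
have H x : x \in Interval (BSide bl l) (BSide br r) -> l < x <= r.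
  move=> /[dup] xI; rewrite /= !in_itv /= => /andP[lx xr].
  apply/andP; split; last by case: br xr {i0 oI xI iI I0} => // /ltW.
  rewrite lt_neqAle; apply/andP; split; last by case: bl lx {i0 oI xI iI I0} => // /ltW.
  apply/eqP => lxE; move: oI; rewrite openE => /(_ _ xI); rewrite /interior -lxE.
  move=> /nbhs_ballP[e /= e0 /(_ (l - e / 2))].
  rewrite /ball /= opprB addrC subrK gtr0_norm ?divr_gt0// => /(_ _)/[!in_itv]/=.
  have -> : (e / 2 < e) by lra.
  by move=> /(_ isT)/andP[]; case: bl {i0 lx xI iI I0} => /=; lra.
have [lr|rl] := ltP l r; last first.
  by apply: I0; apply/seteqP; split => // x /= /H; lra.
rewrite lte_fin lr; exists l, r; split => //; first exact: ltW.
by apply: subset_itv; rewrite bnd_simp; case: bl {i0 oI iI H I0}; case: br.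
Qed.

(** The function h is the distribution function of its Stieltjes measure.
    Absolute continuity makes this measure vanish on null sets, which are
    covered by open sets of small measure; so it has a density, which is the
    derivative of h almost everywhere by Lebesgue differentiation. As h is
    constant off [a, b], the measure may be cut down to a bounded interval,
    where it is finite. *)
Lemma monotone_ac_density (a b : R) (h : R -> R) : a <= b ->
  {homo h : x y / x <= y} ->
  (forall s, s <= a -> h s = h a) -> (forall s, b <= s -> h s = h b) ->
  (forall e, 0 < e -> exists2 d, 0 < d & forall (k : nat) (l r : 'I_k -> R),
    (forall i, l i <= r i) ->
    trivIset [set: 'I_k] (fun i => `]l i, r i[%classic) ->
    \sum_(i < k) (r i - l i) < d -> \sum_(i < k) (h (r i) - h (l i)) < e) ->
  exists g : R -> R, [/\ mu.-integrable setT (EFin \o g),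
    forall u v, u <= v -> (h v - h u)%:E = (\int[mu]_(s in `]u, v]) (g s)%:E)%E &
    {ae mu, forall x, a < x -> is_derive x 1 h (g x)}].
Proof.
move=> ab nd hl hr ach.
have hc : continuous h.
  move=> x; apply/cvgrPdist_lt => e e0; have [d d0 H] := ach e e0.
  have key u v : u <= v -> v - u < d -> h v - h u < e.
    move=> uv uvd; have := H 1%N (fun=> u) (fun=> v).
    rewrite !big_ord1; apply => //.
    by apply/trivIsetP => i j _ _; rewrite !ord1 eqxx.
  near=> y.
  have : `|x - y| < d by near: y; apply: cvgr_dist_lt.
  have [xy|yx] := leP x y.
    rewrite distrC ger0_norm ?subr_ge0// => /(key _ _ xy) hxy.
    by rewrite distrC ger0_norm ?subr_ge0// nd.
  rewrite ger0_norm ?subr_ge0 1?ltW// => /(key _ _ (ltW yx)) hxy.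
  by rewrite ger0_norm ?subr_ge0// nd// ltW.
pose cum := isCumulative.Build R _ R h nd (right_continuousW hc).
pose hC : cumulative R R := HB.pack h cum.
pose nu := lebesgue_stieltjes_measure hC.
have nu_oc u v : u <= v -> nu `]u, v]%classic = (h v - h u)%:E.
  move=> uv; rewrite /nu /lebesgue_stieltjes_measure /measure_extension.
  by rewrite measurable_mu_extE/=; [rewrite wlength_itv_bnd|exact: is_ocitv].
pose D := (`]a - 1, b]%classic : set (measurableTypeR R)).
have mD : measurable D by exact: measurable_itv.
have nuD : (nu D < +oo)%E by rewrite /D nu_oc ?ltry//; lra.
pose nuf := mfrestr mD nuD.
have dom : nuf `<< mu.
  move=> A A0 B mB BA.
  have muB : mu B = 0 by exact: A0.
  apply/eqP; rewrite eq_le measure_ge0 andbT; apply/lee_addgt0Pr => e e0; rewrite add0e.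
  have [d d0 H] := ach e e0.
  have muB_lty : (mu B < +oo)%E by rewrite muB ltry.
  have [U [oU BU muU]] := lebesgue_regularity_outer mB muB_lty d0.
  have mU : measurable U by exact: measurable_realfun.open_measurable.
  have {}muU : (mu U < d%:E)%E.
    apply: le_lt_trans muU; rewrite [leLHS](measureDI mu mU mB).
    rewrite [X in (_ + X)%E](_ : _ = 0%E) ?adde0//.
    by apply/eqP; rewrite eq_le measure_ge0 andbT -muB le_measure ?inE//; exact: measurableI.
  pose I := open_disjoint_itv oU.
  have mI q : measurable (I q) by apply: measurable_realfun.open_measurable; exact: open_disjoint_itv_open.
  have UI : U = \bigcup_q I q by exact: open_disjoint_itv_bigcup.
  have tI : trivIset setT I by exact: open_disjoint_itv_trivIset.
  have muI q : (mu (I q) < +oo)%E.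
    apply: le_lt_trans (lt_trans muU (ltry _)); apply: le_measure; rewrite ?inE; [exact: mI|exact: mU|].
    by rewrite UI; exact: bigcup_sup.
  have [l lP] := choice (fun q => open_interval_bounds
    (@open_disjoint_itv_open _ _ oU q) (@open_disjoint_itv_is_interval _ _ oU q) (muI q)).
  have {lP} [r lrP] := choice lP.
  have muE : (mu U = \sum_(q <oo) (r q - l q)%:E)%E.
    rewrite UI measure_bigcup; [|by move=> q _; exact: mI|exact: tI].
    apply: congr_lim; apply/funext => n /=; apply: eq_big => [q|q _]; first exact/mem_set.
    by have [] := lrP q.
  apply: (@le_trans _ _ (nu U)).
    apply: le_measure; rewrite ?inE; [exact: measurableI|exact: mU|by move=> x [/BU]].
  rewrite UI /nu measure_bigcup; [|by move=> q _; exact: mI|exact: tI].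
  apply: lime_le; first by apply: is_cvg_nneseries => q _ _; exact: measure_ge0.
  apply: nearW => N; apply: (@le_trans _ _ (\sum_(q < N) (h (r q) - h (l q)))%:E).
    rewrite -sumEFin big_mkord big_mkcond; apply: lee_sum => q _.
    have [lr _ Ilr _] := lrP q; rewrite mem_set// -nu_oc//.
    by apply: le_measure; rewrite ?inE; [exact: mI|exact: measurable_itv|].
  rewrite lee_fin ltW//; apply: (H N (fun q => l q) (fun q => r q)).
  - by move=> q; have [] := lrP q.
  - apply/trivIsetP => p q _ _ pq; apply/seteqP; split => // x [xp xq].
    have [_ + _ _] := lrP p => /(_ _ xp) Ip; have [_ + _ _] := lrP q => /(_ _ xq) Iq.
    by move/trivIsetP : tI => /(_ p q Logic.I Logic.I pq)/seteqP[/(_ x) + _]; apply.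
  - rewrite -lte_fin; apply: le_lt_trans muU; rewrite muE -sumEFin -(big_mkord xpredT (fun q => (r q - l q)%:E)).
    by apply: nneseries_lim_ge => q _ _; have [lr _ _ _] := lrP q; rewrite lee_fin subr_ge0.
have [g0 [g0_ge0 g0_fin g0_int g0E]] := @radon_nikodym_sigma_finite _ _ _ mu nuf dom.
pose g := fine \o g0.
have gE : EFin \o g = g0 by apply/funext => x /=; rewrite fineK.
have int_g u v : u <= v -> (h v - h u)%:E = (\int[mu]_(s in `]u, v]) (g s)%:E)%E.
  move=> uv; rewrite -[RHS]/(\int[mu]_(s in `]u, v]) (EFin \o g) s)%E gE -g0E; last exact: measurable_itv.
  rewrite -[RHS]/(nu (`]u, v]%classic `&` D)).
  pose u' := Num.max u (a - 1); pose v' := Num.min v b.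
  have -> : `]u, v] `&` D = `]u', v']%classic.
    by apply/seteqP; split=> x; rewrite /= /D /= !in_itv /= /u' /v' gt_max le_min; lra.
  have hu : h u = h u'.
    by rewrite /u'; case: leP => // ua; rewrite hl ?[RHS]hl; lra.
  have hv : h v = h v'.
    by rewrite /v'; case: leP => // bv; rewrite [LHS]hr// ltW.
  have [uv'|vu'] := leP u' v'; first by rewrite nu_oc// hu hv.
  have -> : `]u', v']%classic = set0.
    by apply/seteqP; split => // x; rewrite /= in_itv /=; lra.
  rewrite /nu measure0.
  suff -> : h v = h u by rewrite subrr.
  apply/eqP; rewrite eq_le; apply/andP; split; last exact: (nd u v uv).
  by rewrite hu hv; exact: (nd v' u' (ltW vu')).
have intg : mu.-integrable setT (EFin \o g) by rewrite gE.
exists g; split => //.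
have locg : locally_integrable setT g by apply: open_integrable_locally => //; exact: openT.
have intgy y : mu.-integrable [set` Interval (BRight (a - 1)) (BRight y)] (EFin \o g).
  by apply: integrableS intg => //; exact: measurable_itv.
have := FTC1 intgy locg.
apply: filterS; first exact: (ae_filter_ringOfSetsType mu).
move=> x /= Hx ax; have [|dF F'] := Hx; first by rewrite lte_fin; lra.
have E : {near x, (fun y => \int[mu]_(t in `]a - 1, y]) g t)%R =1 (fun y => h y - h (a - 1))}.
  near=> y; rewrite /Rintegral -int_g//.
  by apply/ltW; near: y; apply: lt_nbhsr; lra.
have {}dF : is_derive x 1 (fun y => h y - h (a - 1)) (g x).
  apply: near_eq_is_derive E _.
  by apply: DeriveDef => //; rewrite -derive1E.
have := is_deriveD dF (is_derive_cst (h (a - 1)) x 1); rewrite addr0.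
by congr (is_derive _ _ _ _); apply/funext => y /=; rewrite subrK.
Unshelve. all: by end_near. Qed.

Lemma ac_funD a b f h : ac_fun a b f -> ac_fun a b h -> ac_fun a b (f \+ h).
Proof.
move=> acf ach e e0; have e20 : 0 < e / 2 by rewrite divr_gt0.
have [d d0 H] := acf _ e20; have [d' d'0 H'] := ach _ e20.
exists (Num.min d d'); first by rewrite lt_min d0.
move=> k l r lr tr; rewrite lt_min => /andP[sd sd'].
apply: (@le_lt_trans _ _ (\sum_(i < k) (`|f (r i) - f (l i)| + `|h (r i) - h (l i)|))).
  by apply: ler_sum => i _ /=; rewrite opprD addrACA ler_normD.
rewrite big_split/= (splitr e); apply: ltrD; first exact: H.
exact: H'.
Qed.

Lemma ac_fun_le a b f h C : ac_fun a b h ->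
  (forall u v, a <= u -> u <= v -> v <= b -> `|f v - f u| <= C * `|h v - h u|) ->
  ac_fun a b f.
Proof.
move=> ach fh e e0; pose C' := Num.max C 1.
have C'0 : 0 < C' by rewrite lt_max ltr01 orbT.
have eC : 0 < e / C' by rewrite divr_gt0.
have [d d0 H] := ach _ eC; exists d => // k l r lr tr sd.
have := H k l r lr tr sd; rewrite ltr_pdivlMr// => /(le_lt_trans _); apply.
rewrite mulrC mulr_sumr; apply: ler_sum => i _; have [al [lri rb]] := lr i.
apply: le_trans (fh _ _ al lri rb) _; apply: ler_wpM2r => //.
by rewrite le_max lexx.
Qed.

(** The retraction of the line onto [a, b], which extends functions on [a, b] by
    constants. *)
Definition clamp a b s := if s <= a then a else if b <= s then b else s.

Lemma clamp_cases a b s : a <= b -> (s <= a /\ clamp a b s = a) \/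
  ((a < s /\ s < b) /\ clamp a b s = s) \/ (b <= s /\ clamp a b s = b).
Proof.
move=> ab; rewrite /clamp; case: (leP s a) => sa; first by left.
by case: (leP b s) => bs; right; [right|left].
Qed.

Lemma ac_fun_clamp a b h : a <= b -> ac_fun a b h ->
  forall e, 0 < e -> exists2 d, 0 < d & forall (k : nat) (l r : 'I_k -> R),
    (forall i, l i <= r i) ->
    trivIset [set: 'I_k] (fun i => `]l i, r i[%classic) ->
    \sum_(i < k) (r i - l i) < d ->
    \sum_(i < k) `|h (clamp a b (r i)) - h (clamp a b (l i))| < e.
Proof.
move=> ab ach e e0; have [d d0 H] := ach e e0; exists d => // k l r lr tr sd.
pose c := clamp a b.
have cP s : a <= c s /\ c s <= b.
  by have := clamp_cases s ab; rewrite -/(c s); lra.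
have cle u v : u <= v -> c u <= c v /\ c v - c u <= v - u.
  move=> uv; have := clamp_cases u ab; have := clamp_cases v ab.
  by rewrite -/(c u) -/(c v); lra.
apply: (H k (c \o l) (c \o r)).
- move=> i; have := cP (l i); have := cP (r i); have := cle _ _ (lr i).
  by rewrite /=; lra.
- apply/trivIsetP => i j _ _ ij; move/trivIsetP : tr => /(_ i j Logic.I Logic.I ij)/seteqP[+ _].
  move=> dij; apply/seteqP; split => // x [] /=; rewrite !in_itv /= => xi xj.
  have cx u v : c u < x < c v -> u < x < v.
    by have := clamp_cases u ab; have := clamp_cases v ab; rewrite -/(c u) -/(c v); lra.
  by apply: (dij x); split; rewrite /= in_itv /=; exact: cx.
- by apply: le_lt_trans sd; apply: ler_sum => i _; have [] := cle _ _ (lr i).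
Qed.

(** The variation V of f and the function V - f are monotone and absolutely
    continuous, and f is their difference. *)
Lemma ac_fun_density a b f : a <= b -> ac_fun a b f ->
  exists g : R -> R, [/\ mu.-integrable setT (EFin \o g),
    forall u v, a <= u -> u <= v -> v <= b ->
      (f v - f u)%:E = (\int[mu]_(s in `]u, v]) (g s)%:E)%E &
    {ae mu, forall x, a < x < b -> is_derive x 1 f (g x)}].
Proof.
move=> ab acf.
pose c := clamp a b.
have cP s : a <= c s /\ c s <= b.
  by have := clamp_cases s ab; rewrite -/(c s); lra.
have cle u v : u <= v -> c u <= c v.
  move=> uv; have := clamp_cases u ab; have := clamp_cases v ab.
  by rewrite -/(c u) -/(c v); lra.
have cid s : a <= s -> s <= b -> c s = s.
  by move=> ? ?; have := clamp_cases s ab; rewrite -/(c s); lra.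
have ca s : s <= a -> c s = c a.
  by move=> ?; have := clamp_cases s ab; have := clamp_cases a ab; rewrite -/(c s) -/(c a); lra.
have cb s : b <= s -> c s = c b.
  by move=> ?; have := clamp_cases s ab; have := clamp_cases b ab; rewrite -/(c s) -/(c b); lra.
pose V s := fine (total_variation a s f).
have mono (h : R -> R) : ac_fun a b h ->
    (forall u v, a <= u -> u <= v -> v <= b -> h u <= h v) ->
  exists g : R -> R, [/\ mu.-integrable setT (EFin \o g),
    forall u v, a <= u -> u <= v -> v <= b ->
      (h v - h u)%:E = (\int[mu]_(s in `]u, v]) (g s)%:E)%E &
    {ae mu, forall x, a < x < b -> is_derive x 1 h (g x)}].
  move=> ach ndh.
  have nd : {homo h \o c : x y / x <= y}.
    by move=> x y xy /=; apply: ndh; [exact: (cP x).1|exact: cle|exact: (cP y).2].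
  have [g [ig gE dg]] := @monotone_ac_density a b (h \o c) ab nd
    (fun s sa => congr1 h (ca s sa)) (fun s sb => congr1 h (cb s sb))
    (fun e e0 => let: ex_intro2 d d0 H := ac_fun_clamp ab ach e0 in
       ex_intro2 _ _ d d0 (fun k l r lr tr sd => le_lt_trans
         (ler_sum _ (fun i _ => ler_norm _)) (H k l r lr tr sd))).
  exists g; split => //.
    move=> u v au uv vb; rewrite -gE//=.
    by rewrite !cid//; [exact: le_trans uv vb|exact: le_trans au uv].
  apply: filterS dg; first exact: (ae_filter_ringOfSetsType mu).
  move=> x dx /andP[ax xb]; apply: near_eq_is_derive (dx ax); near=> y => /=.
  rewrite cid//; apply/ltW; near: y; first exact: lt_nbhsr.
  exact: lt_nbhsl.
have bv := ac_fun_bv ab acf.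
have fin u v : a <= u -> u <= v -> v <= b -> total_variation u v f \is a fin_num.
  move=> au uv vb; apply/bounded_variationP => //.
  by apply: (bounded_variationl uv vb); apply: bounded_variationr bv => //; exact: le_trans vb.
have VD u v : a <= u -> u <= v -> v <= b -> V v - V u = fine (total_variation u v f).
  move=> au uv vb; rewrite /V (total_variationD f au uv) fineD ?fin//; last exact: le_trans vb.
  by rewrite addrAC subrr add0r.
have acV : ac_fun a b V by exact: ac_fun_tv.
have [g1 [ig1 g1E dg1]] : exists g : R -> R, [/\ mu.-integrable setT (EFin \o g),
    forall u v, a <= u -> u <= v -> v <= b ->
      (V v - V u)%:E = (\int[mu]_(s in `]u, v]) (g s)%:E)%E &
    {ae mu, forall x, a < x < b -> is_derive x 1 V (g x)}].
  apply: mono => // u v au uv vb.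
  by rewrite -subr_ge0 VD// fine_ge0// total_variation_ge0.
have acN : ac_fun a b (\- f).
  by apply: (@ac_fun_le _ _ _ f 1) => // u v _ _ _; rewrite -opprD normrN mul1r.
have [g2 [ig2 g2E dg2]] : exists g : R -> R, [/\ mu.-integrable setT (EFin \o g),
    forall u v, a <= u -> u <= v -> v <= b ->
      ((V \+ \- f) v - (V \+ \- f) u)%:E = (\int[mu]_(s in `]u, v]) (g s)%:E)%E &
    {ae mu, forall x, a < x < b -> is_derive x 1 (V \+ \- f) (g x)}].
  apply: mono; first exact: ac_funD.
  move=> u v au uv vb /=.
  suff : f v - f u <= V v - V u by lra.
  rewrite VD//; apply: le_trans (ler_norm _) _; rewrite -lee_fin fineK ?fin//.
  exact: total_variation_ge.
exists (g1 \- g2); split.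
- by rewrite (_ : EFin \o _ = (EFin \o g1) \- (EFin \o g2))%E//; exact: integrableB.
- move=> u v au uv vb.
  have m : measurable (`]u, v]%classic : set (measurableTypeR R)) by exact: measurable_itv.
  rewrite (_ : (fun s => _) = (EFin \o g1) \- (EFin \o g2))%E//.
  rewrite integralB//; [|by apply: integrableS ig1|by apply: integrableS ig2].
  by rewrite -g1E// -g2E//= -EFinB; congr EFin; ring.
- apply: (filterS2 (ae_filter_ringOfSetsType mu) _ dg1 dg2).
  move=> x d1 d2 xab.
  have := is_deriveB (d1 xab) (d2 xab).
  by congr (is_derive _ _ _ _); apply/funext => y /=; rewrite !fctE /=; ring.
Unshelve. all: by end_near. Qed.

Lemma ac_fun_derivable a b f : a <= b -> ac_fun a b f ->
  {ae mu, forall x, a < x < b -> derivable f x 1}.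
Proof.
move=> ab /(ac_fun_density ab)[g [_ _]].
apply: filterS; first exact: (ae_filter_ringOfSetsType mu).
by move=> x dx /dx [].
Qed.

(** The increment of f is the integral of its density, which is its derivative
    almost everywhere. *)
Lemma ac_fun_decreasing a b f : a <= b -> ac_fun a b f ->
  {ae mu, forall x, a < x < b -> derivable f x 1 -> 'D_1 f x <= 0} -> f b <= f a.
Proof.
move=> ab /(ac_fun_density ab)[g [ig gE dg]] df.
rewrite -subr_le0 -lee_fin gE//.
have m : measurable (`]a, b]%classic : set (measurableTypeR R)) by exact: measurable_itv.
have mo : measurable (`]a, b[%classic : set (measurableTypeR R)) by exact: measurable_itv.
have igo : mu.-integrable `]a, b[ (EFin \o g) by apply: integrableS ig.
have mg := measurable_int _ igo.
rewrite -[leLHS]/(\int[mu]_(x in `]a, b]) (EFin \o g) x)%E (integral_itv_bndoo _ _ mg).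
rewrite integralE.
have -> : (\int[mu]_(x in `]a, b[) ((EFin \o g)^\+ x) = \int[mu]_(x in `]a, b[) (cst 0 x))%E.
  apply: ae_eq_integral => //; first exact: measurable_realfun.measurable_funepos.
  apply: (filterS2 (ae_filter_ringOfSetsType mu) _ dg df) => x d1 d2 /=.
  rewrite in_itv /= => xab; have dfx := d1 xab; have := d2 xab (@ex_derive _ _ _ _ _ _ _ dfx).
  rewrite derive_val => gx; rewrite funeposE /=.
  by apply/max_idPr; rewrite lee_fin.
by rewrite integral0 sub0e oppe_le0; apply: integral_ge0 => x _; exact: funeneg_ge0.
Qed.

End AbsolutelyContinuousFunctions.

(** * Tangent vectors and velocities *)

Section ChainRule.
Context {R : realType} {U V W : normedModType R}.

Lemma derive_comp_diff (g : U -> V) (h : V -> W) a y v : g a = y ->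
  differentiable g a -> differentiable h y ->
  'D_v (h \o g) a = 'd h y ('d g a v).
Proof.
move=> <- dg dh; rewrite deriveE; last exact: differentiable_comp.
by rewrite diff_comp.
Qed.

End ChainRule.

Section TangentVectors.
Context {R : realType} {n : nat} {M : smoothManifold R n}.
Implicit Types (x : M) (i j k : chart M) (gamma beta : R -> M) (s : R).

Lemma near_chart i x (A : set M) : dom i x -> nbhs x A ->
  \forall p \near phi i x, cod i p /\ A (phi_inv i p).
Proof.
move=> ix xA; near=> p; split; near: p.
  by apply: open_nbhs_nbhs; split; [exact: open_cod|exact: phi_cod].
by apply: (phi_inv_continuous (phi_cod ix)); rewrite phiK.
Unshelve. all: by end_near. Qed.

Lemma near_dom i x : dom i x -> \forall y \near x, dom i y.
Proof. by move=> ix; apply: open_nbhs_nbhs; split => //; exact: open_dom. Qed.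

Lemma transition_differentiable i j x : dom i x -> dom j x ->
  differentiable (phi j \o phi_inv i) (phi i x).
Proof.
move=> ix jx; have [+ _] := transition_smooth i j 1%N; apply.
by exists x.
Qed.

(** The chain rule, for two transition maps whose composition is a third one
    only near the point. *)
Lemma transition_cocycle i j k x w : dom i x -> dom j x -> dom k x ->
  'd (phi k \o phi_inv j) (phi j x) ('d (phi j \o phi_inv i) (phi i x) w) =
  'd (phi k \o phi_inv i) (phi i x) w.
Proof.
move=> ix jx kx.
have dij := transition_differentiable ix jx; have djk := transition_differentiable jx kx.
have xE : (phi j \o phi_inv i) (phi i x) = phi j x by rewrite /= phiK.
rewrite -[RHS]deriveE; last exact: transition_differentiable.
have -> : 'D_w (phi k \o phi_inv i) (phi i x) =
    'D_w ((phi k \o phi_inv j) \o (phi j \o phi_inv i)) (phi i x).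
  apply: near_eq_derive.
  have : nbhs x (dom j) by exact: near_dom.
  move=> /(near_chart ix); apply: filterS => p [ip jp] /=.
  by rewrite phiK.
by rewrite (derive_comp_diff _ xE).
Qed.

Lemma transition_id i x w : dom i x -> 'd (phi i \o phi_inv i) (phi i x) w = w.
Proof.
move=> ix; rewrite -deriveE; last exact: transition_differentiable.
rewrite -[RHS](derive_id (phi i x)); apply: near_eq_derive.
have := near_chart ix (near_dom ix); apply: filterS => p [ip _] /=.
by rewrite phi_invK.
Qed.

Lemma tangent_inj i x (v w : tangent x) : dom i x -> v i = w i -> v = w.
Proof.
move=> ix vw; apply: val_inj; apply/funext => j /=.
have /asboolP[v1 v0] := coordP v; have /asboolP[w1 w0] := coordP w.
have [jx|jx] := pselect (dom j x); last by rewrite v0// w0.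
by rewrite (v1 i j)// (w1 i j)// vw.
Qed.

(** The vectors obtained from w by the differentials of the transition maps form
    a tangent vector by the cocycle property. *)
Lemma tangent_exists i x w : dom i x -> exists v : tangent x, v i = w.
Proof.
move=> ix.
pose c j := if pselect (dom j x) then 'd (phi j \o phi_inv i) (phi i x) w else 0.
have cE j : dom j x -> c j = 'd (phi j \o phi_inv i) (phi i x) w.
  by rewrite /c; case: pselect.
have cP : c \in tangent_family x.
  apply/asboolP; split => [j k jx kx|j jx]; last by rewrite /c; case: pselect.
  rewrite (cE _ jx) (cE _ kx); exact/esym/transition_cocycle.
exists (Tangent cP); rewrite /= (cE _ ix); exact: transition_id.
Qed.

Lemma is_derive_diff_comp (V W : normedModType R) (h : V -> W) (g : R -> V) s w :
  differentiable h (g s) -> is_derive s 1 g w ->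
  is_derive s 1 (h \o g) ('d h (g s) w).
Proof.
move=> dh [/derivable1_diffP dg <-]; apply: DeriveDef.
  by apply/derivable1_diffP; exact: differentiable_comp.
by rewrite (derive_comp_diff _ erefl)// deriveE.
Qed.

Lemma has_velocity_chart gamma s i (v : tangent (gamma s)) :
  {for s, continuous gamma} -> dom i (gamma s) ->
  is_derive s 1 (phi i \o gamma) (v i) -> has_velocity v.
Proof.
move=> cg ix dg; split => // j jx.
have /asboolP[v1 _] := coordP v; rewrite (v1 i j)//.
have := is_derive_diff_comp (transition_differentiable ix jx) dg.
apply: near_eq_is_derive.
near=> u; rewrite /= phiK//; near: u; exact: (cg _ (near_dom ix)).
Unshelve. all: by end_near. Qed.

Lemma has_velocity_inj gamma s (v w : tangent (gamma s)) :
  has_velocity v -> has_velocity w -> v = w.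
Proof.
move=> [_ dv] [_ dw]; have [i ix] := dom_cover (gamma s).
apply: (tangent_inj ix).
by rewrite -(@derive_val _ _ _ _ _ _ _ (dv i ix)) -(@derive_val _ _ _ _ _ _ _ (dw i ix)).
Qed.

Lemma velocityE gamma s (v : tangent (gamma s)) : has_velocity v -> velocity gamma s = v.
Proof.
move=> hv; apply: xget_unique => // w hw; exact: has_velocity_inj.
Qed.

(** Where there is no velocity, the default value 0 has speed 0 for every
    Finsler structure, so that comparisons of speeds are trivial there. *)
Lemma velocity_dichotomy gamma s :
  has_velocity (velocity gamma s) \/ velocity gamma s = 0.
Proof. by rewrite /velocity; case: xgetP => [v -> hv|_]; [left|right]. Qed.

Lemma velocity_chart gamma s i w : {for s, continuous gamma} -> dom i (gamma s) ->
  is_derive s 1 (phi i \o gamma) w -> velocity gamma s i = w.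
Proof.
move=> cg ix dg; have [v vw] := tangent_exists w ix.
by rewrite (@velocityE _ _ v)//; apply: (has_velocity_chart cg ix); rewrite vw.
Qed.

End TangentVectors.

(** * Finsler structures in charts *)

Section LocalExpressions.
Context {R : realType} {n : nat} {M : smoothManifold R n}.
Implicit Types (F : forall x : M, tangent x -> R) (i : chart M).

Lemma local_weak_norm F i f p : local_expr F i f -> (forall x, weak_norm (F x)) ->
  cod i p -> weak_norm (fun w => f (p, w)).
Proof.
move=> fF NF ip; set x := phi_inv i p.
have ix : dom i x by exact: phi_inv_dom.
have fE (v : tangent x) : f (p, v i) = F x v by rewrite fF// phi_invK.
have [N0 ND NZ Neq] := NF x.
split.
- by move=> w; have [v <-] := tangent_exists w ix; rewrite fE.
- move=> w1 w2; have [v1 <-] := tangent_exists w1 ix; have [v2 <-] := tangent_exists w2 ix.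
  by rewrite -[v1 i + v2 i]/((v1 + v2 : tangent x) i) !fE.
- move=> l w l0; have [v <-] := tangent_exists w ix.
  by rewrite -[l *: v i]/((l *: v : tangent x) i) !fE NZ.
- move=> w; have [v <-] := tangent_exists w ix; rewrite fE Neq.
  by split => [->//|v0]; apply: (tangent_inj ix).
Qed.

Lemma continuous_distl (p0 : 'rV[R]_n) : continuous (fun p : 'rV[R]_n => `|p - p0|).
Proof.
move=> p.
have H : (fun q : 'rV[R]_n => q - p0) @ p --> p - p0.
  by apply: (@cvgB _ _ _ _ (nbhs_filter p)); [exact: cvg_id|exact: cvg_cst].
exact: (cvg_norm H).
Qed.

Lemma near_norm (p : 'rV[R]_n) (e : R) : 0 < e -> \forall q \near p, `|q - p| < e.
Proof.
by move=> e0; apply/nbhs_ballP; exists e => // q; rewrite -ball_normE /= distrC.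
Qed.

Lemma near_normP (p : 'rV[R]_n) (A : set 'rV[R]_n) : nbhs p A ->
  exists2 e : R, 0 < e & forall q, `|q - p| < e -> A q.
Proof.
move=> /nbhs_ballP[e e0 eA]; exists e => // q qp; apply: eA.
by rewrite -ball_normE /= distrC.
Qed.

Lemma compact_norm_level (D : set R) (p0 : 'rV[R]_n) (r : R) : closed D ->
  (forall y, D y -> y <= r) -> compact [set p : 'rV[R]_n | D `|p - p0|].
Proof.
move=> cD Dr; apply: bounded_closed_compact.
  exists (r + `|p0|); split; first exact: num_real.
  move=> x rx p /= /Dr pr; apply/ltW/(le_lt_trans _ rx).
  by rewrite -[p in leLHS](subrK p0) (le_trans (ler_normD _ _))// lerD2r.
have -> : [set p : 'rV[R]_n | D `|p - p0|] = (fun p => `|p - p0|) @^-1` D by [].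
apply: preimage_closed cD => p _; exact: continuous_distl.
Qed.

Lemma compact_chart_ball i (p0 : 'rV[R]_n) r :
  (forall p, `|p - p0| <= r -> cod i p) ->
  compact (phi_inv i @` [set p | `|p - p0| <= r] : set M).
Proof.
move=> rP; apply: continuous_compact; last first.
  by apply: (@compact_norm_level [set y | y <= r] p0 r) => //; exact: closed_le.
apply: continuous_in_subspaceT => p /set_mem pD.
by apply: phi_inv_continuous; exact: rP.
Qed.

(** Compact sets are closed in a Hausdorff space. *)
Lemma closed_chart_ball i (p0 : 'rV[R]_n) r :
  (forall p, `|p - p0| <= r -> cod i p) ->
  closed [set z : M | dom i z /\ `|phi i z - p0| <= r].
Proof.
move=> rP.
have -> : [set z : M | dom i z /\ `|phi i z - p0| <= r] =
    phi_inv i @` [set p | `|p - p0| <= r].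
  apply/seteqP; split => z /=.
    by move=> [iz zr]; exists (phi i z) => //; exact: phiK.
  by move=> [p pD <-]; have ip := rP _ pD; split; [exact: phi_inv_dom|rewrite phi_invK].
apply: compact_closed; first exact: manifold_hausdorff.
exact: compact_chart_ball.
Qed.

Lemma compact_sphere : compact [set v : 'rV[R]_n | `|v| = 1].
Proof.
have := @compact_norm_level [set 1] 0 1 (@closed_eq _ _) _.
have -> : [set p : 'rV[R]_n | [set 1] `|p - 0|] = [set v | `|v| = 1].
  by apply/seteqP; split => v /=; rewrite subr0.
by apply => y ->.
Qed.

Lemma weak_norm0 (V : lmodType R) (N : V -> R) : weak_norm N -> N 0 = 0.
Proof. by move=> [_ _ _ H]; apply/H. Qed.

(** N has positive extrema on the unit sphere, which is compact; for n = 0 the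
    sphere is empty and there is nothing to compare. *)
Lemma weak_norm_comparison (N : 'rV[R]_n -> R) : weak_norm N -> continuous N ->
  exists c C, [/\ 0 < c, 0 < C & forall v, c * `|v| <= N v /\ N v <= C * `|v|].
Proof.
move=> wN cN; have [N0 ND NZ Neq] := wN.
have [[v1 v1S]|S0] := pselect (exists v : 'rV[R]_n, `|v| = 1); last first.
  have all0 (v : 'rV[R]_n) : v = 0.
    apply: contra_notP S0 => /eqP v0; exists (`|v|^-1 *: v).
    by rewrite normrZ normfV normr_id mulVf// normr_eq0.
  by exists 1, 1; split => // v; rewrite (all0 v) (weak_norm0 wN) normr0 mulr0.
pose S := [set v : 'rV[R]_n | `|v| = 1].
have cS : compact S := compact_sphere.
have cNS : {within S, continuous N} by exact: continuous_subspaceT.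
have S1 : S !=set0 by exists v1.
have [vm /set_mem vmS minN] := EVT_min_rV S1 cS cNS.
have [vM /set_mem vMS maxN] := EVT_max_rV S1 cS cNS.
have Npos v : S v -> 0 < N v.
  move=> vS; rewrite lt_neqAle N0 andbT eq_sym; apply/eqP => /Neq v0.
  by move: vS; rewrite /S /= v0 normr0 => /eqP; rewrite eq_sym oner_eq0.
exists (N vm), (N vM); split; [exact: Npos|exact: Npos|move=> v].
have [->|v0] := eqVneq v 0; first by rewrite normr0 !mulr0 (weak_norm0 wN).
have nv : 0 < `|v| by rewrite normr_gt0.
have uS : (`|v|^-1 *: v) \in S.
  by apply/mem_set; rewrite /S /= normrZ normfV normr_id mulVf// gt_eqF.
have NE : N v = `|v| * N (`|v|^-1 *: v).
  by rewrite NZ ?invr_ge0 ?ltW// mulrA divff ?mul1r// gt_eqF.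
by rewrite NE ![_ * `|v|]mulrC !ler_pM2l// minN// maxN.
Qed.

(** On the compact unit sphere the continuity of f in p is uniform, and
    homogeneity extends the estimate from the sphere, where N is bounded below,
    to all vectors. *)
Lemma finsler_frame (F : forall x : M, tangent x -> R) i f p0 (e : R) : local_expr F i f ->
  (forall x, weak_norm (F x)) -> (forall p, cod i p.1 -> {for p, continuous f}) ->
  cod i p0 -> 0 < e ->
  exists2 r, 0 < r & forall p v, `|p - p0| < r ->
    cod i p /\ `|f (p, v) - f (p0, v)| <= e * f (p0, v).
Proof.
move=> fF NF fc ip0 e0.
pose N v := f (p0, v).
have wN : weak_norm N := local_weak_norm fF NF ip0.
have cN : continuous N.
  move=> v; apply: (@continuous_comp _ _ _ (fun w => (p0, w)) f); last exact: fc.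
  move=> A [[B C] [/= pB vC] BCA]; apply: (@filterS _ _ (nbhs_filter v)) vC => w Cw.
  by apply: BCA; split => //=; exact: nbhs_singleton.
have [c [C [c0 C0 cC]]] := weak_norm_comparison wN cN.
pose S := [set v : 'rV[R]_n | `|v| = 1].
have cS : compact S := compact_sphere.
have := (@compact_near_coveringP _ S).1 cS _ (nbhs p0) (fun p v => `|f (p, v) - N v| < e * c) _.
have cont v : S v -> \forall v' \near v & p \near p0, `|f (p, v') - N v'| < e * c.
  move=> vS.
  have : {for (p0, v), continuous (fun q : 'rV[R]_n * 'rV[R]_n => f q - N q.2)}.
    apply: (@cvgB _ _ _ _ (nbhs_filter (p0, v))); first exact: fc.
    by apply: (@continuous_comp _ _ _ snd N); [exact: cvg_snd|exact: cN].
  move=> /cvgrPdist_lt/(_ (e * c) (mulr_gt0 e0 c0)) [[A B] [/= pA vB] AB].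
  exists (B, A) => //= -[v' p] [/= Bv' Ap].
  have := AB (p, v') (conj Ap Bv').
  by rewrite /= /N subrr sub0r normrN.
move=> /(_ _ cont) nS.
have icod : \forall p \near p0, cod i p by apply: open_nbhs_nbhs; split => //; exact: open_cod.
have [r r0 rP] : exists2 r, 0 < r & forall p, `|p - p0| < r -> cod i p /\ S `<=` (fun v => `|f (p, v) - N v| < e * c).
  exact: near_normP (filterI icod nS).
exists r => // p v pr; have [ip Sp] := rP p pr; split => //.
have [fp0 _ fpZ _] := local_weak_norm fF NF ip.
have [N0 _ NZ _] := wN.
have [->|v0] := eqVneq v 0.
  have f0 := weak_norm0 wN; rewrite /N in f0.
  by rewrite f0 (weak_norm0 (local_weak_norm fF NF ip)) subrr normr0 mulr0.
have nv : 0 < `|v| by rewrite normr_gt0.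
have uS : S (`|v|^-1 *: v) by rewrite /S /= normrZ normfV normr_id mulVf// gt_eqF.
have vE : v = `|v| *: (`|v|^-1 *: v) by rewrite scalerA divff ?scale1r// gt_eqF.
have -> : f (p, v) = `|v| * f (p, `|v|^-1 *: v) by rewrite -fpZ ?ltW// -vE.
have NvE : f (p0, v) = `|v| * N (`|v|^-1 *: v) by rewrite -NZ ?ltW// -vE.
rewrite [X in `|_ - X|]NvE -mulrBr normrM normr_id.
apply: (@le_trans _ _ (`|v| * (e * c))); first by rewrite ler_pM2l// ltW// Sp.
have [+ _] := cC v; rewrite -/(N v) mulrCA mulrC => cv.
by rewrite ler_pM2l.
Qed.

End LocalExpressions.

(** * Speed of a path *)

Lemma near_eq_continuous (S T : topologicalType) (f g : S -> T) s :
  (\forall u \near s, f u = g u) -> {for s, continuous f} -> {for s, continuous g}.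
Proof.
move=> fg; rewrite /prop_for /continuous_at -(nbhs_singleton fg) => cf.
by apply: cvg_trans cf; exact: near_eq_cvg.
Qed.

Lemma continuous_pair (S A B : topologicalType) (f : S -> A) (g : S -> B) s :
  {for s, continuous f} -> {for s, continuous g} ->
  {for s, continuous (fun u => (f u, g u))}.
Proof.
move=> cf cg P [[X Y] [/= /cf fX /cg gY] XYP].
have fX' : \forall u \near s, X (f u) := fX.
have gY' : \forall u \near s, Y (g u) := gY.
suff : \forall u \near s, P (f u, g u) by [].
by apply: filterS2 fX' gY' => u fu gu; apply: XYP.
Qed.

Section Speed.
Context {R : realType} {n : nat} {M : smoothManifold R n}.
Variable F : forall x : M, tangent x -> R.
Hypothesis fin_F : finsler F.
Implicit Types (i : chart M) (gamma beta g : R -> M) (s a b c : R).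
Local Notation mu := (@lebesgue_measure R).

Definition speed gamma s : R := F (velocity gamma s).

Lemma speed_ge0 gamma s : 0 <= speed gamma s.
Proof. by have [+ _ _ _] := fin_F.2 (gamma s); exact. Qed.

Lemma speed_chart gamma s i f w : local_expr F i f -> {for s, continuous gamma} ->
  dom i (gamma s) -> is_derive s 1 (phi i \o gamma) w ->
  speed gamma s = f (phi i (gamma s), w).
Proof.
by move=> fF cg ix dg; rewrite /speed (fF _ _ ix) (velocity_chart cg ix dg).
Qed.

Lemma speed_eq gamma s beta u : gamma s = beta u ->
  ({for s, continuous gamma} <-> {for u, continuous beta}) ->
  (forall i w, is_derive s 1 (phi i \o gamma) w <-> is_derive u 1 (phi i \o beta) w) ->
  speed gamma s = speed beta u.
Proof.
move=> gb cgb dgb; have [i ix] := dom_cover (gamma s).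
have ix' : dom i (beta u) by rewrite -gb.
have [/(_ i)[f fF _] NF] := fin_F.
have [[cg dg]|v0] := velocity_dichotomy gamma s.
  rewrite (speed_chart fF cg ix (dg i ix)) (speed_chart fF (cgb.1 cg) ix' ((dgb _ _).1 (dg i ix))).
  by congr (f (phi i _, _)).
have [[cb db]|w0] := velocity_dichotomy beta u.
  rewrite (speed_chart fF cb ix' (db i ix')) (speed_chart fF (cgb.2 cb) ix ((dgb _ _).2 (db i ix'))).
  by congr (f (phi i _, _)).
by rewrite /speed v0 w0 !(weak_norm0 (NF _)).
Qed.

Lemma speed_near gamma beta s : (\forall u \near s, gamma u = beta u) ->
  speed gamma s = speed beta s.
Proof.
move=> gb; have gbs := nbhs_singleton gb.
have bg : \forall u \near s, beta u = gamma u by apply: filterS gb => u ->.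
apply: speed_eq => //.
- by split; apply: near_eq_continuous.
- move=> i w; split; apply: near_eq_is_derive; [move: gb|move: bg]; apply: filterS => u /= -> //.
Qed.

Lemma speed_shift gamma c s : speed (fun u => gamma (u + c)) s = speed gamma (s + c).
Proof.
apply: speed_eq => //.
- split=> cg.
  + have -> : gamma = (fun u => gamma (u + c)) \o (fun u => u - c).
      by apply/funext => u /=; rewrite subrK.
    apply: continuous_comp; last by rewrite addrK.
    by apply: cvgB; [exact: cvg_id|exact: cvg_cst].
  + apply: (@continuous_comp _ _ _ (fun u => u + c)) => //.
    by apply: cvgD; [exact: cvg_id|exact: cvg_cst].
- move=> i w; have E : (fun h : R => h^-1 *: (((phi i \o (fun u => gamma (u + c))) \o shift s) (h *: 1)
      - (phi i \o (fun u => gamma (u + c))) s)) =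
    (fun h : R => h^-1 *: (((phi i \o gamma) \o shift (s + c)) (h *: 1) - (phi i \o gamma) (s + c))).
    by apply/funext => h /=; rewrite addrA.
  by split=> -[dg <-]; apply: DeriveDef; move: dg; rewrite /derivable /derive E.
Qed.

Lemma C1_near_speed g s : C1_near g s -> {for s, continuous (speed g)}.
Proof.
move=> gs; have [cg dg] := nbhs_singleton gs.
have [i ix] := dom_cover (g s); have [/(_ i)[f fF fc] NF] := fin_F.
have [dig cdig] := dg i ix.
have E : \forall u \near s, f (phi i (g u), derive1 (phi i \o g) u) = speed g u.
  near=> u; have [cu du] : {for u, continuous g} /\ (forall i, dom i (g u) ->
      derivable (phi i \o g) u 1 /\ {for u, continuous (derive1 (phi i \o g))}).
    by near: u.
  have iu : dom i (g u) by near: u; exact: cg (near_dom ix).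
  rewrite (speed_chart fF cu iu (derivableP (du i iu).1)).
  by rewrite derive1E.
apply: near_eq_continuous E _.
apply: (@continuous_comp _ _ _ (fun u => (phi i (g u), derive1 (phi i \o g) u)) f); last first.
  by apply: fc => /=; exact: phi_cod.
apply: continuous_pair => //; apply: continuous_comp => //.
exact: phi_continuous.
Unshelve. all: by end_near. Qed.

Lemma C1_within_interior a b beta s : a < s < b -> C1_within `[a, b] beta s ->
  C1_near beta s.
Proof.
move=> /andP[as_ sb] [g gs gb].
have {}gb : \forall u \near s, g u = beta u.
  near=> u; have := near gb u; apply => //; rewrite /= in_itv /=; apply/andP; split.
    by apply/ltW; near: u; exact: lt_nbhsr.
  by apply/ltW; near: u; exact: lt_nbhsl.
have {gb} gb : \forall u \near s, \forall v \near u, g v = beta v by apply: nbhs_interior.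
move: gs gb; apply: filterS2 => u [cu du] gbu; have gu := nbhs_singleton gbu.
split.
  exact: near_eq_continuous gbu cu.
move=> i; rewrite -gu => /du[di ci].
have E : \forall v \near u, derive1 (phi i \o g) v = derive1 (phi i \o beta) v.
  move/nbhs_interior : gbu; apply: filterS => v gbv.
  by rewrite !derive1E; apply: near_eq_derive; apply: filterS gbv => w /= ->.
split.
  by apply: near_eq_derivable di; apply: filterS gbu => v /= ->.
exact: near_eq_continuous E ci.
Unshelve. all: by end_near. Qed.

Lemma C1_within_cvg a b beta s : a <= s <= b -> C1_within `[a, b] beta s ->
  beta @ within `[a, b] (nbhs s) --> beta s.
Proof.
move=> sab [g gs gb].
have [cg _] := nbhs_singleton gs.
have gbs : g s = beta s by apply: (nbhs_singleton gb); rewrite /= in_itv.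
move=> A; rewrite -gbs => /cg gA.
rewrite /= /nbhs /= /within /=.
by move: gb gA; apply: filterS2 => u gbu Agu uab; rewrite -gbu.
Qed.

End Speed.

(** * Lengths of piecewise C^1 paths *)

Section PathLength.
Context {R : realType} {n : nat} {M : smoothManifold R n}.
Variable F : forall x : M, tangent x -> R.
Hypothesis fin_F : finsler F.
Implicit Types (i : chart M) (gamma beta g : R -> M) (s a b c : R).
Local Notation mu := (@lebesgue_measure R).
Local Notation spd := (speed F).

(** Statements about piecewise C^1 paths follow from their stability under
    concatenation and from the case of one piece. *)
Lemma piecewise_C1_ind (P : R -> R -> Prop) beta :
  (forall a, P a a) ->
  (forall a c b, a <= c -> c <= b -> P a c -> P c b -> P a b) ->
  (forall a b, a < b -> (forall s, a <= s <= b -> C1_within `[a, b] beta s) -> P a b) ->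
  forall a b, piecewise_C1 a b beta -> a <= b /\ P a b.
Proof.
move=> P0 Pc Pp a b [k [t [<- <- tm tC]]] {a b}.
elim: k tm tC => [|k IH] tm tC; first by split.
have [||l1 P1] := IH; [by move=> j jk; apply: tm; exact: ltnW|
  by move=> j jk; apply: tC; exact: ltnW|].
have l2 := ltW (tm k (ltnSn k)).
split; first exact: le_trans l1 l2.
apply: Pc l1 l2 P1 _; apply: Pp; first exact: tm.
by move=> s sP; apply: tC => //; rewrite /= in_itv.
Qed.

Lemma piecewise_C1_le a b beta : piecewise_C1 a b beta -> a <= b.
Proof. by move=> /(@piecewise_C1_ind (fun _ _ => True))[]. Qed.

Lemma piece_measurable a b beta : a < b ->
  (forall s, a <= s <= b -> C1_within `[a, b] beta s) ->
  measurable_fun `[a, b]%classic (spd beta).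
Proof.
move=> ab C; apply: (@measurable_fun_itv_cc _ a b false true).
apply: open_continuous_measurable_fun; first exact: interval_open.
move=> s /set_mem; rewrite /= in_itv /= => /[dup] sab /andP[as_ sb].
have Cs : C1_near beta s by apply: (C1_within_interior sab); apply: C; rewrite !ltW.
exact: (C1_near_speed fin_F Cs).
Qed.

Definition measurable_speed a b beta := measurable_fun `[a, b]%classic (spd beta).

Lemma measurable_speed_sub a b a' b' beta : a <= a' -> b' <= b ->
  measurable_speed a b beta -> measurable_speed a' b' beta.
Proof.
move=> aa bb; apply: measurable_funS; first exact: measurable_itv.
by apply: subset_itv; rewrite bnd_simp.
Qed.

Lemma measurable_speed_cat a c b beta : a <= c -> c <= b ->
  measurable_speed a c beta -> measurable_speed c b beta -> measurable_speed a b beta.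
Proof.
move=> ac cb m1 m2; rewrite /measurable_speed.
have -> : `[a, b]%classic = `[a, c] `|` `[c, b].
  apply/seteqP; split => s /=; rewrite !in_itv /=; last by case; lra.
  by move=> sab; have [sc|sc] := leP s c; [left|right]; lra.
by apply/measurable_funU => //; exact: measurable_itv.
Qed.

Lemma measurable_speed1 a beta : measurable_speed a a beta.
Proof. by rewrite /measurable_speed set_itv1; exact: measurable_fun_set1. Qed.

Lemma piecewise_measurable a b beta : piecewise_C1 a b beta -> measurable_speed a b beta.
Proof.
move=> /(@piecewise_C1_ind (fun a b => measurable_speed a b beta))[] //.
- by move=> *; exact: measurable_speed1.
- move=> u v w; exact: measurable_speed_cat.
- by move=> u v; exact: piece_measurable.
Qed.

Lemma length_ge0 a b beta : (0 <= finsler_length F a b beta)%E.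
Proof. by apply: integral_ge0 => s _; rewrite lee_fin; exact: speed_ge0. Qed.

Lemma length1 a beta : finsler_length F a a beta = 0%E.
Proof. by rewrite /finsler_length set_itv1 integral_set1. Qed.

Lemma length_cat a c b beta : a <= c -> c <= b -> measurable_speed a b beta ->
  finsler_length F a b beta = (finsler_length F a c beta + finsler_length F c b beta)%E.
Proof.
move=> ac cb m; rewrite /finsler_length.
have mE : measurable_fun `[a, b]%classic (EFin \o spd beta) by exact/measurable_EFinP.
have E : `[a, b]%classic = `[a, c] `|` `]c, b].
  apply/seteqP; split => s /=; rewrite !in_itv /=; last by case; lra.
  by move=> sab; have [sc|sc] := leP s c; [left|right]; lra.
rewrite {1}E ge0_integral_setU.
- congr (_ + _)%E; apply: integral_itv_obnd_cbnd.
  by apply: measurable_funS mE => //; rewrite E; exact: subsetUr.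
- exact: measurable_itv.
- exact: measurable_itv.
- by rewrite -E.
- by move=> s _; rewrite lee_fin; exact: speed_ge0.
- apply/disj_setPS => s [] /=; rewrite !in_itv /=; lra.
Qed.

Lemma length_eq_near a b beta gamma : (forall s, a < s < b -> spd beta s = spd gamma s) ->
  measurable_speed a b beta -> measurable_speed a b gamma /\
  finsler_length F a b beta = finsler_length F a b gamma.
Proof.
move=> E m.
have m1 : measurable_fun `]a, b[ (spd beta).
  by apply: measurable_funS m; [exact: measurable_itv|exact: subset_itv_oo_cc].
have m2 : measurable_fun `]a, b[ (spd gamma).
  by apply: eq_measurable_fun m1 => s /set_mem; rewrite /= in_itv /= => /E.
split; first exact: measurable_fun_itv_cc m2.
rewrite /finsler_length (@integral_itv_bndoo _ a b (EFin \o spd beta)); last exact/measurable_EFinP.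
rewrite (@integral_itv_bndoo _ a b (EFin \o spd gamma)); last exact/measurable_EFinP.
by apply: eq_integral => s /set_mem; rewrite /= in_itv /= => /E ->.
Qed.

Lemma lebesgue_shift (c : R) (A : set (measurableTypeR R)) : measurable A ->
  pushforward mu (fun s : measurableTypeR R => s + c : measurableTypeR R) A = mu A.
Proof.
move=> mA.
have ms : measurable_fun [set: measurableTypeR R] (fun s => s + c : measurableTypeR R).
  by apply: measurable_funD; [exact: measurable_id|exact: measurable_cst].
pose nu : {measure set (measurableTypeR R) -> \bar R} :=
  measure_function_pushforward__canonical__measure_function_Measure mu ms.
apply/esym/(@lebesgue_measure_unique _ nu) => // _ [[u v] _ <-].
rewrite /nu /= /pushforward /=.
have -> : (fun s => s + c) @^-1` `]u, v] = `]u - c, v - c]%classic.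
  by apply/seteqP; split => s /=; rewrite !in_itv /=; lra.
rewrite !lebesgue_measure_itv /= !lte_fin ltrD2r.
by case: ifP => // _; rewrite -!EFinB; congr EFin; ring.
Qed.

Lemma length_shift a b c beta : measurable_speed (a + c) (b + c) beta ->
  measurable_speed a b (fun s => beta (s + c)) /\
  finsler_length F a b (fun s => beta (s + c)) = finsler_length F (a + c) (b + c) beta.
Proof.
move=> m.
have ms : measurable_fun [set: measurableTypeR R] (fun s => s + c : measurableTypeR R).
  by apply: measurable_funD; [exact: measurable_id|exact: measurable_cst].
have spdE : spd (fun s => beta (s + c)) = spd beta \o (fun s => s + c).
  by apply/funext => s /=; exact: speed_shift.
have pre : (fun s => s + c) @^-1` `[a + c, b + c]%classic = `[a, b]%classic.
  by apply/seteqP; split => s /=; rewrite !in_itv /=; lra.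
split.
  rewrite /measurable_speed spdE -pre.
  apply: (measurable_comp (F := `[a + c, b + c])) => //; first exact: image_preimage_subset.
  exact: measurable_funTS ms.
rewrite /finsler_length.
pose g := EFin \o spd beta; pose g' := EFin \o spd (fun s => beta (s + c)).
rewrite -[LHS]/(\int[mu]_(s in `[a, b]) g' s)%E -[RHS]/(\int[mu]_(s in `[(a + c)%R, (b + c)%R]) g s)%E.
have -> : g' = g \o (fun s => s + c) by rewrite /g' spdE.
rewrite -pre.
have m' : measurable_fun (`[a + c, b + c] : set (measurableTypeR R)) g by exact/measurable_EFinP.
have mI : measurable (`[a + c, b + c]%classic : set (measurableTypeR R)) by exact: measurable_itv.
have := ge0_integral_pushforward ms mu mI m'.
move=> /(_ _)/esym -> //; last by move=> y _ /=; rewrite lee_fin; exact: speed_ge0.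
apply: eq_measure_integral => A mA _; exact: lebesgue_shift.
Qed.

End PathLength.

(** * Concatenation of paths and the triangle inequality *)

Section PathConcatenation.
Context {R : realType} {n : nat} {M : smoothManifold R n}.
Variable F : forall x : M, tangent x -> R.
Hypothesis fin_F : finsler F.
Implicit Types (i : chart M) (gamma beta g : R -> M) (s a b c : R) (x y z : M).
Local Notation mu := (@lebesgue_measure R).
Local Notation spd := (speed F).

Lemma derivable_shift (V : normedModType R) (h : R -> V) c s :
  derivable (fun u => h (u + c)) s 1 = derivable h (s + c) 1 /\
  derive1 (fun u => h (u + c)) s = derive1 h (s + c).
Proof.
rewrite !derive1E /derivable /derive.
have -> // : (fun k : R => k^-1 *: (((fun u => h (u + c)) \o shift s) (k *: 1) - h (s + c))) =
    (fun k : R => k^-1 *: ((h \o shift (s + c)) (k *: 1) - h (s + c))).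
by apply/funext => k /=; rewrite addrA.
Qed.

Lemma near_shiftr (P : set R) c s : (\forall u \near s + c, P u) -> \forall u \near s, P (u + c).
Proof.
have cc : (fun u => u + c) @ s --> s + c by apply: cvgD; [exact: cvg_id|exact: cvg_cst].
by move=> /cc.
Qed.

Lemma continuous_shiftr (T : topologicalType) (h : R -> T) c s :
  {for s + c, continuous h} -> {for s, continuous (fun u => h (u + c))}.
Proof. by move=> ch A /ch/near_shiftr. Qed.

Lemma C1_near_shift g c s : C1_near g (s + c) -> C1_near (fun u => g (u + c)) s.
Proof.
move=> /near_shiftr; apply: filterS => u [cg dg]; split.
  exact: continuous_shiftr cg.
move=> i iu; have [d1 d2] := dg i iu; split.
  by have [-> _] := derivable_shift (phi i \o g) c u.
have -> : derive1 (phi i \o (fun v => g (v + c))) = fun v => derive1 (phi i \o g) (v + c).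
  by apply/funext => v; have [_ <-] := derivable_shift (phi i \o g) c v.
exact: continuous_shiftr d2.
Qed.

Lemma C1_within_eq (A : set R) beta gamma s : (forall u, A u -> beta u = gamma u) ->
  C1_within A beta s -> C1_within A gamma s.
Proof.
move=> E [g gs gb]; exists g => //; apply: filterS gb => u gu Au.
by rewrite gu// E.
Qed.

Lemma C1_within_sub (A B : set R) beta s : B `<=` A ->
  C1_within A beta s -> C1_within B beta s.
Proof.
by move=> BA [g gs gb]; exists g => //; apply: filterS gb => u gu /BA; exact: gu.
Qed.

Lemma C1_within_shift a b c beta s : C1_within `[a + c, b + c] beta (s + c) ->
  C1_within `[a, b] (fun u => beta (u + c)) s.
Proof.
move=> [g gs gb]; exists (fun u => g (u + c)); first exact: C1_near_shift.
move/near_shiftr : gb; apply: filterS => u gu uab; apply: gu.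
by move: uab; rewrite /= !in_itv /=; lra.
Qed.

Definition path_cat b c beta gamma s := if s <= b then beta s else gamma (s + c).

Lemma piecewise_C1_mono k (t : nat -> R) : (forall j, (j < k)%N -> t j < t j.+1) ->
  forall l j, (l <= j)%N -> (j <= k)%N -> t l <= t j.
Proof.
move=> tm l j ij; elim: j ij => [|j IH].
  by rewrite leqn0 => /eqP ->.
rewrite leq_eqVlt => /predU1P[-> //|ij] jk.
by apply: le_trans (ltW (tm j jk)); apply: IH => //; exact: ltnW.
Qed.

Lemma piecewise_cat a b c beta gamma d : piecewise_C1 a b beta ->
  piecewise_C1 (b + c) d gamma -> beta b = gamma (b + c) ->
  piecewise_C1 a (d - c) (path_cat b c beta gamma).
Proof.
move=> [k [t [t0 tk tm tC]]] [k' [t' [t'0 t'k tm' tC']]] bg.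
have tb := piecewise_C1_mono tm; have tb' := piecewise_C1_mono tm'.
pose T j := if (j <= k)%N then t j else t' (j - k)%N - c.
have Tk : T k = t' 0%N - c by rewrite /T leqnn tk t'0 addrK.
have T1 j : (j < k)%N -> T j = t j /\ T j.+1 = t j.+1.
  by move=> jk; rewrite /T ltnW// jk.
have T2 j : (k <= j)%N -> T j = t' (j - k)%N - c /\ T j.+1 = t' (j - k).+1 - c.
  move=> kj; rewrite {2}/T leqNgt ltnS kj /= subSn//; split => //.
  have [->|jk] := eqVneq j k; first by rewrite Tk subnn.
  by rewrite /T leqNgt ltn_neqAle eq_sym jk kj.
exists (k + k')%N, T; split.
- by rewrite /T /= t0.
- case: k' t'k tm' tC' tb' => [|k'] t'k tm' tC' tb'; first by rewrite addn0 Tk -t'k.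
  by rewrite addnS; have [|_ ->] := T2 (k + k')%N; rewrite ?leq_addr// addKn t'k.
- move=> j jk; have [kj|kj] := leqP k j.
    by have [-> ->] := T2 j kj; rewrite ltrD2r tm'// ltn_subLR// -subSn.
  by have [-> ->] := T1 j kj; exact: tm.
- move=> j jk s; have [kj|kj] := leqP k j.
    have [-> ->] := T2 j kj; have jk' : (j - k < k')%N by rewrite ltn_subLR.
    move=> sj; apply: (@C1_within_eq _ (fun u => gamma (u + c))).
      move=> u; rewrite /= in_itv /= => /andP[u1 _]; rewrite /path_cat.
      have := tb' 0%N (j - k)%N (leq0n _) (ltnW jk').
      rewrite t'0; case: (leP u b) => // ub tj.
      by have -> : u = b by lra.
    apply: C1_within_shift; rewrite !subrK; apply: tC' => //.
    by move: sj; rewrite /= !in_itv /=; lra.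
  have [-> ->] := T1 j kj => sj; apply: (@C1_within_eq _ beta).
    move=> u; rewrite /= in_itv /= => /andP[_ u1]; rewrite /path_cat ifT//.
    by apply: le_trans u1 _; rewrite -tk; exact: tb.
  exact: tC.
Qed.

Lemma finsler_dist_ge0 x y : (0 <= finsler_dist F x y)%E.
Proof.
by apply: le_ereal_inf_tmp => _ [a [b [beta [_ _ _ _ ->]]]]; exact: length_ge0.
Qed.

Lemma finsler_dist_le a b beta : piecewise_C1 a b beta ->
  (finsler_dist F (beta a) (beta b) <= finsler_length F a b beta)%E.
Proof.
move=> pb; apply: ereal_inf_lbound; exists a, b, beta; split => //.
exact: piecewise_C1_le pb.
Qed.

Lemma finsler_dist_lt x y (D : \bar R) : (finsler_dist F x y < D)%E ->
  exists a b beta, [/\ piecewise_C1 a b beta, beta a = x, beta b = y &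
    (finsler_length F a b beta < D)%E].
Proof.
move=> /ereal_inf_lt[_ [a [b [beta [ab pb <- <- ->]]]] lD].
by exists a, b, beta.
Qed.

Lemma piecewise_C1_cst a x : piecewise_C1 a a (fun=> x).
Proof. by exists 0%N, (fun=> a); split. Qed.

Lemma finsler_distxx x : finsler_dist F x x = 0%E.
Proof.
apply/eqP; rewrite eq_le finsler_dist_ge0 andbT.
by have := finsler_dist_le (piecewise_C1_cst 0 x); rewrite length1.
Qed.

(** Two almost shortest paths are concatenated, the second one being shifted in
    time so as to start when the first one ends. *)
Lemma finsler_dist_triangle x y z :
  (finsler_dist F x z <= finsler_dist F x y + finsler_dist F y z)%E.
Proof.
have oo u v : finsler_dist F u v \isn't a fin_num -> finsler_dist F u v = +oo%E.
  by rewrite ge0_fin_numE ?finsler_dist_ge0// -leNgt leye_eq => /eqP.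
have noo u v : finsler_dist F u v != -oo%E.
  by rewrite gt_eqF// (lt_le_trans _ (finsler_dist_ge0 _ _)).
have [xyf|/oo ->] := boolP (finsler_dist F x y \is a fin_num); last first.
  by rewrite addye ?leey.
have [yzf|/oo ->] := boolP (finsler_dist F y z \is a fin_num); last first.
  by rewrite addey ?leey.
apply/lee_addgt0Pr => e e0.
have e20 : 0 < e / 2 by rewrite divr_gt0.
have [|a [b [beta [pb <- by_ lb]]]] := @finsler_dist_lt x y (finsler_dist F x y + (e / 2)%:E).
  by rewrite lteDl// lte_fin.
have [|a' [b' [gam [pg ga <- lg]]]] := @finsler_dist_lt y z (finsler_dist F y z + (e / 2)%:E).
  by rewrite lteDl// lte_fin.
pose c := a' - b; have a'E : a' = b + c by rewrite /c addrC subrK.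
have bg : beta b = gam (b + c) by rewrite -a'E ga.
have pg' : piecewise_C1 (b + c) b' gam by rewrite -a'E.
have pc := piecewise_cat pb pg' bg.
have ab := piecewise_C1_le pb; have ab' := piecewise_C1_le pg.
have m1 := piecewise_measurable fin_F pb; have m2 := piecewise_measurable fin_F pg'.
have mc := piecewise_measurable fin_F pc.
have := finsler_dist_le pc; rewrite {1}/path_cat ab.
have -> : path_cat b c beta gam (b' - c) = gam b'.
  rewrite /path_cat subrK; case: leP => // b'b.
  have -> : b' = b + c by lra.
  by rewrite addrK bg.
move=> /le_trans; apply.
rewrite (@length_cat _ _ _ _ _ a b (b' - c))//; last by lra.
have E1 s : a < s < b -> spd beta s = spd (path_cat b c beta gam) s.
  move=> /andP[_ sb]; apply: (speed_near fin_F); near=> u; rewrite /path_cat ifT//.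
  by apply/ltW; near: u; exact: lt_nbhsl.
have E2 s : b < s < b' - c -> spd (fun s => gam (s + c)) s = spd (path_cat b c beta gam) s.
  move=> /andP[bs _]; apply: (speed_near fin_F); near=> u; rewrite /path_cat ifF//.
  by apply/negbTE; rewrite -ltNge; near: u; exact: lt_nbhsr.
have [_ <-] := length_eq_near E1 m1.
have [|m2' l2] := @length_shift _ _ _ _ fin_F b (b' - c) c gam; first by rewrite subrK.
have [_ <-] := length_eq_near E2 m2'.
rewrite l2 subrK -a'E; apply: le_trans (leeD (ltW lb) (ltW lg)) _.
by rewrite addeACA -EFinD -splitr.
Unshelve. all: by end_near. Qed.

End PathConcatenation.

(** * Functions that grow at most at unit speed *)

Section LengthBounds.
Context {R : realType} {n : nat} {M : smoothManifold R n}.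
Variable F : forall x : M, tangent x -> R.
Hypothesis fin_F : finsler F.
Implicit Types (i j : chart M) (gamma beta g : R -> M) (s a b c : R) (x y z : M).
Local Notation mu := (@lebesgue_measure R).
Local Notation spd := (speed F).
Local Notation L := (finsler_length F).

Definition flen a b beta := fine (L a b beta).

Lemma flen_ge0 a b beta : 0 <= flen a b beta.
Proof. by rewrite fine_ge0// length_ge0. Qed.

Lemma length_fin a b beta u v : measurable_speed F a b beta -> (L a b beta < +oo)%E ->
  a <= u -> u <= v -> v <= b -> L u v beta = (flen u v beta)%:E.
Proof.
move=> m fin au uv vb; rewrite fineK// ge0_fin_numE; last exact: length_ge0.
apply: le_lt_trans fin; rewrite (length_cat fin_F au)//; last exact: le_trans vb.
rewrite [X in (_ + X)%E](length_cat fin_F uv vb); last exact: measurable_speed_sub m.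
by rewrite addeCA leeDl// adde_ge0// length_ge0.
Qed.

Lemma flen_cat a b beta u v w : measurable_speed F a b beta -> (L a b beta < +oo)%E ->
  a <= u -> u <= v -> v <= w -> w <= b ->
  flen u w beta = flen u v beta + flen v w beta.
Proof.
move=> m fin au uv vw wb; apply: EFin_inj.
rewrite EFinD -(length_fin m fin)//; last exact: le_trans vw.
rewrite -!(length_fin m fin)//; [|exact: le_trans uv|exact: le_trans wb].
by rewrite (length_cat fin_F uv vw)//; apply: measurable_speed_sub m.
Qed.

Lemma flen_ge a b beta u v m : measurable_speed F a b beta -> (L a b beta < +oo)%E ->
  a <= u -> u <= v -> v <= b -> 0 <= m -> (forall s, u <= s <= v -> m <= spd beta s) ->
  m * (v - u) <= flen u v beta.
Proof.
move=> ms fin au uv vb m0 mP; rewrite -lee_fin -(length_fin ms fin)//.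
apply: (@le_trans _ _ (\int[mu]_(s in `[u, v]) (cst m%:E s))%E).
  have muE : mu `[u, v]%classic = (v - u)%:E.
    rewrite lebesgue_measure_itv /= lte_fin; case: ltP => uv'; first by rewrite -EFinB.
    by have -> : v = u by [lra]; rewrite subrr.
  rewrite integral_cst; last exact: measurable_itv.
  by rewrite [X in (_ <= _ * X)%E](_ : _ = (v - u)%:E).
apply: ge0_le_integral => //.
  by apply/measurable_EFinP; exact: measurable_speed_sub ms.
Qed.

(** The upper right derivative of u along C^1 paths is at most their speed. Such
    functions are 1-Lipschitz for the metric, which bounds it from below. *)
Definition subspeed (u : M -> R) := continuous u /\
  forall g s, C1_near g s -> forall e, 0 < e -> exists2 d, 0 < d &
    forall h, 0 < h < d -> u (g (s + h)) - u (g s) <= h * (spd g s + e).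

(** The inequality u (beta s) - u (beta a) <= flen a s beta + e (s - a)
    propagates to the right by the bound on the derivative and passes to limits
    by continuity. *)
Lemma subspeed_interior u a b beta : subspeed u -> a < b ->
  (forall s, a <= s <= b -> C1_near beta s) ->
  measurable_speed F a b beta -> (L a b beta < +oo)%E ->
  u (beta b) - u (beta a) <= flen a b beta.
Proof.
move=> [cu du] ab C m fin; apply/ler_addgt0Pr => e0 e00.
pose e := e0 / (b - a).
have e_gt0 : 0 < e by rewrite divr_gt0// subr_gt0.
suff : u (beta b) - u (beta a) <= flen a b beta + e * (b - a).
  by rewrite /e divfK// gt_eqF// subr_gt0.
have f0 : flen a a beta = 0 by rewrite /flen length1.
apply: (@real_induction _ a b (fun s => u (beta s) - u (beta a) <= flen a s beta + e * (s - a))).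
- exact: ltW.
- by rewrite f0 !subrr mulr0 addr0.
- move=> s /andP[as_ sb] Ss; have e20 : 0 < e / 2 by rewrite divr_gt0.
  have Cs : C1_near beta s by apply: C; rewrite as_ ltW.
  have [d d0 dP] := du beta s Cs (e / 2) e20.
  have /cvgrPdist_lt/(_ _ e20)/nbhs_ballP[d' /= d'0 d'P] := C1_near_speed fin_F Cs.
  pose s' := Num.min b (s + Num.min d d' / 2).
  have dd : 0 < Num.min d d' by rewrite lt_min d0 d'0.
  have [dd1 dd2] : Num.min d d' <= d /\ Num.min d d' <= d' by rewrite !ge_min !lexx orbT.
  have s'b : s' <= b by rewrite ge_min lexx.
  have s's : s' <= s + Num.min d d' / 2 by rewrite ge_min lexx orbT.
  have ss' : s < s' by rewrite lt_min sb /=; lra.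
  exists s'; first by rewrite ss'.
  move=> v /andP[sv vs'].
  have vb : v <= b by lra.
  rewrite (flen_cat m fin (lexx a) as_ (ltW sv) vb).
  have {}uv : u (beta v) - u (beta s) <= (v - s) * (spd beta s + e / 2).
    by have := dP (v - s); rewrite [s + _]addrC subrK; apply; lra.
  pose mm := Num.max 0 (spd beta s - e / 2).
  have mm1 : spd beta s - e / 2 <= mm by rewrite le_max lexx orbT.
  have : mm * (v - s) <= flen s v beta.
    apply: (flen_ge m fin as_ (ltW sv) vb); first by rewrite le_max lexx.
    move=> w /andP[sw wv]; rewrite ge_max speed_ge0//=.
    have : ball s d' w by rewrite /ball /= ler0_norm; lra.
    by move=> /d'P /=; rewrite ltr_norml => /andP[_]; lra.
  have : (v - s) * (spd beta s + e / 2) <= (v - s) * (mm + e).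
    by rewrite ler_pM2l; lra.
  by move: Ss uv; nra.
- move=> s /andP[as_ sb] IH; apply/ler_addgt0Pr => eta eta0.
  have Cs : C1_near beta s by apply: C; rewrite sb ltW.
  have cs : {for s, continuous (u \o beta)}.
    apply: continuous_comp; last exact: cu.
    by have [] := nbhs_singleton Cs.
  move/cvgrPdist_lt : cs => /(_ _ eta0)/nbhs_ballP[d /= d0 dP].
  pose v := Num.max a (s - d / 2).
  have av : a <= v by rewrite le_max lexx.
  have vs : v < s by rewrite gt_max as_ /=; lra.
  have vd : s - d / 2 <= v by rewrite le_max lexx orbT.
  have := IH v; rewrite av vs => /(_ isT).
  have : ball s d v by rewrite /ball /= ger0_norm; lra.
  move=> /dP /=; rewrite ltr_norml => /andP[_ us].
  rewrite (flen_cat m fin (lexx a) av (ltW vs) sb).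
  have := flen_ge0 v s beta.
  have : e * (v - a) <= e * (s - a) by rewrite ler_pM2l; lra.
  by lra.
Qed.

(** At its endpoints a piece only has C^1 extensions, so the previous bound is
    applied to a slightly shorter interval and the ends are left to continuity. *)
Lemma subspeed_piece u a b beta : subspeed u -> a < b ->
  (forall s, a <= s <= b -> C1_within `[a, b] beta s) ->
  ((u (beta b) - u (beta a))%:E <= L a b beta)%E.
Proof.
move=> su ab C; have m := piece_measurable fin_F ab C.
have [fin|] := ltP (L a b beta) +oo%E; last by rewrite leye_eq => /eqP ->; rewrite leey.
rewrite (length_fin m fin (lexx a) (ltW ab) (lexx b)) lee_fin; apply/ler_addgt0Pr => e e0.
have e20 : 0 < e / 2 by rewrite divr_gt0.
have near_end s : a <= s <= b -> exists2 d, 0 < d & forall v, a <= v <= b -> `|v - s| < d ->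
    `|u (beta s) - u (beta v)| < e / 2.
  move=> sab; have cb := C1_within_cvg sab (C s sab).
  have : u \o beta @ within `[a, b] (nbhs s) --> u (beta s).
    by apply: (cvg_comp _ _ cb); exact: su.1.
  move=> /cvgrPdist_lt/(_ _ e20); rewrite /within /= => /nbhs_ballP[d /= d0 dP].
  exists d => // v vab vs; apply: dP; last by rewrite /= in_itv.
  by rewrite /ball /= distrC.
have [|d d0 dP] := near_end a; first by rewrite lexx ltW.
have [|d' d'0 d'P] := near_end b; first by rewrite lexx ltW.
pose a' := Num.min (a + d / 2) (a + (b - a) / 3).
pose b' := Num.max (b - d' / 2) (b - (b - a) / 3).
have a'1 : a' <= a + d / 2 by rewrite ge_min lexx.
have a'2 : a' <= a + (b - a) / 3 by rewrite ge_min lexx orbT.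
have a'3 : a < a' by rewrite lt_min; apply/andP; split; lra.
have b'1 : b - d' / 2 <= b' by rewrite le_max lexx.
have b'2 : b - (b - a) / 3 <= b' by rewrite le_max lexx orbT.
have b'3 : b' < b by rewrite gt_max; apply/andP; split; lra.
have a'b' : a' < b' by lra.
have : `|u (beta a) - u (beta a')| < e / 2.
  by apply: dP; [lra|rewrite ger0_norm; lra].
have : `|u (beta b) - u (beta b')| < e / 2.
  by apply: d'P; [lra|rewrite ler0_norm; lra].
have m' : measurable_speed F a' b' beta by apply: measurable_speed_sub m; lra.
have fin' : (L a' b' beta < +oo)%E by rewrite (length_fin m fin) ?ltry//; lra.
have := subspeed_interior su a'b' _ m' fin'.
rewrite !ltr_norml => /(_ _) H /andP[_ H1] /andP[H2 _].
have {}H : u (beta b') - u (beta a') <= flen a' b' beta.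
  by apply: H => s sab; apply: (@C1_within_interior _ _ _ a b); [lra|apply: C; lra].
have E1 : flen a b beta = flen a a' beta + flen a' b beta by apply: (flen_cat m fin); lra.
have E2 : flen a' b beta = flen a' b' beta + flen b' b beta by apply: (flen_cat m fin); lra.
have := flen_ge0 a a' beta; have := flen_ge0 b' b beta.
by lra.
Qed.

Lemma subspeed_length u a b beta : subspeed u -> piecewise_C1 a b beta ->
  ((u (beta b) - u (beta a))%:E <= L a b beta)%E.
Proof.
move=> su /(@piecewise_C1_ind _ _ _ (fun a b => measurable_speed F a b beta /\
  ((u (beta b) - u (beta a))%:E <= L a b beta)%E)).
case=> [v|v w z vw wz [m1 l1] [m2 l2]|v w vw C|_ []//].
- by rewrite subrr length1; split => //; exact: measurable_speed1.
- have m : measurable_speed F v z beta by exact: measurable_speed_cat m1 m2.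
  split => //; rewrite (length_cat fin_F vw wz m).
  by apply: le_trans (leeD l1 l2); rewrite -EFinD lee_fin; lra.
- split; [exact: piece_measurable|exact: subspeed_piece].
Qed.

Lemma subspeed_dist u x y : subspeed u -> ((u y - u x)%:E <= finsler_dist F x y)%E.
Proof.
move=> su; apply: le_ereal_inf_tmp => _ [a [b [beta [_ pb <- <- ->]]]].
exact: subspeed_length.
Qed.

End LengthBounds.

(** * Almost shortest paths of constant speed *)

Section NearMinimizers.
Context {R : realType} {n : nat} {M : smoothManifold R n}.
Variable F : forall x : M, tangent x -> R.
Hypothesis fin_F : finsler F.
Implicit Types (i j : chart M) (gamma beta g : R -> M) (s a b c : R) (x y z : M).
Local Notation mu := (@lebesgue_measure R).
Local Notation spd := (speed F).
Local Notation L := (finsler_length F).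

Lemma dist_le_sublength a b beta : piecewise_C1 a b beta ->
  forall u v, a <= u -> u <= v -> v <= b ->
    (finsler_dist F (beta u) (beta v) <= L u v beta)%E.
Proof.
move=> pb; have m := piecewise_measurable fin_F pb.
suff [_] : a <= b /\ (measurable_speed F a b beta -> forall u v, a <= u -> u <= v -> v <= b ->
    (finsler_dist F (beta u) (beta v) <= L u v beta)%E) by apply.
apply: (@piecewise_C1_ind _ _ _ (fun a b => measurable_speed F a b beta -> forall u v, a <= u -> u <= v -> v <= b ->
    (finsler_dist F (beta u) (beta v) <= L u v beta)%E)) pb => {a b m}.
- move=> a _ u v au uv va; have -> : u = v by lra.
  by rewrite finsler_distxx// length1.
- move=> a c b ac cb P1 P2 m u v au uv vb.
  have m1 : measurable_speed F a c beta by apply: measurable_speed_sub m.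
  have m2 : measurable_speed F c b beta by apply: measurable_speed_sub m.
  have [vc|cv] := leP v c; first exact: P1.
  have [uc|cu] := leP u c; last by apply: P2 => //; exact: ltW.
  rewrite (length_cat fin_F uc (ltW cv)); last exact: measurable_speed_sub m.
  apply: le_trans (finsler_dist_triangle fin_F _ (beta c) _) _; apply: leeD.
    exact: P1.
  by apply: P2 => //; exact: ltW.
- move=> a b ab C m u v au uv vb.
  have [->|uv'] := eqVneq u v; first by rewrite finsler_distxx// length1.
  have {uv'} uv' : u < v by rewrite lt_neqAle uv' uv.
  apply: finsler_dist_le; exists 1%N, (fun k : nat => if k is 0%N then u else v); split => //.
    by case.
  case=> // _ s; rewrite /= in_itv /= => suv.
  apply: (@C1_within_sub _ _ _ `[a, b]); last by apply: C; lra.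
  by apply: subset_itv; rewrite bnd_simp.
Qed.

Lemma flen_continuous a b beta : a < b -> measurable_speed F a b beta -> (L a b beta < +oo)%E ->
  {within `[a, b], continuous (fun s => flen F a s beta)}.
Proof.
move=> ab m fin; apply: (parameterized_integral_continuous (ltW ab)).
apply/integrableP; split; first exact/measurable_EFinP.
apply: le_lt_trans fin; apply: ge0_le_integral => //.
- by apply/measurable_EFinP; apply: measurableT_comp.
- by apply/measurable_EFinP.
- by move=> s _ /=; rewrite lee_fin ger0_norm// speed_ge0.
Qed.

(** An almost shortest path is reparametrised by a perturbation of its arc
    length. *)
Lemma near_minimizer x y (D : R) : (finsler_dist F x y < D%:E)%E ->
  exists gamma, [/\ gamma 0 = x, gamma 1 = y &
    forall u v, 0 <= u -> u <= v -> v <= 1 ->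
      (finsler_dist F (gamma u) (gamma v) <= ((v - u) * D)%:E)%E].
Proof.
move=> xyD; have D0 : 0 < D by rewrite -lte_fin (le_lt_trans _ xyD)// finsler_dist_ge0.
have [a [b [beta [pb bx by_ lD]]]] := finsler_dist_lt xyD.
have m := piecewise_measurable fin_F pb.
have fin : (L a b beta < +oo)%E by exact: lt_trans lD (ltry _).
have := piecewise_C1_le pb; rewrite le_eqVlt => /predU1P[ab|ab].
  exists (fun=> x); split => //; first by rewrite -bx ab.
  move=> u v u0 uv v1; rewrite finsler_distxx// lee_fin.
  by apply: mulr_ge0; [rewrite subr_ge0|exact: ltW].
have lab : flen F a b beta < D.
  by rewrite -lte_fin -(length_fin fin_F m fin (lexx a) (ltW ab) (lexx b)).
(* arc length plus a linear term, which is strictly increasing even where the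
   speed vanishes and takes the value D at b *)
pose psi s := flen F a s beta + (D - flen F a b beta) / (b - a) * (s - a).
have kpos : 0 < (D - flen F a b beta) / (b - a) by rewrite divr_gt0 ?subr_gt0.
have psia : psi a = 0 by rewrite /psi /flen length1 subrr mulr0 addr0.
have psib : psi b = D by rewrite /psi divfK ?gt_eqF ?subr_gt0//; lra.
have psiD u v : a <= u -> u <= v -> v <= b ->
    psi v - psi u = flen F u v beta + (D - flen F a b beta) / (b - a) * (v - u).
  move=> au uv vb; rewrite /psi (flen_cat fin_F m fin (lexx a) au uv vb).
  by ring.
have psic : {within `[a, b], continuous psi}.
  have cl : {within `[a, b], continuous (fun s => (D - flen F a b beta) / (b - a) * (s - a))}.
    apply: continuous_subspaceT => s; apply: cvgM; first exact: cvg_cst.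
    by apply: cvgB; [exact: cvg_id|exact: cvg_cst].
  by move=> s; apply: cvgD; [exact: flen_continuous|exact: cl].
have ex s : exists v, 0 <= s <= 1 -> a <= v <= b /\ psi v = s * D.
  have [s01|s01] := boolP (0 <= s <= 1); last by exists a.
  have [|v] := @IVT _ psi a b (s * D) (ltW ab) psic.
    have D0' := ltW D0; rewrite psia psib (min_l D0') (max_r D0').
    move/andP : s01 => [s0 s1]; apply/andP; split; first exact: mulr_ge0.
    by rewrite ler_piMl.
  by rewrite in_itv /= => vab vE; exists v.
have {ex} [tau tauP] := choice ex.
have mono u v : 0 <= u -> u <= v -> v <= 1 -> tau u <= tau v.
  move=> u0 uv v1; have [|/andP[ua ub] tu] := tauP u; first lra.
  have [|/andP[va vb] tv] := tauP v; first lra.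
  rewrite leNgt; apply/negP => vu.
  have H := psiD (tau v) (tau u) va (ltW vu) ub.
  have := flen_ge0 fin_F (tau v) (tau u) beta.
  have : (D - flen F a b beta) / (b - a) * (tau u - tau v) > 0 by rewrite mulr_gt0// subr_gt0.
  have : u * D <= v * D by rewrite ler_pM2r.
  by lra.
have tau0 : tau 0 = a.
  have [|/andP[ta tb] t0] := tauP 0; first by rewrite lexx ler01.
  apply/eqP; rewrite eq_le ta andbT leNgt; apply/negP => at_.
  have := psiD a (tau 0) (lexx a) (ltW at_) tb; rewrite t0 psia mul0r subrr.
  have := flen_ge0 fin_F a (tau 0) beta.
  have : (D - flen F a b beta) / (b - a) * (tau 0 - a) > 0 by rewrite mulr_gt0// subr_gt0.
  by lra.
have tau1 : tau 1 = b.
  have [|/andP[ta tb] t0] := tauP 1; first by rewrite lexx ler01.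
  apply/eqP; rewrite eq_le tb /= leNgt; apply/negP => at_.
  have := psiD (tau 1) b ta (ltW at_) (lexx b); rewrite t0 psib mul1r subrr.
  have := flen_ge0 fin_F (tau 1) b beta.
  have : (D - flen F a b beta) / (b - a) * (b - tau 1) > 0 by rewrite mulr_gt0// subr_gt0.
  by lra.
exists (beta \o tau); split; [by rewrite /= tau0|by rewrite /= tau1|].
move=> u v u0 uv v1 /=.
have [|/andP[uab1 uab2] tu] := tauP u; first lra.
have [|/andP[vab1 vab2] tv] := tauP v; first lra.
apply: le_trans (dist_le_sublength pb uab1 (mono u v u0 uv v1) vab2) _.
rewrite (length_fin fin_F m fin)//; last exact: mono.
rewrite lee_fin mulrBl -tu -tv psiD//; last exact: mono.
by rewrite lerDl; apply: mulr_ge0; [exact: ltW|rewrite subr_ge0; exact: mono].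
Qed.

End NearMinimizers.

(** * Straight segments in a chart *)

Section Segments.
Context {R : realType} {n : nat} {M : smoothManifold R n}.
Variable F : forall x : M, tangent x -> R.
Hypothesis fin_F : finsler F.
Implicit Types (i j : chart M) (p q w : 'rV[R]_n) (s c : R).
Local Notation mu := (@lebesgue_measure R).

Lemma is_derive_line p w s : is_derive s 1 (fun u : R => p + u *: w) w.
Proof.
have dw : differentiable (fun u : R => u *: w) s by exact: ex_diff.
have lw : is_derive s 1 (fun u : R => u *: w) w.
  apply: DeriveDef; first exact/derivable1_diffP.
  by rewrite deriveE// diff_val scale1r.
by have := is_deriveD (is_derive_cst p s 1) lw; rewrite add0r.
Qed.

Lemma line_C1 i p w s : cod i (p + s *: w) ->
  C1_near (fun u => phi_inv i (p + u *: w)) s.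
Proof.
move=> ip; pose l u := p + u *: w.
have lc : continuous l.
  by move=> u; apply/differentiable_continuous/derivable1_diffP; have [] := is_derive_line p w u.
have : \forall u \near s, cod i (l u).
  by apply: lc; apply: open_nbhs_nbhs; split => //; exact: open_cod.
apply: filterS => u iu.
have cu : {for u, continuous (phi_inv i \o l)}.
  by apply: continuous_comp; [exact: lc|exact: phi_inv_continuous].
split => // j ju.
pose T := phi j \o phi_inv i.
have ix : dom i (phi_inv i (l u)) by exact: phi_inv_dom.
have dT v : cod i (l v) -> dom j (phi_inv i (l v)) -> differentiable T (l v).
  move=> iv jv; have := transition_differentiable (phi_inv_dom iv) jv.
  by rewrite phi_invK.
have E : \forall v \near u, derivable (phi j \o (phi_inv i \o l)) v 1 /\
   'D_w T (l v) = derive1 (phi j \o (phi_inv i \o l)) v.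
  near=> v.
  have iv : cod i (l v).
    by near: v; apply: lc; apply: open_nbhs_nbhs; split => //; exact: open_cod.
  have jv : dom j (phi_inv i (l v)) by near: v; apply: cu; exact: near_dom.
  have dc := is_derive_diff_comp (dT v iv jv) (is_derive_line p w v).
  split; first by have [] := dc.
  by rewrite derive1E -[LHS]/('D_w T (l v)) deriveE; [rewrite (@derive_val _ _ _ _ _ _ _ dc)|exact: dT].
split; first by have [] := nbhs_singleton E.
apply: (@near_eq_continuous _ _ (fun v => 'D_w T (l v))).
  by apply: filterS E => v [].
apply: (@continuous_comp _ _ _ l ('D_w T)); first exact: lc.
have [_ /(_ w) [dd _]] := transition_smooth i j 2%N.
apply: differentiable_continuous; apply: dd.
by exists (phi_inv i (l u)); [split|rewrite phi_invK].
Unshelve. all: by end_near. Qed.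

Lemma segment_dist i f p q c : local_expr F i f ->
  (forall s, 0 <= s <= 1 -> cod i (p + s *: (q - p)) /\ f (p + s *: (q - p), q - p) <= c) ->
  (finsler_dist F (phi_inv i p) (phi_inv i q) <= c%:E)%E.
Proof.
move=> fF H; pose l u := p + u *: (q - p); pose beta := phi_inv i \o l.
have pb : piecewise_C1 0 1 beta.
  exists 1%N, (fun k : nat => k%:R); split => //; first by case.
  case=> // _ s /=; rewrite in_itv /= => s01; exists beta; last by near=> u.
  by apply: line_C1; have [] := H s s01.
have := finsler_dist_le F pb; rewrite /beta /l /= scale0r addr0 scale1r addrC subrK.
move=> /le_trans; apply.
have spdc s : 0 <= s <= 1 -> speed F beta s <= c.
  move=> /[dup] s01 /H[iu fc].
  have Cs : C1_near beta s by exact: line_C1.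
  have [cb _] := nbhs_singleton Cs.
  have d : is_derive s 1 (phi i \o beta) (q - p).
    apply: near_eq_is_derive (is_derive_line p (q - p) s).
    near=> u; rewrite /beta /= phi_invK//; near: u.
    have lc : {for s, continuous l}.
      by apply/differentiable_continuous/derivable1_diffP; have [] := is_derive_line p (q - p) s.
    by apply: lc; apply: open_nbhs_nbhs; split => //; exact: open_cod.
  rewrite (speed_chart fF cb _ d); last exact: phi_inv_dom.
  by rewrite /beta /= phi_invK.
have c0 : 0 <= c by apply: le_trans (speed_ge0 fin_F beta 0) (spdc 0 _); rewrite lexx ler01.
apply: (@le_trans _ _ (\int[mu]_(s in `[0%R, 1%R]) (cst c%:E s))%E).
  apply: ge0_le_integral => //.
  - by move=> s _; rewrite lee_fin; exact: (speed_ge0 fin_F beta s).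
  - by apply/measurable_EFinP; exact: (piecewise_measurable fin_F pb).
rewrite integral_cst; last exact: measurable_itv.
have muE : mu `[0, 1]%classic = 1%E.
  by rewrite lebesgue_measure_itv /= lte_fin ltr01 -EFinB subr0.
by rewrite [X in (_ * X <= _)%E](_ : _ = 1%E)// mule1.
Unshelve. all: by end_near. Qed.

End Segments.

(** * Comparison functions in a chart *)

Lemma is_derive_quotient (R : realType) (V : normedModType R) (g : R -> V) (s : R) (v : V) :
  is_derive s 1 g v -> h^-1 *: (g (s + h) - g s) @[h --> 0^'] --> v.
Proof.
move=> [/cvg_ex[l ll] <-].
have -> : 'D_1 g s = l by apply/cvg_lim.
suff -> : (fun h : R => h^-1 *: (g (s + h) - g s)) =
  (fun h : R => h^-1 *: ((g \o shift s) (h *: 1) - g s)) by [].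
by apply/funext => h /=; rewrite [h *: 1]mulr1 [s + h]addrC.
Qed.

Section Barriers.
Context {R : realType} {n : nat} {M : smoothManifold R n}.
Variable F : forall x : M, tangent x -> R.
Hypothesis fin_F : finsler F.
Variables (i : chart M) (f : 'rV[R]_n * 'rV[R]_n -> R) (p0 : 'rV[R]_n) (r e : R).
Hypothesis fF : local_expr F i f.
Hypothesis r0 : 0 < r.
Hypothesis e01 : 0 < e < 1.
Hypothesis frameP : forall p v, `|p - p0| < r ->
  cod i p /\ `|f (p, v) - f (p0, v)| <= e * f (p0, v).
Let N v := f (p0, v).
Hypothesis wN : weak_norm N.
Hypothesis cN : continuous N.
Implicit Types (p q v : 'rV[R]_n) (s : R).

Lemma barrier_continuous (w : 'rV[R]_n -> R) :
  (forall p q, w q - w p <= N (q - p)) -> continuous w.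
Proof.
move=> wL p; have [c [C [c0 C0 cC]]] := weak_norm_comparison wN cN.
apply/(@cvgrPdist_lt _ _ _ _ (nbhs_filter p)) => a a0.
apply: (@filterS _ _ (nbhs_filter p)) (near_norm p (divr_gt0 a0 C0)) => q.
rewrite ltr_pdivlMr// mulrC => qp.
have := wL p q; have := wL q p; have := (cC (q - p)).2; have := (cC (p - q)).2.
rewrite [`|p - q|]distrC ltr_norml => *; apply/andP; split; lra.
Qed.

(** The function is continuous, although it is extended by a constant off the
    chart, because w takes this constant value outside a smaller closed ball.
    Increments of w are bounded by N of the increments of the coordinates, and
    in the ball (1 - e) N is at most the expression f of F. *)
Lemma barrier_subspeed (w : 'rV[R]_n -> R) (m : R) :
  (forall p q, w q - w p <= N (q - p)) ->
  (forall p, r / 2 < `|p - p0| -> w p = m) ->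
  subspeed F (fun z => (1 - e) * (if `[< dom i z >] then w (phi i z) else m)).
Proof.
move=> wL wm; have cw := barrier_continuous wL.
have r0' := r0; have e01' := e01.
pose u z := if `[< dom i z >] then w (phi i z) else m.
have r2 : r / 2 < r by lra.
have clK : closed [set z : M | dom i z /\ `|phi i z - p0| <= r / 2].
  by apply: closed_chart_ball => p pr; have [] := frameP 0 (le_lt_trans pr r2).
have out z : ~ (dom i z /\ `|phi i z - p0| <= r / 2) -> \forall y \near z, u y = m.
  move=> zK; have : \forall y \near z, ~ (dom i y /\ `|phi i y - p0| <= r / 2).
    apply: open_nbhs_nbhs; split => //.
    by rewrite -[X in open X]/(~` [set y | dom i y /\ `|phi i y - p0| <= r / 2]); exact: closed_openC.
  apply: filterS => y yK; rewrite /u; case: asboolP => // iy.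
  by apply: wm; rewrite ltNge; apply/negP => yr; apply: yK.
have inn z : dom i z -> \forall y \near z, u y = w (phi i y).
  by move=> /near_dom; apply: filterS => y iy; rewrite /u asboolT.
have cu : continuous u.
  move=> z; have [iz|iz] := pselect (dom i z).
    have H : \forall y \near z, w (phi i y) = u y by apply: filterS (inn z iz) => y ->.
    apply: (near_eq_continuous H).
    by apply: (@continuous_comp _ _ _ (phi i) w); [exact: phi_continuous|exact: cw].
  have H : \forall y \near z, m = u y.
    by apply: filterS (out z _) => [y ->//|[]].
  by apply: (near_eq_continuous H); exact: cst_continuous.
split.
  by move=> z; apply: cvgM; [exact: cvg_cst|exact: cu].
move=> g s gs a a0; have [cg dg] := nbhs_singleton gs.
have e1 : 0 < 1 - e by lra.
have [[iz zr]|zK] := pselect (dom i (g s) /\ `|phi i (g s) - p0| <= r / 2); last first.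
  have : \forall v \near s, u (g v) = m by exact: (cg _ (out _ zK)).
  move=> /nbhs_ballP[d /= d0 dP]; exists d => // h /andP[h0 hd].
  rewrite -!/(u _) !dP; [|exact: ballxx|rewrite /ball /= opprD addNKr normrN gtr0_norm//].
  rewrite subrr mulr_ge0 ?(ltW h0)// addr_ge0 ?(ltW a0)//.
  exact: (speed_ge0 fin_F g s).
have [dig _] := dg i iz.
pose v := 'D_1 (phi i \o g) s.
have dgi : is_derive s 1 (phi i \o g) v := derivableP dig.
have spE : speed F g s = f (phi i (g s), v) := speed_chart fF cg iz dgi.
have [izc fv] := frameP v (le_lt_trans zr r2).
have Nv : (1 - e) * N v <= speed F g s.
  by rewrite spE; move: fv; rewrite ler_norml -/(N v); lra.
have qv := is_derive_quotient dgi.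
have Nq : N (h^-1 *: ((phi i \o g) (s + h) - (phi i \o g) s)) @[h --> 0^'] --> N v.
  by apply: (cvg_comp _ _ qv); exact: cN.
move/cvgrPdist_lt : Nq => /(_ a a0)[d /= d0 dP].
have : \forall t \near s, dom i (g t) by exact: (cg _ (near_dom iz)).
move=> /nbhs_ballP[d' /= d'0 d'P].
exists (Num.min d d'); first by rewrite lt_min d0.
move=> h /andP[h0]; rewrite lt_min => /andP[hd hd'].
have ish : dom i (g (s + h)).
  by apply: d'P; rewrite /ball /= opprD addNKr normrN gtr0_norm.
rewrite !asboolT// -mulrBr.
have hn : h != 0 by rewrite gt_eqF.
have := dP h; rewrite /= sub0r normrN gtr0_norm// => /(_ hd hn).
rewrite ltr_norml => /andP[Nh _].
have NE : N ((phi i (g (s + h))) - phi i (g s)) =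
    h * N (h^-1 *: ((phi i \o g) (s + h) - (phi i \o g) s)).
  have [_ _ NZ _] := wN.
  by rewrite NZ ?invr_ge0 ?(ltW h0)// mulrA divff// mul1r.
apply: (@le_trans _ _ ((1 - e) * (h * (N v + a)))).
  rewrite ler_pM2l//; apply: le_trans (wL _ _) _; rewrite NE ler_pM2l//; lra.
rewrite mulrCA ler_pM2l// mulrDr; apply: lerD => //.
by rewrite ler_piMl//; lra.
Qed.

End Barriers.

(** * The metric near a point *)

Section LocalDistance.
Context {R : realType} {n : nat} {M : smoothManifold R n}.
Variable F : forall x : M, tangent x -> R.
Hypothesis fin_F : finsler F.
Implicit Types (p q v : 'rV[R]_n) (s : R) (x y z : M) (i : chart M).

Lemma norm_segment p q p0 (r s : R) : `|p - p0| < r -> `|q - p0| < r -> 0 <= s <= 1 ->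
  `|p + s *: (q - p) - p0| < r.
Proof.
move=> pr qr /andP[s0 s1].
have -> : p + s *: (q - p) - p0 = (1 - s) *: (p - p0) + s *: (q - p0).
  by rewrite !scalerBr !scalerBl !scale1r; apply/rowP => k; rewrite !mxE; ring.
apply: le_lt_trans (ler_normD _ _) _; rewrite !normrZ (ger0_norm s0) ger0_norm ?subr_ge0//.
have [s10|s10] := eqVneq s 1; first by rewrite s10 subrr mul0r add0r mul1r.
have {}s10 : 0 < 1 - s by rewrite subr_gt0 lt_neqAle s10.
have H1 : (1 - s) * `|p - p0| < (1 - s) * r by rewrite ltr_pM2l.
have H2 : s * `|q - p0| <= s * r by apply: ler_wpM2l => //; exact: ltW.
by lra.
Qed.

(** The upper bound is the length of a segment, the lower bounds come from
    barriers. A distance smaller than eta excludes the points where the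
    barrier is truncated, in particular those outside the chart. *)
Lemma frame_dist i f p0 (e : R) : local_expr F i f ->
  (forall t, cod i t.1 -> {for t, continuous f}) -> cod i p0 -> 0 < e < 1 ->
  let N := fun v => f (p0, v) in
  exists r eta, [/\ 0 < r, 0 < eta & forall p, `|p - p0| < r ->
    [/\ cod i p,
      forall q, `|q - p0| < r ->
        (finsler_dist F (phi_inv i p) (phi_inv i q) <= ((1 + e) * N (q - p))%:E)%E,
      forall y, (finsler_dist F (phi_inv i p) y < eta%:E)%E -> dom i y /\
        (((1 - e) * N (phi i y - p))%:E <= finsler_dist F (phi_inv i p) y)%E &
      forall y, (finsler_dist F y (phi_inv i p) < eta%:E)%E -> dom i y /\
        (((1 - e) * N (p - phi i y))%:E <= finsler_dist F y (phi_inv i p))%E]].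
Proof.
move=> fF fc ip0 e01 N; have NF := fin_F.2.
have [e0 e1] : 0 < e /\ e < 1 by lra.
have wN : weak_norm N := local_weak_norm fF NF ip0.
have cN : continuous N.
  move=> v; apply: (@continuous_comp _ _ _ (fun w => (p0, w)) f); last exact: fc.
  by apply: continuous_pair; [exact: cst_continuous|move=> ?].
have [c [C [c0 C0 cC]]] := weak_norm_comparison wN cN.
have [r r0 rP] := finsler_frame fF NF fc ip0 e0.
have [N0 ND NZ Neq] := wN.
pose m := c * (r / 4).
have m0 : 0 < m by rewrite mulr_gt0//; lra.
have Nm v : N v < m -> `|v| < r / 4.
  by move=> Nv; have := (cC v).1; rewrite -(ltr_pM2l c0) -/m; lra.
exists (r / 4), ((1 - e) * m); split; [lra|by rewrite mulr_gt0//; lra|].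
move=> p pr4; have pr : `|p - p0| < r by lra.
have far v : r / 2 < `|v - p0| -> r / 4 < `|v - p|.
  move=> vr; have : `|v - p0| <= `|v - p| + `|p - p0|.
    by apply: le_trans (ler_normD _ _); rewrite addrA subrK.
  by lra.
split.
- by have [] := rP p 0 pr.
- move=> q qr4; have qr : `|q - p0| < r by lra.
  apply: (segment_dist fin_F fF) => s s01.
  have [ip] := rP _ (q - p) (norm_segment pr qr s01).
  by rewrite ler_norml -/(N (q - p)) => fb; split => //; lra.
(* the barrier is the truncated distance from p *)
- move=> y; pose w q := Num.min (N (q - p)) m.
  have wL q q' : w q' - w q <= N (q' - q).
    have : N (q' - p) <= N (q' - q) + N (q - p).
      by apply: le_trans (ND _ _); rewrite addrA subrK.
    have := N0 (q' - q); rewrite /w.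
    by case: (ltP (N (q' - p)) m); case: (ltP (N (q - p)) m); lra.
  have wm v : r / 2 < `|v - p0| -> w v = m.
    move=> /far vp; rewrite /w min_r// leNgt; apply/negP => /Nm; lra.
  have su := barrier_subspeed fin_F fF r0 e01 rP wN cN wL wm.
  have := subspeed_dist fin_F (phi_inv i p) y su.
  have ip : cod i p by have [] := rP p 0 pr.
  rewrite (asboolT (phi_inv_dom ip)).
  rewrite phi_invK// /w subrr (weak_norm0 wN) (min_l (ltW m0)) mulr0 subr0.
  case: asboolP => iy H dy; last first.
    by move: (le_lt_trans H dy); rewrite lte_fin ltxx.
  split => //; move: H (le_lt_trans H dy).
  rewrite lte_fin ltr_pM2l; last lra.
  by case: (ltP (N (phi i y - p)) m) => //; rewrite ltxx.
(* the barrier is the opposite of the truncated distance to p *)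
- move=> y; pose w q := - Num.min (N (p - q)) m.
  have wL q q' : w q' - w q <= N (q' - q).
    have : N (p - q) <= N (p - q') + N (q' - q).
      by apply: le_trans (ND _ _); rewrite addrA subrK.
    have := N0 (q' - q); rewrite /w.
    by case: (ltP (N (p - q')) m); case: (ltP (N (p - q)) m); lra.
  have wm v : r / 2 < `|v - p0| -> w v = - m.
    move=> /far vp; rewrite /w min_r// leNgt; apply/negP => /Nm.
    by rewrite distrC; lra.
  have su := barrier_subspeed fin_F fF r0 e01 rP wN cN wL wm.
  have := subspeed_dist fin_F y (phi_inv i p) su.
  have ip : cod i p by have [] := rP p 0 pr.
  rewrite (asboolT (phi_inv_dom ip)).
  rewrite phi_invK// /w subrr (weak_norm0 wN) (min_l (ltW m0)) oppr0 mulr0 sub0r.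
  case: asboolP => iy; rewrite mulrN opprK => H dy; last first.
    by move: (le_lt_trans H dy); rewrite lte_fin ltxx.
  split => //; move: H (le_lt_trans H dy).
  rewrite lte_fin ltr_pM2l; last lra.
  by case: (ltP (N (p - phi i y)) m) => //; rewrite ltxx.
Qed.

Lemma chart_dist i x : dom i x ->
  exists f c C, [/\ local_expr F i f, weak_norm (fun v => f (phi i x, v)),
    (0 < c /\ 0 < C), (forall v, c * `|v| <= f (phi i x, v) <= C * `|v|) &
    forall e, 0 < e < 1 -> exists r eta, [/\ 0 < r, 0 < eta &
      forall y, dom i y -> `|phi i y - phi i x| < r ->
      [/\ forall z, dom i z -> `|phi i z - phi i x| < r ->
          (finsler_dist F y z <= ((1 + e) * f (phi i x, phi i z - phi i y))%:E)%E,
        forall z, (finsler_dist F y z < eta%:E)%E -> dom i z /\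
          (((1 - e) * f (phi i x, phi i z - phi i y))%:E <= finsler_dist F y z)%E &
        forall z, (finsler_dist F z y < eta%:E)%E -> dom i z /\
          (((1 - e) * f (phi i x, phi i y - phi i z))%:E <= finsler_dist F z y)%E]]].
Proof.
move=> ix; have [/(_ i)[f fF fc] NF] := fin_F.
have ip := phi_cod ix.
have wN := local_weak_norm fF NF ip.
have cN : continuous (fun v => f (phi i x, v)).
  move=> v; apply: (@continuous_comp _ _ _ (fun w => (phi i x, w)) f); last exact: fc.
  by apply: continuous_pair; [exact: cst_continuous|move=> ?].
have [c [C [c0 C0 cC]]] := weak_norm_comparison wN cN.
exists f, c, C; split => //; first by move=> v; have [-> ->] := cC v.
move=> e e01; have [r [eta [r0 eta0 H]]] := frame_dist fF fc ip e01.
exists r, eta; split => // y iy yr; have [ipy H1 H2 H3] := H _ yr.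
move: H1 H2 H3; rewrite phiK// => H1 H2 H3; split => // z iz zr.
by have := H1 _ zr; rewrite phiK.
Qed.

End LocalDistance.

(** * Finiteness, topology and metric derivative *)

Section RealDistance.
Context {R : realType} {n : nat} {M : smoothManifold R n}.
Hypothesis conM : connected [set: M].
Implicit Types (p q v : 'rV[R]_n) (s : R) (x y z : M) (i : chart M).
Variable F : forall x : M, tangent x -> R.
Hypothesis fin_F : finsler F.

Lemma chart_nbhs i x (r : R) : dom i x -> 0 < r ->
  \forall y \near x, dom i y /\ `|phi i y - phi i x| < r.
Proof.
move=> ix r0; apply: filterI; first exact: near_dom.
exact: (phi_continuous ix (near_norm (phi i x) r0)).
Qed.

Lemma finsler_dist_near x : \forall y \near x,
  (finsler_dist F x y < +oo)%E /\ (finsler_dist F y x < +oo)%E.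
Proof.
have [i ix] := dom_cover x.
have [f [c [C [_ _ _ _ H]]]] := chart_dist fin_F ix.
have [|r [eta [r0 _ rP]]] := H (1 / 2); first lra.
have xr : `|phi i x - phi i x| < r by rewrite subrr normr0.
apply: filterS (chart_nbhs ix r0) => y [iy yr]; split.
- by have [+ _ _] := rP x ix xr => /(_ y iy yr)/le_lt_trans; apply; exact: ltry.
- by have [+ _ _] := rP y iy yr => /(_ x ix xr)/le_lt_trans; apply; exact: ltry.
Qed.

(** The points at finite distance from x form an open and closed set. *)
Lemma finsler_dist_fin x y : finsler_dist F x y \is a fin_num.
Proof.
rewrite ge0_fin_numE; last exact: finsler_dist_ge0.
pose A := [set y | (finsler_dist F x y < +oo)%E].
suff AT : A = setT by have : setT y by []; rewrite -AT.
have triang (u v w : M) : (finsler_dist F u v < +oo -> finsler_dist F v w < +oo ->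
    finsler_dist F u w < +oo)%E.
  move=> uv vw; apply: le_lt_trans (finsler_dist_triangle fin_F _ v _) _.
  exact: lte_add_pinfty.
have oA : open A.
  rewrite openE => u Au; apply: filterS (finsler_dist_near u) => v [uv _].
  exact: triang Au uv.
have cA : closed A.
  rewrite -[A]setCK; apply: open_closedC; rewrite openE => u Au.
  apply: filterS (finsler_dist_near u) => v [_ vu] Av; apply: Au.
  exact: triang Av vu.
apply: conM.
- by exists x; rewrite /A /= finsler_distxx// ltry.
- by exists A => //; rewrite setTI.
- by exists A => //; rewrite setTI.
Qed.

Definition rdist x y : R := fine (finsler_dist F x y).

Lemma rdistE x y : finsler_dist F x y = (rdist x y)%:E.
Proof. by rewrite fineK// finsler_dist_fin. Qed.

Lemma rdist_ge0 x y : 0 <= rdist x y.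
Proof. by rewrite fine_ge0// finsler_dist_ge0. Qed.

Lemma rdistxx x : rdist x x = 0.
Proof. by rewrite /rdist finsler_distxx. Qed.

Lemma rdist_triangle y x z : rdist x z <= rdist x y + rdist y z.
Proof. by rewrite -lee_fin EFinD -!rdistE finsler_dist_triangle. Qed.

Lemma rdist_cvg0 (a : nat -> M) y :
  (finsler_dist F (a k) y @[k --> \oo] --> 0%E) <->
  (forall e : R, 0 < e -> \forall m \near \oo, rdist (a m) y < e).
Proof.
have -> : (fun m => finsler_dist F (a m) y) = EFin \o (fun m => rdist (a m) y).
  by apply/funext => m /=; rewrite -rdistE.
split=> [/fine_cvgP[_] /cvgr0Pnorm_lt H e /H|H].
  by apply: filterS => m /=; rewrite ger0_norm//; exact: rdist_ge0.
apply/fine_cvgP; split; first exact: nearW.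
apply/cvgr0Pnorm_lt => e /H; apply: filterS => m /=.
by rewrite ger0_norm//; exact: rdist_ge0.
Qed.

Lemma rdist_bilipschitz i x : dom i x -> exists r C, [/\ 0 < r, 0 < C &
  forall y z, dom i y -> `|phi i y - phi i x| < r -> dom i z -> `|phi i z - phi i x| < r ->
    rdist y z <= C * `|phi i z - phi i y| /\ `|phi i z - phi i y| <= C * rdist y z].
Proof.
move=> ix; have [f [c [C [_ _ [c0 C0] cC H]]]] := chart_dist fin_F ix.
have [|r [eta [r0 eta0 rP]]] := H (1 / 2); first lra.
pose D := Num.max (2 * C) (2 / c).
have [D1 D2] : 2 * C <= D /\ 2 / c <= D by rewrite !le_max !lexx orbT.
have D0 : 0 < D by lra.
pose r' := Num.min r (eta / (4 * D)).
have r'0 : 0 < r' by rewrite lt_min r0 divr_gt0// mulr_gt0.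
have r'r : r' <= r by rewrite ge_min lexx.
have r'e : r' <= eta / (4 * D) by rewrite ge_min lexx orbT.
exists r', D; split => // y z iy yr iz zr.
have [up lo _] := rP y iy (lt_le_trans yr r'r).
have up1 := up z iz (lt_le_trans zr r'r).
have [fc fC] := andP (cC (phi i z - phi i y)).
have {}up1 : rdist y z <= D * `|phi i z - phi i y|.
  rewrite -lee_fin -rdistE; apply: le_trans up1 _; rewrite lee_fin.
  have : 2 * C * `|phi i z - phi i y| <= D * `|phi i z - phi i y| by rewrite ler_wpM2r.
  have : 0 <= C * `|phi i z - phi i y| by rewrite mulr_ge0// ltW.
  by lra.
split => //.
have yz : `|phi i z - phi i y| < 2 * r'.
  have : `|phi i z - phi i y| <= `|phi i z - phi i x| + `|phi i y - phi i x|.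
    by rewrite [X in _ <= _ + X]distrC; apply: le_trans (ler_normD _ _); rewrite addrA subrK.
  by lra.
have [|_] := lo z.
  rewrite rdistE lte_fin; apply: le_lt_trans up1 _.
  rewrite mulrC -ltr_pdivlMr//; apply: lt_le_trans yz _.
  have -> : eta / D = 4 * (eta / (4 * D)) by field; rewrite gt_eqF.
  have : 0 < eta / (4 * D) by rewrite divr_gt0// mulr_gt0.
  by lra.
rewrite rdistE lee_fin => lo1.
apply: (@le_trans _ _ (2 / c * rdist y z)); last by rewrite ler_wpM2r// rdist_ge0.
rewrite mulrAC ler_pdivlMr// mulrC; lra.
Qed.

Lemma rdist_near x (d : R) : 0 < d -> \forall y \near x, rdist x y < d /\ rdist y x < d.
Proof.
move=> d0; have [i ix] := dom_cover x.
have [r [C [r0 C0 rC]]] := rdist_bilipschitz ix.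
have s0 : 0 < Num.min r (d / C) by rewrite lt_min r0 divr_gt0.
apply: filterS (chart_nbhs ix s0) => y [iy]; rewrite lt_min => /andP[yr yd].
have xr : `|phi i x - phi i x| < r by rewrite subrr normr0.
have [H1 _] := rC x y ix xr iy yr; have [H2 _] := rC y x iy yr ix xr.
rewrite ltr_pdivlMr// mulrC in yd.
by split; [apply: le_lt_trans H1 yd|apply: le_lt_trans H2 _; rewrite distrC].
Qed.

(** With [rdist_near], balls of the metric in either sense form bases of
    neighbourhoods, although the metric need not be symmetric. *)
Lemma nbhs_rdist x (A : set M) : nbhs x A -> exists2 d : R, 0 < d &
  forall y, rdist x y < d \/ rdist y x < d -> A y.
Proof.
move=> xA; have [i ix] := dom_cover x.
have [f [c [C [_ _ [c0 C0] cC H]]]] := chart_dist fin_F ix.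
have [|r [eta [r0 eta0 rP]]] := H (1 / 2); first lra.
have xr : `|phi i x - phi i x| < r by rewrite subrr normr0.
have /near_normP[a a0 aP] := near_chart ix xA.
have key y : dom i y -> `|phi i y - phi i x| < a -> A y.
  by move=> iy /aP[_]; rewrite phiK.
have ca : 0 < c * a / 2 by rewrite divr_gt0// mulr_gt0.
exists (Num.min eta (c * a / 2)); first by rewrite lt_min eta0.
have [_ lo1 lo2] := rP x ix xr.
move=> y [|]; rewrite lt_min => /andP[ye yc].
- have [|iy] := lo1 y; first by rewrite rdistE lte_fin.
  rewrite rdistE lee_fin => H1; apply: key => //.
  by have /andP[fc _] := cC (phi i y - phi i x); rewrite -(ltr_pM2l c0); lra.
- have [|iy] := lo2 y; first by rewrite rdistE lte_fin.
  rewrite rdistE lee_fin => H1; apply: key => //.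
  have /andP[fc _] := cC (phi i x - phi i y).
  by rewrite distrC -(ltr_pM2l c0); lra.
Qed.

(** In a chart the distance is within a factor 1 +- e1 of the norm at gamma s of
    the increment of the coordinates, and the difference quotients of the
    coordinates tend to the velocity. *)
Lemma metric_derivative gamma s : has_velocity (velocity gamma s) ->
  forall e : R, 0 < e -> exists2 d : R, 0 < d & forall h, 0 < h < d ->
    `|rdist (gamma s) (gamma (s + h)) - h * speed F gamma s| <= e * h.
Proof.
move=> [cg dg] e e0; have [i ix] := dom_cover (gamma s).
have [f [c [C [fF wN [c0 C0] cC H]]]] := chart_dist fin_F ix.
pose N v := f (phi i (gamma s), v).
set v := velocity gamma s i in dg.
have spE : speed F gamma s = N v by rewrite /speed (fF _ _ ix).
have Nv0 : 0 <= N v by have [+ _ _ _] := wN; exact.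
pose e1 := Num.min (1 / 2) (e / (2 * (N v + e))).
have e1P : 0 < e1 < 1.
  apply/andP; split; last by rewrite gt_min; apply/orP; left; lra.
  by rewrite lt_min; apply/andP; split; [lra|apply: divr_gt0 => //; lra].
have e1e : e1 * (N v + e) <= e / 2.
  have : e1 <= e / (2 * (N v + e)) by rewrite ge_min lexx orbT.
  rewrite ler_pdivlMr; last by lra.
  by lra.
have [r [eta [r0 eta0 rP]]] := H e1 e1P.
have qv := is_derive_quotient (dg i ix).
have Nq : N (h^-1 *: ((phi i \o gamma) (s + h) - (phi i \o gamma) s)) @[h --> 0^'] --> N v.
  apply: (cvg_comp _ _ qv).
  have [/(_ i)[f' fF' fc'] _] := fin_F.
  have NN : N = (fun w => f' (phi i (gamma s), w)).
    apply/funext => w; rewrite /N.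
    by have [t <-] := tangent_exists w ix; rewrite -(fF _ _ ix) -(fF' _ _ ix).
  rewrite NN; apply: (@continuous_comp _ _ _ (fun w => (phi i (gamma s), w)) f'); last first.
    by apply: fc'; exact: phi_cod.
  by apply: continuous_pair; [exact: cst_continuous|move=> ?].
have e20 : 0 < e / 2 by lra.
move/cvgrPdist_lt : Nq => /(_ _ e20)[d /= d0 dP].
have nb : \forall y \near gamma s, (dom i y /\ `|phi i y - phi i (gamma s)| < r) /\
    rdist (gamma s) y < eta.
  apply: filterI; first exact: chart_nbhs.
  by apply: filterS (rdist_near _ eta0) => y [].
have : \forall t \near s, (dom i (gamma t) /\ `|phi i (gamma t) - phi i (gamma s)| < r) /\
    rdist (gamma s) (gamma t) < eta by exact: (cg _ nb).
move=> /nbhs_ballP[d' /= d'0 d'P].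
exists (Num.min d d'); first by rewrite lt_min d0.
move=> h /andP[h0]; rewrite lt_min => /andP[hd hd'].
have [|[ish hr] heta] := d'P (s + h).
  by rewrite /ball /= opprD addNKr normrN gtr0_norm.
have sr : `|phi i (gamma s) - phi i (gamma s)| < r by rewrite subrr normr0.
have [up lo _] := rP _ ix sr.
have {up} up := up _ ish hr; have [|_ {}lo] := lo (gamma (s + h)).
  by rewrite rdistE lte_fin.
rewrite rdistE !lee_fin in up, lo.
have hn : h != 0 by rewrite gt_eqF.
have := dP h; rewrite /= sub0r normrN gtr0_norm// => /(_ hd hn).
set Q := N (_ *: _) => Qv.
have NE : f (phi i (gamma s), phi i (gamma (s + h)) - phi i (gamma s)) = h * Q.
  have [_ _ NZ _] := wN.
  by rewrite /Q /N NZ ?invr_ge0 ?(ltW h0)// mulrA divff// mul1r.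
rewrite NE in up, lo.
move: Qv; rewrite spE ltr_norml => /andP[Q1 Q2].
have Q0 : 0 <= Q by have [+ _ _ _] := wN; exact.
have QN : Q <= N v + e by lra.
have e1Q : e1 * Q <= e / 2.
  by apply: le_trans e1e; rewrite ler_pM2l//; have /andP[] := e1P.
rewrite ler_norml; apply/andP; split.
- have : h * ((1 - e1) * Q - N v) >= h * (- e) by rewrite ler_pM2l//; lra.
  by lra.
- have : h * ((1 + e1) * Q - N v) <= h * e by rewrite ler_pM2l//; lra.
  by lra.
Qed.

End RealDistance.

(** * Existence of shortest paths *)

Lemma ultra_image (S T : Type) (U : set_system S) (f : S -> T) :
  UltraFilter U -> UltraFilter (fmap f U).
Proof.
move=> UU; split; first exact: fmap_proper_filter.
move=> G GG UG; apply/seteqP; split => // A GA.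
have [//|UA] := in_ultra_setVsetC (f @^-1` A) UU.
have GnA : G (~` A) by exact: UG.
by have [t []] := filter_ex (filterI GA GnA).
Qed.

Section Minimizers.
Context {R : realType} {n : nat} {M : smoothManifold R n}.
Hypothesis conM : connected [set: M].
Implicit Types (s u v : R) (x y z : M) (i : chart M).
Variable F : forall x : M, tangent x -> R.
Hypothesis fin_F : finsler F.
Local Notation d := (rdist F).

Lemma compact_neighborhood z : exists2 K : set M, compact K & nbhs z K.
Proof.
have [i iz] := dom_cover z.
have /near_normP[r r0 rP] : nbhs (phi i z) (cod i).
  by apply: open_nbhs_nbhs; split; [exact: open_cod|exact: phi_cod].
exists (phi_inv i @` [set p | `|p - phi i z| <= r / 2]).
  by apply: compact_chart_ball => p pr; apply: rP; apply: le_lt_trans pr _; lra.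
have r2 : 0 < r / 2 by lra.
apply: filterS (chart_nbhs iz r2) => y [iy yr].
by exists (phi i y); [exact: ltW|exact: phiK].
Qed.

Lemma rdist_complete (x : nat -> M) : finsler_complete F ->
  (forall e, 0 < e -> exists N, forall m k, (N <= m)%N -> (m <= k)%N -> d (x m) (x k) < e) ->
  exists y, forall e, 0 < e -> exists N, forall m, (N <= m)%N -> d y (x m) < e.
Proof.
move=> cF cx; have [|y xy] := cF x.
  move=> e e0; have [N NP] := cx e e0; exists N => m k Nm mk.
  by rewrite (rdistE conM fin_F) lte_fin NP.
exists y => e e0.
have [dl dl0 dlP] := nbhs_rdist conM fin_F (rdist_near conM fin_F y e0).
have := (rdist_cvg0 conM fin_F x y).1 xy dl dl0.
move=> [N _ NP]; exists N => m /NP /= xm.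
by have [] := dlP (x m) (or_intror xm).
Qed.

Section Limit.
Variables (x y : M) (g : nat -> R -> M) (U : set_system nat).
Hypothesis cF : finsler_complete F.
Hypothesis UU : UltraFilter U.
Hypothesis Uoo : \oo `<=` U.
Let D := d x y.
Hypothesis g0 : forall k, g k 0 = x.
Hypothesis gL : forall k u v, 0 <= u -> u <= v -> v <= 1 ->
  d (g k u) (g k v) <= (v - u) * (D + k.+1%:R^-1).

Let pU : ProperFilter U.
Proof. exact: ultra_proper. Qed.

Let D0 : 0 <= D.
Proof. exact: rdist_ge0. Qed.

Let gL1 k u v : 0 <= u -> u <= v -> v <= 1 -> d (g k u) (g k v) <= (v - u) * (D + 1).
Proof.
move=> u0 uv v1; apply: le_trans (gL k u0 uv v1) _.
rewrite ler_wpM2l ?subr_ge0// lerD2l invf_le1 ?ltr0n// ler1n //.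
Qed.

Let lim u z := forall e, 0 < e -> U [set k | d z (g k u) < e /\ d (g k u) z < e].

Let lim_dist u v z w : 0 <= u -> u <= v -> v <= 1 -> lim u z -> lim v w -> d z w <= (v - u) * D.
Proof.
move=> u0 uv v1 uz vw; apply/ler_addgt0Pr => e e0.
have e30 : 0 < e / 3 by lra.
have : \forall k \near \oo, (k.+1%:R^-1 : R) < e / 3.
  by near=> k; near: k; exact: near_infty_natSinv_lt (PosNum e30).
move=> /Uoo Uk.
have [k [[[H1 _] [_ H2]] H3]] := @filter_ex _ U _ _ (filterI (filterI (uz _ e30) (vw _ e30)) Uk).
have := rdist_triangle conM fin_F (g k u) z w.
have := rdist_triangle conM fin_F (g k v) (g k u) w.
have := gL k u0 uv v1.
have : (v - u) * (D + k.+1%:R^-1) <= (v - u) * D + e / 3.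
  rewrite mulrDr lerD2l; have : (v - u) * k.+1%:R^-1 <= k.+1%:R^-1.
    by rewrite ler_piMl ?invr_ge0//; lra.
  by move=> /le_trans; apply; exact: ltW.
move: ((v - u) * (D + _)) ((v - u) * D) H1 H2 => X Y; lra.
Unshelve. all: by end_near. Qed.

Let lim_filter u z : (fun k => g k u) @ U --> z -> lim u z.
Proof. by move=> gz e e0; exact: (gz _ (rdist_near conM fin_F z e0)). Qed.

Let lim_compact u K : compact K -> U [set k | K (g k u)] -> exists z, lim u z.
Proof.
rewrite compact_ultra => /(_ (fmap (fun k => g k u) U)) cK UK.
have [|z [_ gz]] := cK _ UK; first exact: ultra_image.
by exists z; exact: lim_filter.
Qed.

(** Real induction on the time. A compact neighbourhood of the limit at time t
    contains the points g k u for u slightly larger than t, so that these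
    converge along the ultrafilter; limits at times increasing to t form a
    Cauchy sequence, and its limit is the limit at time t. *)
Let lim_exists s : 0 <= s <= 1 -> exists z, lim s z.
Proof.
move=> /andP[s0 s1].
apply: (@real_induction _ 0 s (fun s => exists z, lim s z)) => //.
- by exists x => e e0; apply: filterE => k; rewrite /= g0 rdistxx.
- move=> t /andP[t0 ts] [z tz].
  have [K cK zK] := compact_neighborhood z.
  have [e e0 eP] := nbhs_rdist conM fin_F zK.
  have e20 : 0 < e / 2 by lra.
  pose t' := Num.min s (t + e / 2 / (D + 1) / 2).
  have q0 : 0 < e / 2 / (D + 1) by rewrite divr_gt0//; have := D0; lra.
  have t't : t' <= t + e / 2 / (D + 1) / 2 by rewrite ge_min lexx orbT.
  have t's : t' <= s by rewrite ge_min lexx.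
  exists t'; first by rewrite t's lt_min ts /=; lra.
  move=> u /andP[tu ut']; apply: (lim_compact cK).
  apply: filterS (tz _ e20) => k [H1 _]; apply: eP; left.
  have tu' : u - t < e / 2 / (D + 1) by lra.
  have := rdist_triangle conM fin_F (g k t) z (g k u).
  have := gL1 k t0 (ltW tu) (le_trans ut' (le_trans t's s1)).
  by rewrite ltr_pdivlMr in tu'; [lra|have := D0; lra].
- move=> t /andP[t0 ts] IH.
  have [Z ZP] : exists Z : R -> M, forall u, 0 <= u < t -> lim u (Z u).
    have : forall u, exists z, 0 <= u < t -> lim u z.
      move=> u; have [/[dup] h /IH[z uz]|] := boolP (0 <= u < t); first by exists z.
      by exists x.
    by move=> /choice[Z ZP]; exists Z.
  have [iv ivE] : exists iv : nat -> R, forall j, iv j = j.+1%:R^-1 by exists (fun j => j.+1%:R^-1).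
  (* times that increase to t *)
  pose a (j : nat) := t - t * iv j.
  have aE j : a j = t - t * iv j by [].
  have jinv j : 0 < iv j /\ iv j <= 1.
    by rewrite !ivE invr_gt0 ltr0n invf_le1 ?ltr0n// ler1n.
  have aP j : 0 <= a j < t.
    have [j1 j2] := jinv j; have := ler_piMr (ltW t0) j2.
    by have : 0 < t * iv j by [rewrite mulr_gt0]; rewrite ?aE; lra.
  have aD m k : (m <= k)%N -> a m <= a k /\ a k - a m <= t * iv m.
    move=> mk; have [k1 _] := jinv k.
    have : t * iv k <= t * iv m.
      by rewrite ler_pM2l// !ivE lef_pV2 ?posrE ?ltr0n// ler_nat.
    by have : 0 < t * iv k by [rewrite mulr_gt0]; rewrite ?aE; lra.
  have small e : 0 < e -> exists N, forall m, (N <= m)%N -> t * iv m * (D + 1) < e.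
    move=> e0; have : 0 < e / (t * (D + 1)).
      by rewrite divr_gt0// mulr_gt0//; have := D0; lra.
    move=> q0; have : \forall k \near \oo, iv k < e / (t * (D + 1)).
      near=> k; rewrite ivE; near: k; exact: near_infty_natSinv_lt (PosNum q0).
    move=> [N _ NP]; exists N => m /NP /=.
    rewrite ltr_pdivlMr; last by rewrite mulr_gt0//; have := D0; lra.
    by lra.
  have [|w wP] := @rdist_complete (Z \o a) cF.
    move=> e e0; have [N NP] := small e e0; exists N => m k Nm mk /=.
    have [am1 am2] := aD m k mk; have /andP[a1 a2] := aP m; have /andP[a3 a4] := aP k.
    apply: le_lt_trans (lim_dist a1 am1 _ (ZP _ (aP m)) (ZP _ (aP k))) _; first by lra.
    apply: le_lt_trans (NP m Nm).
    have : (a k - a m) * D <= t * iv m * D by rewrite ler_wpM2r.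
    have [m1 _] := jinv m; have : 0 < t * iv m by rewrite mulr_gt0.
    by lra.
  exists w => e e0.
  have [dl dl0 dlP] := nbhs_rdist conM fin_F (rdist_near conM fin_F w e0).
  have dl30 : 0 < dl / 3 by lra.
  have [N1 N1P] := wP _ dl30; have [N2 N2P] := small _ dl30.
  pose m := maxn N1 N2.
  have H1 := N1P m (leq_maxl _ _); have H2 := N2P m (leq_maxr _ _).
  have /andP[a1 a2] := aP m.
  apply: filterS (ZP _ (aP m) _ dl30) => k [H3 _].
  apply: dlP; left.
  have t1 : t <= 1 by lra.
  have := rdist_triangle conM fin_F (Z (a m)) w (g k t).
  have := rdist_triangle conM fin_F (g k (a m)) (Z (a m)) (g k t).
  have := gL1 k a1 (ltW a2) t1.
  have -> : t - a m = t * iv m by rewrite aE; lra.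
  by move: H1 => /=; lra.
Unshelve. all: by end_near. Qed.

Lemma limit_path : exists gamma : R -> M,
  (forall s, 0 <= s <= 1 -> forall e, 0 < e -> U [set k | d (gamma s) (g k s) < e /\ d (g k s) (gamma s) < e]) /\
  (forall u v, 0 <= u -> u <= v -> v <= 1 -> d (gamma u) (gamma v) <= (v - u) * D).
Proof.
have : forall s, exists z, 0 <= s <= 1 -> lim s z.
  move=> s; have [/[dup] h /lim_exists[z sz]|] := boolP (0 <= s <= 1); first by exists z.
  by exists x.
move=> /choice[gamma gP]; exists gamma; split; first exact: gP.
by move=> u v u0 uv v1; apply: (lim_dist u0 uv v1); apply: gP; lra.
Qed.

End Limit.

Lemma rdist_sep z w : (forall e, 0 < e -> d z w < e) -> z = w.
Proof.
move=> zw; apply: manifold_hausdorff => A B zA wB.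
exists w; split; last exact: nbhs_singleton.
by have [e e0 eP] := nbhs_rdist conM fin_F zA; apply: eP; left; exact: zw.
Qed.

(** Almost shortest paths of constant speed have a limit that is Lipschitz with
    constant d x y, and the triangle inequality between x, gamma u, gamma v and
    y leaves no room for strict inequality. *)
Lemma minimizer_exists x y : finsler_complete F -> exists gamma : R -> M,
  [/\ gamma 0 = x, gamma 1 = y &
    forall u v, 0 <= u -> u <= v -> v <= 1 -> d (gamma u) (gamma v) = (v - u) * d x y].
Proof.
move=> cF.
have : forall k : nat, exists gam : R -> M, [/\ gam 0 = x, gam 1 = y &
    forall u v, 0 <= u -> u <= v -> v <= 1 ->
      d (gam u) (gam v) <= (v - u) * (d x y + k.+1%:R^-1)].
  move=> k; have k0 : 0 < (k.+1%:R^-1 : R) by rewrite invr_gt0 ltr0n.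
  have [|gam [gam0 gam1 gL]] := @near_minimizer _ _ _ _ fin_F x y (d x y + k.+1%:R^-1).
    by rewrite (rdistE conM fin_F) lte_fin ltrDl.
  exists gam; split => // u v u0 uv v1.
  by rewrite -lee_fin -(rdistE conM fin_F); exact: gL.
move=> /choice[g gP].
have [U [UU Uoo]] := @ultraFilterLemma _ \oo _.
have g0 k : g k 0 = x by have [] := gP k.
have g1 k : g k 1 = y by have [] := gP k.
have gL k u v : 0 <= u -> u <= v -> v <= 1 -> d (g k u) (g k v) <= (v - u) * (d x y + k.+1%:R^-1).
  by have [_ _] := gP k; exact.
have [gamma [gamlim gamL]] := limit_path cF UU Uoo g0 gL.
have pU : ProperFilter U by exact: ultra_proper.
have gam0 : gamma 0 = x.
  apply: rdist_sep => e e0; have := gamlim 0; rewrite lexx ler01 => /(_ isT e e0).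
  by move=> /(@filter_ex _ U pU)[k [+ _]]; rewrite g0.
have gam1 : gamma 1 = y.
  apply: rdist_sep => e e0; have := gamlim 1; rewrite lexx ler01 => /(_ isT e e0).
  by move=> /(@filter_ex _ U pU)[k [+ _]]; rewrite g1.
exists gamma; split => // u v u0 uv v1; apply/eqP; rewrite eq_le gamL//=.
have := rdist_triangle conM fin_F (gamma u) x y.
have := rdist_triangle conM fin_F (gamma v) (gamma u) y.
have := gamL 0 u (lexx _) u0 (le_trans uv v1); have := gamL v 1 (le_trans u0 uv) v1 (lexx _).
by rewrite gam0 gam1; lra.
Qed.

End Minimizers.

(** * Calculus of C^k functions *)

Section CkCalculus.
Context {R : realType} {V : normedModType R}.

Lemma near_eq_differentiable (W : normedModType R) (f g : V -> W) x :
  (\forall y \near x, f y = g y) -> differentiable f x -> differentiable g x.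
Proof.
move=> fg /diff_locallyP[cf fE].
have gE : g \o shift x = cst (g x) + 'd f x +o_ 0 id.
  apply/eqaddoP => _/posnumP[e].
  have /eqaddoP/(_ e%:num ltac:(done)) H := fE.
  have fg0 : \forall h \near (0 : V), f (h + x) = g (h + x).
    by move: fg; rewrite (near_shift 0) subr0; exact.
  have Ex := nbhs_singleton fg.
  apply: (@filterS2 _ _ (nbhs_filter (0 : V)) _ _ _ _ H fg0) => h /=.
  by rewrite !fctE -Ex => + <-.
by apply/diff_locallyP; rewrite (diff_unique cf gE).
Qed.

(** Being C^k only depends on the germs at the points of U, from which the
    locality of the notion follows. *)
Lemma Ck_onP (W : normedModType R) k (U : set V) (f : V -> W) :
  Ck_on k U f <-> forall x, U x -> Ck_on k [set x] f.
Proof.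
elim: k f => [|k IH] f /=.
  by split=> [cf x Ux _ ->|cf x Ux]; [exact: cf|exact: (cf x Ux)].
split=> [[df cf] x Ux|H].
  by split=> [_ ->|v]; [exact: df|exact: ((IH _).1 (cf v))].
split=> [x Ux|v]; first by have [+ _] := H x Ux; apply.
by apply/IH => x Ux; have [_] := H x Ux; exact.
Qed.

Lemma Ck_on_sub (W : normedModType R) k (U U' : set V) (f : V -> W) :
  U' `<=` U -> Ck_on k U f -> Ck_on k U' f.
Proof. by move=> UU /Ck_onP cf; apply/Ck_onP => x /UU; exact: cf. Qed.

Lemma Ck_on_eq (W : normedModType R) k (U : set V) (f g : V -> W) : open U ->
  (forall x, U x -> f x = g x) -> Ck_on k U f -> Ck_on k U g.
Proof.
move=> oU; elim: k f g => [|k IH] f g fg /=.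
  move=> cf x Ux; apply: (near_eq_continuous _ (cf x Ux)).
  by apply: filterS (open_nbhs_nbhs (conj oU Ux)) => y; exact: fg.
have fgU x : U x -> \forall y \near x, f y = g y.
  by move=> Ux; apply: filterS (open_nbhs_nbhs (conj oU Ux)) => y; exact: fg.
move=> [df cf]; split=> [x Ux|v].
  by apply: (near_eq_differentiable (fgU x Ux)); exact: df.
by apply: IH (cf v) => x Ux; apply: near_eq_derive; exact: fgU.
Qed.

Lemma Ck_on_local (W : normedModType R) k (U : set V) (f : V -> W) :
  (forall x, U x -> exists2 g, \forall y \near x, f y = g y &
    exists2 A, nbhs x A & Ck_on k A g) -> Ck_on k U f.
Proof.
move=> H; apply/Ck_onP => x /H[g fg [A xA cg]].
have [B oB BP] : exists2 B, open_nbhs x B & B `<=` A `&` (fun y => f y = g y).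
  have : nbhs x (A `&` (fun y => f y = g y)) by exact: filterI.
  by rewrite nbhsE => -[B]; exists B.
have [oB' Bx] := oB.
apply: (@Ck_on_sub _ _ B) => [_ -> //|].
apply: (@Ck_on_eq _ _ _ g) => //; first by move=> y /BP[_].
by apply: Ck_on_sub cg => y /BP[].
Qed.

Lemma CkS (W : normedModType R) k (U : set V) (f : V -> W) :
  Ck_on k.+1 U f -> Ck_on k U f.
Proof.
elim: k f => [|k IH] f /= [df cf]; first by move=> x /df; exact: differentiable_continuous.
by split=> // v; exact: IH (cf v).
Qed.

Lemma Ck_cst (W : normedModType R) k (U : set V) (w : W) : Ck_on k U (fun=> w).
Proof.
elim: k w => [|k IH] w /=; first by move=> x _; exact: cst_continuous.
split=> // v; have -> : (fun x => 'D_v (fun=> w) x) = (fun=> 0 : W) by apply/funext => x; exact: derive_cst.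
exact: IH.
Qed.

Lemma Ck_add (W : normedModType R) k (U : set V) (f g : V -> W) : open U ->
  Ck_on k U f -> Ck_on k U g -> Ck_on k U (fun x => f x + g x).
Proof.
move=> oU; elim: k f g => [|k IH] f g /=.
  by move=> cf cg x Ux; apply: cvgD; [exact: cf|exact: cg].
move=> [df cf] [dg cg]; split=> [x Ux|v].
  by apply: differentiableD; [exact: df|exact: dg].
apply: Ck_on_eq (IH _ _ (cf v) (cg v)) => // x Ux.
by rewrite [RHS]deriveD//; apply: diff_derivable; [exact: df|exact: dg].
Qed.

Lemma Ck_linear (W W' : normedModType R) (L : {linear W -> W'}) k (U : set V) (f : V -> W) :
  continuous L -> open U -> Ck_on k U f -> Ck_on k U (fun x => L (f x)).
Proof.
move=> cL oU; elim: k f => [|k IH] f /=.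
  by move=> cf x Ux; apply: continuous_comp; [exact: cf|exact: cL].
move=> [df cf]; split=> [x Ux|v].
  by apply: differentiable_comp; [exact: df|exact: linear_differentiable].
apply: Ck_on_eq (IH _ (cf v)) => // x Ux.
rewrite [RHS](derive_comp_diff v erefl (df x Ux) (linear_differentiable _ cL)).
by rewrite diff_lin// deriveE//; exact: df.
Qed.

Lemma Ck_mul k (U : set V) (f g : V -> R) : open U ->
  Ck_on k U f -> Ck_on k U g -> Ck_on k U (fun x => f x * g x).
Proof.
move=> oU; elim: k f g => [|k IH] f g.
  by move=> cf cg x Ux; apply: cvgM; [exact: cf|exact: cg].
move=> fS gS; have fk := CkS fS; have gk := CkS gS; move: fS gS.
move=> [df cf] [dg cg]; split=> [x Ux|v].
  by apply: differentiableM; [exact: df|exact: dg].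
apply: Ck_on_eq (Ck_add oU (IH _ _ fk (cg v)) (IH _ _ gk (cf v))) => // x Ux.
by rewrite [RHS]deriveM//; apply: diff_derivable; [exact: df|exact: dg].
Qed.

Lemma Ck_sum (W : normedModType R) I (s : seq I) k (U : set V) (f : I -> V -> W) : open U ->
  (forall i, Ck_on k U (f i)) -> Ck_on k U (fun x => \sum_(i <- s) f i x).
Proof.
move=> oU cf; elim: s => [|i s IH].
  by under eq_fun do rewrite big_nil; exact: Ck_cst.
by under eq_fun do rewrite big_cons; exact: Ck_add.
Qed.

Lemma Ck_prod I (s : seq I) k (U : set V) (f : I -> V -> R) : open U ->
  (forall i, Ck_on k U (f i)) -> Ck_on k U (fun x => \prod_(i <- s) f i x).
Proof.
move=> oU cf; elim: s => [|i s IH].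
  by under eq_fun do rewrite big_nil; exact: Ck_cst.
by under eq_fun do rewrite big_cons; exact: Ck_mul.
Qed.

End CkCalculus.

(** * Flat functions *)

Section FlatFunctions.
Context {R : realType}.
Implicit Types (P : {poly R}) (x y : R).

(** The function P(1/x) exp(-1/x) on x > 0, extended by 0. These functions
    include exp(-1/x) and are stable under differentiation, so that their
    smoothness needs no formula for higher derivatives. *)
Definition flat P x : R := if 0 < x then P.[x^-1] * expR (- x^-1) else 0.

Lemma expR_pow_le n y : 0 <= y -> y ^+ n * expR (- y) <= n`!%:R.
Proof.
move=> y0; rewrite expRN ler_pdivrMr ?expR_gt0//.
case: n => [|n].
  by rewrite fact0 mul1r expr0 -expR0 ler_expR.
have f0 : 0 < (n.+1)`!%:R :> R by rewrite ltr0n fact_gt0.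
rewrite mulrC -ler_pdivrMr//; apply: le_trans (expR_ge1Dxn n y0).
by rewrite lerDr.
Qed.

Lemma flat_bounded P : exists C, forall x, `|flat P x| <= C.
Proof.
exists (\sum_(i < size P) `|P`_i| * i`!%:R) => x; rewrite /flat.
case: ifPn => [x0|_]; last by rewrite normr0 sumr_ge0// => i _; rewrite mulr_ge0.
have y0 : 0 <= x^-1 by rewrite invr_ge0 ltW.
rewrite normrM horner_coef (ger0_norm (expR_ge0 _)).
apply: le_trans (ler_wpM2r (expR_ge0 _) (ler_norm_sum _ _ _)) _.
rewrite mulr_suml; apply: ler_sum => i _; rewrite normrM normrX (ger0_norm y0) -mulrA.
by apply: ler_wpM2l => //; exact: expR_pow_le.
Qed.

Lemma is_derive_horner P x : is_derive x 1 (horner P) P^`().[x].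
Proof. by apply: DeriveDef; [exact: derivable_horner|rewrite derivE derive1E]. Qed.

Lemma is_derive_quadratic (f : R -> R) C : (forall x, `|f x| <= C * x ^+ 2) ->
  is_derive (0 : R) (1 : R) f (0 : R).
Proof.
move=> fC.
have f0 : f 0 = 0 by apply/eqP; rewrite -normr_le0 (le_trans (fC 0))// expr0n mulr0.
have lim0 : h^-1 *: ((f \o shift 0) (h *: (1 : R)) - f 0) @[h --> 0^'] --> (0 : R).
  apply/cvgr0Pnorm_lt => e e0.
  have C0 : 0 <= C by have := le_trans (normr_ge0 _) (fC 1); rewrite expr1n mulr1.
  have d0 : 0 < e / (C + 1) by rewrite divr_gt0//; lra.
  near=> h.
  have hn : h != 0 by near: h; exact: nbhs_dnbhs_neq.
  have hd : `|h| < e / (C + 1) by near: h; apply: dnbhs0_lt.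
  rewrite /= f0 subr0 [h *: 1]mulr1 addr0 [h^-1 *: _]/(h^-1 * f h) normrM normfV.
  rewrite mulrC ltr_pdivrMr ?normr_gt0//.
  apply: le_lt_trans (fC h) _; rewrite -real_normK ?num_real// expr2 mulrA ltr_pM2r ?normr_gt0//.
  move: hd; rewrite ltr_pdivlMr; last lra.
  by have := normr_ge0 h; nra.
by apply: DeriveDef; [apply/cvg_ex; exists 0|exact/cvg_lim].
Unshelve. all: by end_near. Qed.

(** Since the second factor is bounded, this makes [flat P] quadratically small
    at 0. *)
Lemma flat_shift P x : flat P x = x ^+ 2 * flat (P * 'X^2) x.
Proof.
rewrite /flat; case: ifPn => [x0|_]; last by rewrite mulr0.
rewrite hornerM hornerXn exprVn mulrA; congr (_ * _).
by rewrite mulrCA divff ?mulr1// expf_neq0// gt_eqF.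
Qed.

Lemma is_derive_flat P x : is_derive x 1 (flat P) (flat ((P - P^`()) * 'X^2) x).
Proof.
case: (ltgtP x 0) => x0.
- rewrite [X in is_derive _ _ _ X]/flat ltNge (ltW x0)/=.
  apply: near_eq_is_derive (is_derive_cst (0 : R) x 1).
  near=> y; rewrite /flat ltNge (_ : y <= 0 = true)//.
  by apply/ltW; near: y; exact: lt_nbhsl.
- have xn : x != 0 by rewrite gt_eqF.
  have dV := is_deriveV xn (is_derive_id x 1).
  have dP := is_derive1_comp (is_derive_horner P x^-1) dV.
  have dE := @is_derive1_comp _ expR (fun y => - y^-1) x _ _ (is_derive_expR _) (is_deriveN dV).
  have scaleE (a b : R) : a *: b = a * b by [].
  apply: near_eq_is_derive (is_derive_eq (is_deriveM dP dE) _); last first.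
    rewrite /flat x0 hornerM hornerD hornerN hornerXn exprVn !scaleE.
    rewrite !mulr1 /=; move: (P.[_]) (P^`().[_]) (expR _) (x ^- 2) => p p' E y.
    by ring.
  near=> y; rewrite /flat (_ : 0 < y = true)//.
  by near: y; exact: lt_nbhsr.
- rewrite x0 [X in is_derive _ _ _ X]/flat ltxx.
  have [C CP] := flat_bounded (P * 'X^2).
  apply: (@is_derive_quadratic _ C) => h; rewrite flat_shift normrM normrX.
  by rewrite real_normK ?num_real// mulrC ler_wpM2r ?sqr_ge0.
Unshelve. all: by end_near. Qed.

(** The derivative of the composition is a product of a derivative of u and of
    another flat function of u, hence an induction over all P at once. *)
Lemma Ck_flat (V : normedModType R) k (U : set V) P (u : V -> R) : open U ->
  Ck_on k U u -> Ck_on k U (fun z => flat P (u z)).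
Proof.
move=> oU; elim: k P u => [|k IH] P u cu.
  move=> x Ux; apply: continuous_comp; first exact: cu.
  by apply/differentiable_continuous/derivable1_diffP; have [] := is_derive_flat P (u x).
have uk := CkS cu; move: cu => [du cu].
have dP y : differentiable (flat P) y by apply/derivable1_diffP; have [] := is_derive_flat P y.
split=> [x Ux|v]; first by apply: differentiable_comp => //; exact: du.
apply: Ck_on_eq (Ck_mul oU (cu v) (IH ((P - P^`()) * 'X^2) _ uk)) => // x Ux.
rewrite [RHS](derive_comp_diff v erefl (du x Ux) (dP _)) deriveE; last exact: du.
rewrite -[in RHS](mulr1 ('d u x v)) -[_ * 1]/(_ *: (1 : R)) linearZ /=; congr (_ * _).
by rewrite -deriveE//; have [] := is_derive_flat P (u x).
Qed.

Definition cutoff : R -> R := flat 1.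

Lemma cutoff_gt0 x : (0 < cutoff x) = (0 < x).
Proof.
by rewrite /cutoff /flat; case: ifPn => [x0|]; rewrite ?ltxx// hornerC mul1r expR_gt0.
Qed.

Lemma cutoff_ge0 x : 0 <= cutoff x.
Proof.
by rewrite /cutoff /flat; case: ifPn => // _; rewrite hornerC mul1r expR_ge0.
Qed.

Lemma cutoff_eq0 x : x <= 0 -> cutoff x = 0.
Proof. by rewrite /cutoff /flat ltNge => ->. Qed.

End FlatFunctions.

Section LinearPostcomposition.
Context {R : realType} {V : normedModType R}.

Lemma Ck_scale (W : normedModType R) k (U : set V) (f : V -> R) (w : W) : open U ->
  Ck_on k U f -> Ck_on k U (fun x => f x *: w).
Proof.
move=> oU; have L_lin : linear (fun r : R => r *: w) by move=> a b c; rewrite scalerDl scalerA.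
pose L : {linear R -> W} := HB.pack (fun r : R => r *: w) (GRing.isLinear.Build _ _ _ _ _ L_lin).
by apply: (@Ck_linear _ _ _ _ L) => //; exact: scalel_continuous.
Qed.

Lemma Ck_coord m n k (U : set V) (f : V -> 'M[R]_(m, n)) a b : open U ->
  Ck_on k U f -> Ck_on k U (fun x => f x a b).
Proof.
move=> oU; have L_lin : linear (fun N : 'M[R]_(m, n) => N a b) by move=> c A B; rewrite !mxE.
pose L : {linear 'M[R]_(m, n) -> R} :=
  HB.pack (fun N : 'M[R]_(m, n) => N a b) (GRing.isLinear.Build _ _ _ _ _ L_lin).
by apply: (@Ck_linear _ _ _ _ L) => //; exact: coord_continuous.
Qed.

Lemma Ck_matrix m n k (U : set V) (f : V -> 'M[R]_(m, n)) : open U ->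
  (forall a b, Ck_on k U (fun x => f x a b)) -> Ck_on k U f.
Proof.
move=> oU cf.
have -> : f = fun x => \sum_(a < m) \sum_(b < n) f x a b *: delta_mx a b.
  by apply/funext => x; exact: matrix_sum_delta.
by apply: Ck_sum => // a; apply: Ck_sum => // b; exact: Ck_scale.
Qed.

End LinearPostcomposition.

(** * Smooth functions on a manifold *)

Section SmoothFunctions.
Context {R : realType} {n : nat} {M : smoothManifold R n}.
Implicit Types (x y z : M) (i j : chart M).

Definition smooth_fun (u : M -> R) : Prop :=
  forall i, smooth_on (cod i) (u \o phi_inv i).

Lemma smooth_fun_continuous (u : M -> R) : smooth_fun u -> continuous u.
Proof.
move=> su x; have [i ix] := dom_cover x.
apply: (@near_eq_continuous _ _ ((u \o phi_inv i) \o phi i)).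
  by apply: filterS (near_dom ix) => y iy /=; rewrite phiK.
apply: continuous_comp; first exact: phi_continuous.
by have := su i 0%N (phi i x) (phi_cod ix).
Qed.

Definition overlap i j := [set q | cod i q /\ dom j (phi_inv i q)].

Lemma overlapE i j : overlap i j = phi i @` (dom i `&` dom j).
Proof.
apply/seteqP; split => q /=.
  by move=> [iq jq]; exists (phi_inv i q); [split=> //; exact: phi_inv_dom|exact: phi_invK].
by move=> [x [ix jx] <-]; split; [exact: phi_cod|rewrite phiK].
Qed.

Lemma open_overlap i j : open (overlap i j).
Proof.
rewrite openE => q [iq jq]; rewrite -(phi_invK iq).
have [iy jy] : dom i (phi_inv i q) /\ dom j (phi_inv i q) by split=> //; exact: phi_inv_dom.
exact: (near_chart iy (near_dom jy)).
Qed.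

Lemma transition_Ck i j k : Ck_on k (overlap i j) (phi j \o phi_inv i).
Proof. by rewrite overlapE; exact: transition_smooth. Qed.

(** For extensions by 0 from the domain of j, looked at in the chart i: near a
    point outside that domain they vanish. *)
Lemma Ck_overlap (W : normedModType R) i j k (f : 'rV[R]_n -> W) :
  (forall q, cod i q -> ~ dom j (phi_inv i q) -> \forall p \near q, f p = 0) ->
  Ck_on k (overlap i j) f -> Ck_on k (cod i) f.
Proof.
move=> f0 cf; apply: Ck_on_local => q iq.
have iy := phi_inv_dom iq.
have [jy|jy] := pselect (dom j (phi_inv i q)).
  exists f; first exact: (@filterE _ _ (nbhs_filter q)).
  by exists (overlap i j) => //; apply: open_nbhs_nbhs; split => //; exact: open_overlap.
exists (fun=> 0); last by exists setT; [exact: (@filterT _ _ (nbhs_filter q))|exact: Ck_cst].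
exact: f0.
Qed.

(** In a chart around x with coordinates p, take the product over j of
    [cutoff (s^2 - (q_j - p_j)^2)]. It vanishes off a closed ball of the chart,
    which is a closed subset of the manifold, so that its extension by 0 is
    smooth. *)
Lemma bump_function_exists x : exists i (b : M -> R), [/\ smooth_fun b, forall y, 0 <= b y,
  0 < b x & forall y, ~ dom i y -> \forall z \near y, b z = 0].
Proof.
have [i ix] := dom_cover x; pose p := phi i x.
have /near_normP[r r0 rP] : nbhs p (cod i).
  by apply: open_nbhs_nbhs; split; [exact: open_cod|exact: phi_cod].
pose s := r / 2; have s0 : 0 < s by rewrite /s; lra.
have sP q : `|q - p| <= s -> cod i q by move=> qs; apply: rP; apply: le_lt_trans qs _; rewrite /s; lra.
pose B (q : 'rV[R]_n) := \prod_(j < n) cutoff (s ^+ 2 + -1 * ((q 0 j + - p 0 j) * (q 0 j + - p 0 j))).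
have B0 q : B q != 0 -> `|q - p| <= s.
  move=> Bq; rewrite [leLHS]mx_normrE; apply/bigmax_leP; split=> [|[a j] _]; first exact: ltW.
  rewrite /= ord1 !mxE leNgt; apply/negP => sj; case/negP: Bq.
  rewrite /B (bigD1 j)//= cutoff_eq0 ?mul0r// mulN1r subr_le0 -expr2 -[leRHS]real_normK ?num_real//.
  by rewrite ler_sqr ?nnegrE ?(ltW s0)// ltW.
pose b y := if asbool (dom i y) then B (phi i y) else 0.
have bE y : dom i y -> b y = B (phi i y) by move=> iy; rewrite /b asboolT.
have bout y : ~ dom i y -> \forall z \near y, b z = 0.
  move=> iy; have : \forall z \near y, ~ (dom i z /\ `|phi i z - p| <= s).
    apply: open_nbhs_nbhs; split; last by move=> [].
    by rewrite -[X in open X]/(~` [set z | dom i z /\ `|phi i z - p| <= s]); exact/closed_openC/closed_chart_ball.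
  apply: filterS => z zK; rewrite /b; case: asboolP => // iz.
  by apply/eqP/negPn/negP => /B0 zs; apply: zK.
exists i, b; split => //.
- move=> j k; apply: (@Ck_overlap _ j i).
    move=> q jq iy; have := near_chart (phi_inv_dom jq) (bout _ iy).
    by rewrite phi_invK//; apply: (@filterS _ _ (nbhs_filter q)) => z [].
  have oO := @open_overlap j i.
  pose T := phi i \o phi_inv j.
  apply: (@Ck_on_eq _ _ _ _ _ (B \o T)) => // [q [_ iq]|]; first by rewrite /= bE.
  rewrite /B; apply: Ck_prod => // a; apply: Ck_flat => //.
  have cT : Ck_on k (overlap j i) (fun q => T q 0 a + - p 0 a).
    by apply: Ck_add => //; [apply: Ck_coord => //; exact: transition_Ck|exact: Ck_cst].
  apply: Ck_add => //; first exact: Ck_cst.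
  by apply: Ck_mul => //; [exact: Ck_cst|exact: Ck_mul].
- by move=> y; rewrite /b; case: asboolP => // _; apply: prodr_ge0 => a _; exact: cutoff_ge0.
- rewrite bE//; apply: prodr_gt0 => a _; rewrite cutoff_gt0 subrr !mulr0 addr0.
  by rewrite exprn_gt0.
Unshelve. all: by end_near. Qed.

End SmoothFunctions.

(** * Existence of a Riemannian metric *)

Section RiemannianMetric.
Context {R : realType} {n : nat} {M : smoothManifold R n}.
Implicit Types (x y z : M) (i j : chart M).

Lemma tangent_transition i j x (v : tangent x) : dom i x -> dom j x ->
  v j = v i *m jacobian (phi j \o phi_inv i) (phi i x).
Proof.
move=> ix jx; have /asboolP[vij _] := coordP v.
rewrite (vij i j ix jx) -deriveEjacobian; last exact: transition_differentiable.
by rewrite deriveE//; exact: transition_differentiable.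
Qed.

Lemma jacobian_Ck i j k a b :
  Ck_on k (overlap i j) (fun q => jacobian (phi j \o phi_inv i) q a b).
Proof.
have oO := @open_overlap _ _ M i j.
have [dT cT] := @transition_Ck _ _ M i j k.+1.
apply: Ck_on_eq (Ck_coord 0 b oO (cT (delta_mx 0 a))) => // q qO.
by rewrite deriveE; [rewrite mxE|exact: dT].
Qed.

Lemma mulmx_trE m1 m2 (A : 'M[R]_(m1, m2)) a b :
  (A *m A^T) a b = \sum_(c < m2) A a c * A b c.
Proof. by rewrite mxE; apply: eq_bigr => c _; rewrite mxE. Qed.

Lemma sum_vanish (u : nat -> R) N N' : (N <= N')%N -> (forall k, (N < k)%N -> u k = 0) ->
  \sum_(k < N'.+1) u k = \sum_(k < N.+1) u k.
Proof.
move=> NN u0; rewrite -!(big_mkord xpredT u) (big_cat_nat (n:=N.+1))//=.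
by rewrite [X in _ + X]big_nat_cond [X in _ + X]big1 ?addr0// => k /andP[/andP[Nk _] _]; exact: u0.
Qed.

Section WeightedSum.
Variables (I : nat -> chart M) (l : nat -> M -> R) (kappa : M -> nat).
Hypothesis l_smooth : forall k, smooth_fun (l k).
Hypothesis l_ge0 : forall k y, 0 <= l k y.
Hypothesis l_supp : forall k y, ~ dom (I k) y -> \forall z \near y, l k z = 0.
Hypothesis l_fin : forall y, \forall z \near y, forall k, (kappa y < k)%N -> l k z = 0.
Hypothesis l_pos : forall y, exists k, 0 < l k y.

(** The sum of the Euclidean metrics of the charts I k with weights l k. Near y
    all weights of index larger than kappa y vanish, so that the bound kappa x
    of the sum, which is not continuous in x, is locally immaterial. *)
Definition weighted_metric (x : M) (v w : tangent x) : R :=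
  \sum_(k < (kappa x).+1) l k x * (v (I k) *m (w (I k))^T) 0 0.

Definition weighted_term i k (q : 'rV[R]_n) : 'M[R]_n :=
  l k (phi_inv i q) *: (jacobian (phi (I k) \o phi_inv i) q *m
                        (jacobian (phi (I k) \o phi_inv i) q)^T).

Lemma weighted_term_Ck i k m : Ck_on m (cod i) (weighted_term i k).
Proof.
apply: (@Ck_overlap _ _ _ _ i (I k)).
  move=> q iq kq; have := near_chart (phi_inv_dom iq) (l_supp kq).
  rewrite phi_invK//; apply: (@filterS _ _ (nbhs_filter q)) => p [_ lp].
  by rewrite /weighted_term lp scale0r.
have oO := @open_overlap _ _ M i (I k).
apply: Ck_matrix => // a b.
pose J q a c := jacobian (phi (I k) \o phi_inv i) q a c.
apply: (@Ck_on_eq _ _ _ _ _ (fun q => l k (phi_inv i q) * \sum_(c < n) J q a c * J q b c)) => //.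
  by move=> q _; rewrite [RHS]mxE mulmx_trE.
apply: Ck_mul => //; last by apply: Ck_sum => // c; apply: Ck_mul => //; exact: jacobian_Ck.
by apply: Ck_on_sub (l_smooth k i m) => q [].
Qed.

Lemma l_fin_at y k : (kappa y < k)%N -> l k y = 0.
Proof. by move=> yk; have := nbhs_singleton (l_fin y); exact. Qed.

Lemma weighted_metric_riemannian : riemannian weighted_metric.
Proof.
split.
- move=> i; exists (fun q => \sum_(k < (kappa (phi_inv i q)).+1) weighted_term i k q).
    move=> m; apply: Ck_on_local => q iq; have iy := phi_inv_dom iq.
    pose N := kappa (phi_inv i q).
    exists (fun p => \sum_(k < N.+1) weighted_term i k p).
      have := near_chart iy (l_fin (phi_inv i q)); rewrite phi_invK//.
      apply: (@filterS _ _ (nbhs_filter q)) => p [ip lN].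
      pose N' := kappa (phi_inv i p).
      apply/matrixP => a b; rewrite !summxE.
      have z1 k : (N < k)%N -> weighted_term i k p a b = 0.
        by move=> Nk; rewrite /weighted_term lN// scale0r mxE.
      have z2 k : (N' < k)%N -> weighted_term i k p a b = 0.
        by move=> Nk; rewrite /weighted_term l_fin_at// scale0r mxE.
      rewrite -(@sum_vanish _ N (maxn N N') (leq_maxl _ _) z1).
      by rewrite -(@sum_vanish _ N' (maxn N N') (leq_maxr _ _) z2).
    exists (cod i); first by apply: open_nbhs_nbhs; split => //; exact: open_cod.
    apply: Ck_sum; first exact: open_cod.
    by move=> k; exact: weighted_term_Ck.
  move=> x v w ix; rewrite phiK// mulmx_sumr mulmx_suml summxE.
  apply: eq_bigr => k _; rewrite /weighted_term phiK//.
  have [kx|kx] := pselect (dom (I k) x); last first.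
    by rewrite (nbhs_singleton (l_supp kx)) mul0r scale0r mulmx0 mul0mx mxE.
  rewrite -scalemxAr -scalemxAl [RHS]mxE; congr (_ * _).
  by rewrite !(tangent_transition _ ix kx) trmx_mul !mulmxA.
- move=> x v w; apply: eq_bigr => k _; congr (_ * _).
  by rewrite -[w (I k) *m _]trmxK trmx_mul trmxK [RHS]mxE.
- move=> x v v0.
  have sq (u : 'rV[R]_n) : (u *m u^T) 0 0 = \sum_(c < n) u 0 c ^+ 2.
    by rewrite mxE; apply: eq_bigr => c _; rewrite mxE expr2.
  have term0 k : 0 <= l k x * (v (I k) *m (v (I k))^T) 0 0.
    by rewrite mulr_ge0// sq sumr_ge0// => c _; exact: sqr_ge0.
  have [k kx] := l_pos x.
  have kN : (k < (kappa x).+1)%N.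
    by rewrite ltnS leqNgt; apply/negP => /l_fin_at lk; rewrite lk ltxx in kx.
  rewrite /weighted_metric (bigD1 (Ordinal kN))//= ltr_wpDr//.
    by apply: sumr_ge0 => j _; exact: term0.
  rewrite mulr_gt0// lt_neqAle sq sumr_ge0 ?andbT; last by move=> c _; exact: sqr_ge0.
  have kd : dom (I k) x.
    apply: contrapT => kd; have := nbhs_singleton (l_supp kd) => lk.
    by rewrite lk ltxx in kx.
  have vk : v (I k) != 0.
    apply/eqP => vk; apply: v0; apply: (tangent_inj kd); rewrite vk.
    by have [_] := coordP (0 : tangent x).
  rewrite eq_sym psumr_eq0; last by move=> c _; exact: sqr_ge0.
  apply: contraNN vk => /allP H; apply/eqP/rowP => c.
  by have := H c (mem_index_enum _); rewrite /= mxE sqrf_eq0 => /eqP.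
Qed.

End WeightedSum.

(** Countably many sets W cover the manifold. The k-th bump function b k is
    multiplied by cutoffs that vanish as soon as an earlier one exceeds its
    threshold t j. Hence the weights l k with k > N vanish near y if t N < b N y,
    whereas l k y > 0 for the smallest k with t k <= b k y. *)
Lemma riemannian_exists (x0 : M) : exists g : forall x : M, tangent x -> tangent x -> R,
  riemannian g.
Proof.
have /choice[I0 /choice[B BP]] := @bump_function_exists _ _ M.
have cB x : continuous (B x) by have [sB _ _ _] := BP x; exact: smooth_fun_continuous.
pose W x := [set y | B x x / 2 < B x y].
have xW x : nbhs x (W x).
  have [_ _ bx _] := BP x; have h : B x x / 2 < B x x by lra.
  exact: (cvgr_gt _ (cB x x) _ h).
have [A cA [oA bA]] := @manifold_second_countable _ _ M.
have /countable_injP[c cinj] := cA.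
pose D k := xget x0 [set x | exists2 U, A U /\ c U = k & U `<=` W x].
have D_cover y : exists k, W (D k) y.
  have [U [AU Uy] UW] := bA y _ (xW y).
  exists (c U); rewrite /D; case: xgetP => [x _ [U' [AU' cU] U'W]|/(_ y)]; last by case; exists U.
  by apply: U'W; rewrite (cinj U' U) ?inE.
pose b k := B (D k); pose t k := b k (D k) / 2.
have t0 k : 0 < t k by rewrite /t /b divr_gt0//; have [] := BP (D k).
pose l k (y : M) := b k y * \prod_(j <- iota 0 k) cutoff (t j + -1 * b j y).
have b_sm k : smooth_fun (b k) by have [] := BP (D k).
have l_fin y : exists N, \forall z \near y, forall k, (N < k)%N -> l k z = 0.
  have [N Ny] := D_cover y; exists N.
  have : \forall z \near y, t N < b N z by exact: (cvgr_gt _ (cB (D N) y) _ Ny).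
  apply: filterS => z Nz k Nk; rewrite /l (bigD1_seq N) ?iota_uniq ?mem_iota//=.
  by rewrite cutoff_eq0 ?mul0r ?mulr0//; lra.
have [kappa kappaP] := choice l_fin.
exists (weighted_metric (fun k => I0 (D k)) l kappa).
apply: weighted_metric_riemannian => //.
- move=> k i m; have oi := open_cod (i:=i).
  apply: Ck_mul => //; first exact: b_sm.
  apply: Ck_prod => // j; apply: Ck_flat => //.
  apply: Ck_add => //; first exact: Ck_cst.
  by apply: Ck_mul => //; [exact: Ck_cst|exact: b_sm].
- move=> k y; apply: mulr_ge0; first by have [_ + _ _] := BP (D k); apply.
  by apply: prodr_ge0 => j _; exact: cutoff_ge0.
- move=> k y ky; have [_ _ _ /(_ y ky)] := BP (D k).
  by apply: filterS => z bz; rewrite /l /b bz mul0r.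
- move=> y; have ex : exists k, t k <= b k y by have [k ky] := D_cover y; exists k; exact: ltW.
  case: (ex_minnP ex) => k ky kmin; exists k.
  apply: mulr_gt0; first exact: lt_le_trans ky.
  rewrite big_seq_cond; apply: prodr_gt0 => j.
  rewrite mem_iota /= add0n andbT => jk; rewrite cutoff_gt0.
  have : b j y < t j by rewrite ltNge; apply/negP => /kmin; rewrite leqNgt jk.
  by lra.
Qed.

End RiemannianMetric.

(** * The Finsler structure of a Riemannian metric *)

Section RiemannianNorm.
Context {R : realType}.

(** The triangle inequality is the inequality of Cauchy-Schwarz, that is the
    positivity of B at v - s w for s = B v w / B w w. *)
Lemma inner_product_norm (V : lmodType R) (B : V -> V -> R) :
  (forall a u v w, B (a *: u + v) w = a * B u w + B v w) ->
  (forall v w, B v w = B w v) -> (forall v, v <> 0 -> 0 < B v v) ->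
  weak_norm (fun v => Num.sqrt (B v v)).
Proof.
move=> Blin Bsym Bpos.
have Badd u v w : B (u + v) w = B u w + B v w by rewrite -[u]scale1r Blin scale1r mul1r.
have B0 w : B 0 w = 0 by have := Badd 0 0 w; rewrite addr0; lra.
have Bscale a u w : B (a *: u) w = a * B u w by rewrite -[a *: u]addr0 Blin B0 addr0.
have Bge0 v : 0 <= B v v.
  by have [->|v0] := pselect (v = 0); [rewrite B0|exact/ltW/Bpos].
have cauchy v w : B v w <= Num.sqrt (B v v) * Num.sqrt (B w w).
  have [->|w0] := pselect (w = 0); first by rewrite Bsym B0 mulr_ge0 ?sqrtr_ge0.
  have c0 := Bpos _ w0.
  rewrite -sqrtrM//; apply: le_trans (ler_norm _) _; rewrite -sqrtr_sqr ler_sqrt; last first.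
    by rewrite mulr_ge0.
  have := Bge0 (v + (- (B v w / B w w)) *: w).
  rewrite Badd Bscale ![B _ (v + _)]Bsym !Badd !Bscale (Bsym w v).
  have : B v w / B w w * B w w = B v w by rewrite divfK ?gt_eqF.
  move: (B v w / B w w) => s.
  move: (B v w) (B v v) (B w w) c0 => b a c c0 sc H.
  have : 0 <= a - s * b by move: H; rewrite -sc; lra.
  by rewrite -sc; nra.
split=> [v|v w|a v a0|v].
- exact: sqrtr_ge0.
- rewrite -(ger0_norm (sqrtr_ge0 (B (v + w) (v + w)))).
  have s0 := addr_ge0 (sqrtr_ge0 (B v v)) (sqrtr_ge0 (B w w)).
  rewrite -[leRHS](ger0_norm s0) -ler_sqr ?nnegrE ?normr_ge0// !real_normK ?num_real//.
  rewrite sqr_sqrtr// sqrrD !sqr_sqrtr// Badd ![B _ (v + w)]Bsym !Badd (Bsym w v).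
  have := cauchy v w; lra.
- by rewrite Bscale Bsym Bscale mulrA -expr2 sqrtrM ?sqr_ge0// sqrtr_sqr ger0_norm.
- split=> [/eqP|->]; last by rewrite B0 sqrtr0.
  by apply: contraPP => /Bpos v0; rewrite sqrtr_eq0 leNgt v0.
Qed.

Lemma continuous_sum (T : topologicalType) I (s : seq I) (f : I -> T -> R) (p : T) :
  (forall i, {for p, continuous (f i)}) -> {for p, continuous (fun q => \sum_(i <- s) f i q)}.
Proof.
rewrite /prop_for /continuous_at => cf; elim: s => [|i s IH].
  by under eq_fun do rewrite big_nil; rewrite big_nil; exact: cvg_cst.
by under eq_fun do rewrite big_cons; rewrite big_cons; apply: cvgD; [exact: cf|exact: IH].
Qed.

Context {n : nat} {M : smoothManifold R n}.

Lemma riemannian_finsler (g : forall x : M, tangent x -> tangent x -> R) :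
  riemannian g -> finsler (riemannian_norm g).
Proof.
move=> [g_loc g_sym g_pos]; split=> [i|x].
  have [G G_sm gG] := g_loc i.
  exists (fun p => Num.sqrt ((p.2 *m G p.1 *m p.2^T) 0 0)).
    by move=> x v ix; rewrite /riemannian_norm gG.
  move=> p ip; apply: continuous_comp; last exact: sqrt_continuous.
  have -> : (fun p : 'rV[R]_n * 'rV[R]_n => (p.2 *m G p.1 *m p.2^T) 0 0) =
     fun p => \sum_(b < n) (\sum_(a < n) p.2 0 a * G p.1 a b) * p.2 0 b.
    by apply/funext => q; rewrite mxE; apply: eq_bigr => b _; rewrite !mxE.
  have c2 a : {for p, continuous (fun q : 'rV[R]_n * 'rV[R]_n => q.2 0 a)}.
    by apply: (@continuous_comp _ _ _ snd (fun v : 'rV[R]_n => v 0 a)); [exact: cvg_snd|exact: coord_continuous].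
  have cG a b : {for p, continuous (fun q : 'rV[R]_n * 'rV[R]_n => G q.1 a b)}.
    apply: (@continuous_comp _ _ _ (fun q : 'rV[R]_n * 'rV[R]_n => G q.1) (fun A => A a b)); last exact: coord_continuous.
    by apply: (@continuous_comp _ _ _ fst G); [exact: cvg_fst|exact: (G_sm 0%N)].
  apply: continuous_sum => b; apply: cvgM; last exact: c2.
  by apply: continuous_sum => a; apply: cvgM; [exact: c2|exact: cG].
have [i ix] := dom_cover x; have [G _ gG] := g_loc i.
apply: inner_product_norm; [|exact: g_sym|exact: g_pos].
move=> a u v w; rewrite !gG//.
have -> : (a *: u + v) i = a *: u i + v i by [].
by rewrite !mulmxDl -!scalemxAl mxE [X in X + _]mxE.
Qed.

End RiemannianNorm.

(** * Monotonicity in the Finsler structure *)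

Section Comparison.
Context {R : realType} {n : nat} {M : smoothManifold R n}.
Hypothesis conM : connected [set: M].
Implicit Types x y : M.

Variables F G : forall x : M, tangent x -> R.
Hypothesis fin_F : finsler F.
Hypothesis fin_G : finsler G.
Variable c : R.
Hypothesis c0 : 0 <= c.
Hypothesis FG : forall x (v : tangent x), c * F v <= G v.
Lemma le_finsler_dist x y : (c%:E * finsler_dist F x y <= finsler_dist G x y)%E.
Proof.
apply: le_ereal_inf_tmp => _ [a [b [beta [ab pb <- <- ->]]]].
have cF := finsler_dist_le F pb.
apply: (@le_trans _ _ (c%:E * finsler_length F a b beta)%E).
  by apply: lee_wpmul2l cF; rewrite lee_fin.
have mF : measurable_fun `[a, b]%classic (EFin \o speed F beta).
  by apply/measurable_EFinP; exact: (piecewise_measurable fin_F pb).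
have mG : measurable_fun `[a, b]%classic (EFin \o speed G beta).
  by apply/measurable_EFinP; exact: (piecewise_measurable fin_G pb).
rewrite /finsler_length -ge0_integralZl//; last by move=> s _; rewrite lee_fin; exact: speed_ge0.
apply: ge0_le_integral => //.
- by move=> s _; rewrite -EFinM lee_fin mulr_ge0//; exact: speed_ge0.
- by apply: measurable_funeM.
- by move=> s _; rewrite -EFinM lee_fin; exact: FG.
Qed.

Lemma le_rdist x y : c * rdist F x y <= rdist G x y.
Proof.
have := le_finsler_dist x y.
by rewrite (rdistE conM fin_F) (rdistE conM fin_G) -EFinM lee_fin.
Qed.

(** A Cauchy sequence of G is one of F, and its limit is a limit for G as well,
    because both metrics induce the topology of the manifold. *)
Lemma le_finsler_complete : 0 < c -> finsler_complete F -> finsler_complete G.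
Proof.
move=> cp cF x cx; have [|y xy] := cF x.
  move=> e e0; have [|N NP] := cx (c * e); first by rewrite mulr_gt0.
  exists N => m k Nm mk; have := NP m k Nm mk.
  rewrite (rdistE conM fin_F) (rdistE conM fin_G) !lte_fin => dG.
  by rewrite -(ltr_pM2l cp); apply: le_lt_trans dG; exact: le_rdist.
exists y.
apply/(rdist_cvg0 conM fin_G) => e e0.
have [d d0 dP] := nbhs_rdist conM fin_F (rdist_near conM fin_G y e0).
have := (rdist_cvg0 conM fin_F x y).1 xy d d0; apply: filterS => m md.
by have [] := dP (x m) (or_intror md).
Qed.

End Comparison.

(** * The maximum of two Finsler structures *)

Section MaxFinsler.
Context {R : realType} {n : nat} {M : smoothManifold R n}.
Variables (F1 F2 : forall x : M, tangent x -> R) (t : R).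
Hypothesis fin1 : finsler F1.
Hypothesis fin2 : finsler F2.
Hypothesis t01 : 0 <= t <= 1.

Lemma max_finslerP : finsler (max_finsler t F1 F2).
Proof.
have [loc1 wn1] := fin1; have [loc2 wn2] := fin2.
have [t0 t1] := andP t01; have s0 : 0 <= 1 - t by rewrite subr_ge0.
split=> [i|x].
  have [f1 F1f c1] := loc1 i; have [f2 F2f c2] := loc2 i.
  exists (fun p => Num.max ((1 - t) * f1 p) (t * f2 p)).
    by move=> x v ix; rewrite /max_finsler (F1f _ _ ix) (F2f _ _ ix).
  move=> p ip; apply: continuous_max; apply: cvgM; try exact: cvg_cst.
  - exact: c1.
  - exact: c2.
have [p1 a1 h1 z1] := wn1 x; have [p2 a2 h2 z2] := wn2 x.
rewrite /max_finsler; split=> [v|v w|a v a0|v].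
- by rewrite le_max mulr_ge0.
- rewrite ge_max; apply/andP; split.
    apply: le_trans (ler_wpM2l s0 (a1 v w)) _.
    by rewrite mulrDr lerD// le_max lexx.
  apply: le_trans (ler_wpM2l t0 (a2 v w)) _.
  by rewrite mulrDr lerD// le_max lexx orbT.
- by rewrite h1// h2// maxr_pMr//; congr Num.max; ring.
- split=> [m0|->]; last by rewrite (z1 0).2 // (z2 0).2 // !mulr0 maxxx.
  have /andP[m1 m2] : ((1 - t) * F1 v <= 0) && (t * F2 v <= 0) by rewrite -ge_max m0.
  have [t_lt1|t_ge1] := ltP t 1.
    apply/z1/eqP; rewrite eq_le p1 andbT.
    by rewrite -(@pmulr_rle0 _ (1 - t)) ?subr_gt0.
  have tp : 0 < t := lt_le_trans ltr01 t_ge1.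
  by apply/z2/eqP; rewrite eq_le p2 andbT -(pmulr_rle0 _ tp).
Qed.

End MaxFinsler.

(** * Comparison of two metrics along a geodesic *)

Section GeodesicComparison.
Context {R : realType} {n : nat} {M : smoothManifold R n}.
Local Notation mu := (@lebesgue_measure R).
Hypothesis conM : connected [set: M].
Implicit Types (gamma : R -> M) (s u v h e : R).

Lemma within_near gamma s (A : set M) : {within `[0, 1], continuous gamma} ->
  0 <= s <= 1 -> nbhs (gamma s) A ->
  exists2 d, 0 < d & forall u, 0 <= u <= 1 -> `|u - s| < d -> A (gamma u).
Proof.
move=> /subspace_continuousP cg s01 /(cg s) H.
have /nbhs_ballP[d d0 dP] : nbhs s (fun u => `[0, 1]%classic u -> A (gamma u)).
  by apply: H; rewrite /= in_itv.
exists d => // u u01 us; apply: dP; last by rewrite /= in_itv.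
by rewrite /ball /= distrC.
Qed.

Lemma within_interior gamma s : {within `[0, 1], continuous gamma} -> 0 < s < 1 ->
  {for s, continuous gamma}.
Proof.
move=> cg s01 A sA; have s01' : 0 <= s <= 1 by lra.
have [d d0 dP] := within_near cg s01' sA.
suff: \forall u \near s, A (gamma u) by [].
near=> u; apply: dP.
  apply/andP; split; apply: ltW; near: u; [apply: lt_nbhsr|apply: lt_nbhsl]; lra.
by rewrite distrC; near: u; apply/nbhs_ballP; exists d.
Unshelve. all: by end_near. Qed.

Lemma coordinates_velocity gamma s i : {for s, continuous gamma} -> dom i (gamma s) ->
  (forall j, derivable (fun u => phi i (gamma u) 0 j) s 1) ->
  has_velocity (velocity gamma s).
Proof.
move=> cg ix dg.
have dphi : derivable (phi i \o gamma) s 1.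
  by apply/derivable_mxP => a j; rewrite ord1; exact: dg.
have [v vE] := tangent_exists ('D_1 (phi i \o gamma) s) ix.
have hv : has_velocity v.
  by apply: (has_velocity_chart cg ix); rewrite vE; exact: DeriveDef.
by rewrite (velocityE hv).
Qed.

Section Sufficiency.
Variables F G H : forall x : M, tangent x -> R.
Hypothesis fin_F : finsler F.
Hypothesis fin_G : finsler G.
Hypothesis fin_H : finsler H.
Variables (c : R) (gamma : R -> M).
Hypothesis c0 : 0 <= c.
Hypothesis acH : forall e : R, 0 < e -> exists2 d : R, 0 < d &
  forall (k : nat) (l r : 'I_k -> R),
    (forall i, 0 <= l i /\ l i <= r i /\ r i <= 1) ->
    trivIset [set: 'I_k] (fun i => `]l i, r i[%classic) ->
    \sum_(i < k) (r i - l i) < d ->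
    \sum_(i < k) rdist H (gamma (l i)) (gamma (r i)) < e.
Hypothesis cg : {within `[0, 1], continuous gamma}.
Hypothesis geo : forall s u, 0 <= s -> s <= u -> u <= 1 ->
  rdist G (gamma 0) (gamma s) + rdist G (gamma s) (gamma u) <= rdist G (gamma 0) (gamma u).
Hypothesis speed_le : {ae mu, forall s, 0 < s < 1 -> speed F gamma s <= c * speed G gamma s}.

Lemma ac_dominated u v C (h : R -> R) : 0 <= u -> v <= 1 -> 0 < C ->
  (forall s s', u <= s -> s <= s' -> s' <= v ->
     `|h s' - h s| <= C * rdist H (gamma s) (gamma s')) -> ac_fun u v h.
Proof.
move=> u0 v1 C0 hC e e0; have eC : 0 < e / C by rewrite divr_gt0.
have [d d0 dP] := acH eC; exists d => // k l r lr tr sd.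
have := dP k l r _ tr sd; rewrite ltr_pdivlMr// mulrC mulr_sumr => dP'.
apply: le_lt_trans (dP' _).
  by apply: ler_sum => i _; have [ul [lr' rv]] := lr i; exact: hC.
move=> i; have [ul [lr' rv]] := lr i.
by split; [exact: le_trans ul|split=> //; exact: le_trans v1].
Qed.

(** The claim is that the excess is non-positive at 1. The first distance grows at
    most at the F-speed of gamma, and the second one grows at its G-speed,
    because gamma is a geodesic. *)
Definition excess s := rdist F (gamma 0) (gamma s) - c * rdist G (gamma 0) (gamma s).

Lemma excess_le s u : 0 <= s -> s <= u -> u <= 1 ->
  excess u - excess s <= rdist F (gamma s) (gamma u) - c * rdist G (gamma s) (gamma u).
Proof.
move=> s0 su u1; rewrite /excess.
have := rdist_triangle conM fin_F (gamma s) (gamma 0) (gamma u).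
have := ler_wpM2l c0 (geo s0 su u1); rewrite mulrDr; lra.
Qed.

Lemma excess_derive s : 0 < s < 1 -> has_velocity (velocity gamma s) ->
  speed F gamma s <= c * speed G gamma s -> derivable excess s 1 ->
  'D_1 excess s <= 0.
Proof.
move=> s01 hv sp dx; apply/ler_addgt0Pr => e e0; rewrite add0r.
have e'0 : 0 < e / 2 / (1 + c) by rewrite !divr_gt0//; have := c0; lra.
have [d1 d10 D1] := metric_derivative conM fin_F hv e'0.
have [d2 d20 D2] := metric_derivative conM fin_G hv e'0.
have q := is_derive_quotient (derivableP dx).
move/cvgrPdist_lt : q => /(_ (e / 2) ltac:(lra))[d3 /= d30 D3].
pose h := Num.min (Num.min d1 d2) (Num.min d3 (1 - s)) / 2.
have m0 : 0 < Num.min (Num.min d1 d2) (Num.min d3 (1 - s)) by rewrite !lt_min d10 d20 d30 /=; lra.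
have [h1 h2 h3 h4] : [/\ h < d1, h < d2, h < d3 & h < 1 - s].
  have : h < Num.min (Num.min d1 d2) (Num.min d3 (1 - s)) by rewrite /h; lra.
  by rewrite !lt_min => /andP[/andP[? ?] /andP[? ?]].
have h0 : 0 < h by rewrite /h; lra.
have /D3 : ball_ Num.norm 0 d3 h by rewrite /ball_ /= sub0r normrN gtr0_norm.
move=> /(_ (lt0r_neq0 h0)) /=; rewrite distrC ltr_norml => /andP[+ _].
have := D1 h; have := D2 h; rewrite h0 h1 h2 => /(_ isT) + /(_ isT).
rewrite !ler_norml => /andP[L1 _] /andP[_ L2] L3.
have E : excess (s + h) - excess s <= h * (e / 2).
  apply: le_trans (excess_le _ _ _) _; [lra|lra|lra|].
  have eE : (1 + c) * (e / 2 / (1 + c)) = e / 2 by rewrite mulrC divfK// gt_eqF//; have := c0; lra.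
  have := ler_wpM2l c0 L1; have := ler_wpM2l (ltW h0) sp.
  have : h * (e / 2) = h * (e / 2 / (1 + c)) + c * (h * (e / 2 / (1 + c))) by rewrite -{1}eE; ring.
  move: L2; move: (e / 2 / (1 + c)) (e / 2) (rdist _ _ _) (rdist _ _ _) (speed _ _ _) (speed _ _ _) => a b x y z w.
  by lra.
have : h^-1 *: (excess (s + h) - excess s) <= e / 2.
  have scaleE (a b : R) : a *: b = a * b by [].
  by rewrite scaleE ler_pdivrMl.
move: L3; move: (h^-1 *: _) ('D_(1 : R) excess s) => a b; lra.
Qed.


(** In a small chart the excess and the coordinates of gamma vary no more than
    gamma does for the metric H, so that all of them are absolutely continuous;
    where the coordinates are differentiable gamma has a velocity. *)
Lemma excess_decrease s : 0 <= s <= 1 -> exists2 d, 0 < d &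
  forall u v, 0 <= u -> v <= 1 -> s - d < u -> u <= v -> v < s + d -> excess v <= excess u.
Proof.
move=> s01; have [i ix] := dom_cover (gamma s).
have [r1 [C1 [r10 C10 B1]]] := rdist_bilipschitz conM fin_F ix.
have [r2 [C2 [r20 C20 B2]]] := rdist_bilipschitz conM fin_G ix.
have [r3 [C3 [r30 C30 B3]]] := rdist_bilipschitz conM fin_H ix.
have r0 : 0 < Num.min r1 (Num.min r2 r3) by rewrite !lt_min r10 r20.
have [d d0 dP] := within_near cg s01 (chart_nbhs ix r0).
exists d => // u v u0 v1 su uv vs.
have chartP w : u <= w -> w <= v -> [/\ dom i (gamma w), `|phi i (gamma w) - phi i (gamma s)| < r1,
    `|phi i (gamma w) - phi i (gamma s)| < r2 & `|phi i (gamma w) - phi i (gamma s)| < r3].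
  move=> uw wv; have [||iw] := dP w; [lra|by rewrite ltr_distl; lra|].
  by rewrite !lt_min => /and3P[].
pose cH w w' := rdist H (gamma w) (gamma w').
have chart_le w w' : u <= w -> w <= w' -> w' <= v ->
    `|phi i (gamma w') - phi i (gamma w)| <= C3 * cH w w'.
  move=> uw ww wv; have [iw _ _ w3] := chartP w uw (le_trans ww wv).
  by have [iw' _ _ w3'] := chartP w' (le_trans uw ww) wv; have [] := B3 _ _ iw w3 iw' w3'.
have ac_coord j : ac_fun u v (fun w => phi i (gamma w) 0 j).
  apply: (ac_dominated u0 v1 C30) => w w' uw ww wv; apply: le_trans (chart_le _ _ uw ww wv).
  rewrite [leRHS]mx_normrE.
  have := le_bigmax 0 (fun ij : 'I_1 * 'I_n => `|(phi i (gamma w') - phi i (gamma w)) ij.1 ij.2|) (0, j).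
  by rewrite /= !mxE.
have CC0 : 0 < (C1 + c * C2) * C3 by rewrite mulr_gt0// ltr_wpDr// mulr_ge0// ltW.
have ac_excess : ac_fun u v excess.
  apply: (ac_dominated u0 v1 CC0) => w w' uw ww wv.
  have [iw w1 w2 _] := chartP w uw (le_trans ww wv).
  have [iw' w1' w2' _] := chartP w' (le_trans uw ww) wv.
  have [F1 _] := B1 _ _ iw w1 iw' w1'; have [F2 _] := B1 _ _ iw' w1' iw w1.
  have [G1 _] := B2 _ _ iw w2 iw' w2'; have [G2 _] := B2 _ _ iw' w2' iw w2.
  rewrite distrC in F2; rewrite distrC in G2.
  rewrite -mulrA; apply: (@le_trans _ _ ((C1 + c * C2) * `|phi i (gamma w') - phi i (gamma w)|)); last first.
    apply: ler_wpM2l; last exact: chart_le.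
    by rewrite addr_ge0 ?mulr_ge0// ltW.
  have T1 := rdist_triangle conM fin_F (gamma w) (gamma 0) (gamma w').
  have T2 := rdist_triangle conM fin_F (gamma w') (gamma 0) (gamma w).
  have := rdist_triangle conM fin_G (gamma w) (gamma 0) (gamma w').
  have := rdist_triangle conM fin_G (gamma w') (gamma 0) (gamma w).
  move=> /(ler_wpM2l c0) + /(ler_wpM2l c0); have := ler_wpM2l c0 G1; have := ler_wpM2l c0 G2.
  rewrite !mulrDr mulrDl (mulrA c C2) /excess ler_norml => g1 g2 g3 g4.
  by apply/andP; split; clear -F1 F2 T1 T2 g1 g2 g3 g4; lra.
apply: (ac_fun_decreasing uv ac_excess).
have ae_coord : {ae mu, forall w, forall j, u < w < v ->
    derivable (fun w => phi i (gamma w) 0 j) w 1}.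
  by apply: filter_forall => j; exact: ac_fun_derivable.
apply: (filterS2 (ae_filter_ringOfSetsType mu) _ ae_coord speed_le).
move=> w dw sw wuv; have w01 : 0 < w < 1 by lra.
apply: excess_derive => //; last exact: sw.
have [iw _ _ _] := chartP w (ltW (andP wuv).1) (ltW (andP wuv).2).
apply: (coordinates_velocity (within_interior cg w01) iw) => j.
exact: dw.
Qed.

Lemma dominated_dist_le : rdist F (gamma 0) (gamma 1) <= c * rdist G (gamma 0) (gamma 1).
Proof.
have : excess 1 <= excess 0.
  apply: (@chain_local _ 0 1 (fun u v => excess v <= excess u)) => //.
  - by move=> s u v _ _ su uv; exact: le_trans uv su.
  - exact: excess_decrease.
by rewrite /excess (rdistxx fin_F) (rdistxx fin_G) mulr0 subrr subr_le0.
Qed.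

End Sufficiency.

End GeodesicComparison.
(** * Geodesics and shortest paths *)

Section Geodesics.
Context {R : realType} {n : nat} {M : smoothManifold R n}.
Local Notation mu := (@lebesgue_measure R).
Hypothesis conM : connected [set: M].
Implicit Types (gamma : R -> M) (F G : forall x : M, tangent x -> R).

(** The sum over the partition 0, s, u, 1 is at most the length, which is the
    distance of the endpoints. *)
Lemma geodesic_additive G gamma (fin_G : finsler G) : geodesic G 0 1 gamma ->
  forall s u, 0 <= s -> s <= u -> u <= 1 ->
  rdist G (gamma 0) (gamma s) + rdist G (gamma s) (gamma u) <= rdist G (gamma 0) (gamma u).
Proof.
move=> [_ _ E] s u s0 su u1.
have : (finsler_dist G (gamma 0%R) (gamma s) + finsler_dist G (gamma s) (gamma u) +
    finsler_dist G (gamma u) (gamma 1%R) <= finsler_dist G (gamma 0%R) (gamma 1%R))%E.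
  rewrite -E; apply: ereal_sup_ubound; exists 2%N, (nth 1 [:: 0; s; u]); split => //.
    by case=> [|[|[|k]]].
  by rewrite !big_ord_recr big_ord0 /= add0e.
rewrite !(rdistE conM fin_G) -!EFinD lee_fin.
have := rdist_triangle conM fin_G (gamma u) (gamma 0) (gamma 1); lra.
Qed.

Lemma absolutely_continuous_rdist gamma : absolutely_continuous 0 1 gamma ->
  exists2 H : (forall x : M, tangent x -> R), finsler H &
  forall e : R, 0 < e -> exists2 d : R, 0 < d &
  forall (k : nat) (l r : 'I_k -> R),
    (forall i, 0 <= l i /\ l i <= r i /\ r i <= 1) ->
    trivIset [set: 'I_k] (fun i => `]l i, r i[%classic) ->
    \sum_(i < k) (r i - l i) < d ->
    \sum_(i < k) rdist H (gamma (l i)) (gamma (r i)) < e.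
Proof.
move=> [g /riemannian_finsler fin_g acg]; exists (riemannian_norm g) => // e e0.
have [d d0 dP] := acg e e0; exists d => // k l r lr tr sd.
have := dP k l r lr tr sd; under eq_bigr do rewrite (rdistE conM fin_g).
by rewrite sumEFin lte_fin.
Qed.

Lemma dist_le_of_geodesic F G c gamma (fin_F : finsler F) (fin_G : finsler G) : 0 <= c ->
  absolutely_continuous 0 1 gamma -> geodesic G 0 1 gamma ->
  (\forall s \ae mu, `[0, 1]%classic s ->
     F _ (velocity gamma s) <= c * G _ (velocity gamma s)) ->
  rdist F (gamma 0) (gamma 1) <= c * rdist G (gamma 0) (gamma 1).
Proof.
move=> c0 /absolutely_continuous_rdist[H fin_H acH] geo sp.
apply: (dominated_dist_le conM fin_F fin_G fin_H c0 acH).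
- by have [] := geo.
- exact: geodesic_additive.
- apply: filterS sp; first exact: (ae_filter_ringOfSetsType mu).
  by move=> s sp s01; apply: sp; rewrite /= in_itv /=; lra.
Qed.

Lemma ae_interior (P : R -> Prop) : (forall s, 0 < s < 1 -> P s) ->
  \forall s \ae mu, `[0, 1]%classic s -> P s.
Proof.
move=> H; exists ([set 0] `|` [set 1]); split.
- by apply: measurableU.
- apply/eqP; rewrite -measure_le0; apply: le_trans (measureU2 _ _ _) _ => //.
  have Z : (mu [set 0%R] + mu [set 1%R] = 0)%E by rewrite !lebesgue_measure_set1 adde0.
  by rewrite -Z.
- move=> s /= /not_implyP[]; rewrite in_itv /= => /andP[s0 s1] nP.
  have [->|s0'] := eqVneq s 0; first by left.
  right; apply: contrapT => s1'; apply: nP; apply: H.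
  rewrite lt_neqAle eq_sym s0' s0 /= lt_neqAle s1 andbT.
  by apply/eqP.
Qed.

Lemma speed_of_linear G gamma s a d D (fin_G : finsler G) :
  has_velocity (velocity gamma s) -> 0 <= a -> 0 < d ->
  (forall h, 0 < h < d -> a * rdist G (gamma s) (gamma (s + h)) = h * D) ->
  a * speed G gamma s = D.
Proof.
move=> hv a0 d0 lin; apply/eqP; rewrite -subr_eq0 -normr_le0.
apply/ler_addgt0Pr => e e0; rewrite add0r.
have e'0 : 0 < e / (a + 1) by rewrite divr_gt0//; lra.
have [d' d'0 dP] := metric_derivative conM fin_G hv e'0.
pose h := Num.min d d' / 2; have m0 : 0 < Num.min d d' by rewrite lt_min d0.
have h0 : 0 < h by rewrite /h; lra.
have /andP[hd hd'] : (h < d) && (h < d') by rewrite -lt_min /h; lra.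
have := dP h; rewrite h0 hd' => /(_ isT) /(ler_wpM2l a0).
rewrite -[X in X * `|_|](ger0_norm a0) -normrM mulrBr lin ?h0//.
have -> : h * D - a * (h * speed G gamma s) = - h * (a * speed G gamma s - D) by ring.
rewrite normrM normrN (gtr0_norm h0) => le_e; rewrite -(ler_pM2l h0).
apply: le_trans le_e _; rewrite mulrA [leRHS]mulrC ler_pM2r// mulrA ler_pdivrMr; last lra.
by rewrite mulrC ler_pM2l//; lra.
Qed.

Section Minimizers.
Variables (F : forall x : M, tangent x -> R) (gamma : R -> M) (D : R).
Hypothesis fin_F : finsler F.
Hypothesis D0 : 0 <= D.
Hypothesis gammaD : forall u v, 0 <= u -> u <= v -> v <= 1 ->
  rdist F (gamma u) (gamma v) = (v - u) * D.

Lemma minimizer_continuous : {within `[0, 1], continuous gamma}.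
Proof.
apply/subspace_continuousP => s; rewrite /= in_itv /= => /andP[s0 s1] A sA.
have [d d0 dP] := nbhs_rdist conM fin_F sA.
have D1 : 0 < d / (D + 1) by rewrite divr_gt0//; have := D0; lra.
suff : \forall u \near s, `[0, 1]%classic u -> A (gamma u) by [].
apply/nbhs_ballP; exists (d / (D + 1)) => // u.
rewrite /ball /= ltr_distl ltrBlDr => /andP[us su]; rewrite in_itv /= => /andP[u0 u1].
have lt_d w w' : w - w' < d / (D + 1) -> w' <= w -> (w - w') * D < d.
  rewrite ltr_pdivlMr; last by have := D0; lra.
  by have := D0; nra.
apply: dP; have [le_su|/ltW le_us] := leP s u; [left|right].
- by rewrite gammaD//; apply: lt_d => //; lra.
- by rewrite gammaD//; apply: lt_d => //; lra.
Qed.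

(** In a chart a Riemannian distance is at most a multiple of that of F, so that
    gamma is locally Lipschitz for it, hence Lipschitz. *)
Lemma minimizer_absolutely_continuous : absolutely_continuous 0 1 gamma.
Proof.
have [g rg] := @riemannian_exists _ _ M (gamma 0); exists g => //.
have fin_g := riemannian_finsler rg.
have [L L0 LP] : exists2 L, 0 < L & forall u v, 0 <= u -> u <= v -> v <= 1 ->
    rdist (riemannian_norm g) (gamma u) (gamma v) <= L * (v - u).
  have := @chain_local _ 0 1 (fun s s' => exists2 L, 0 < L & forall u v, s <= u -> u <= v -> v <= s' ->
    rdist (riemannian_norm g) (gamma u) (gamma v) <= L * (v - u)); apply => //.
    move=> s u v _ _ [L1 L10 L1P] [L2 L20 L2P].
    exists (Num.max L1 L2); first by rewrite lt_max L10.
    have le1 w w' : w <= w' -> L1 * (w' - w) <= Num.max L1 L2 * (w' - w).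
      by move=> ww; apply: ler_wpM2r; [lra|rewrite le_max lexx].
    have le2 w w' : w <= w' -> L2 * (w' - w) <= Num.max L1 L2 * (w' - w).
      by move=> ww; apply: ler_wpM2r; [lra|rewrite le_max lexx orbT].
    move=> w w' sw ww w'v; have [w'u|uw'] := leP w' u.
      exact: le_trans (L1P _ _ sw ww w'u) (le1 _ _ ww).
    have [uw|wu] := leP u w.
      exact: le_trans (L2P _ _ uw ww w'v) (le2 _ _ ww).
    apply: le_trans (rdist_triangle conM fin_g (gamma u) (gamma w) (gamma w')) _.
    have -> : Num.max L1 L2 * (w' - w) = Num.max L1 L2 * (u - w) + Num.max L1 L2 * (w' - u) by ring.
    apply: lerD; [apply: le_trans (le1 _ _ (ltW wu))|apply: le_trans (le2 _ _ (ltW uw'))].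
      exact: L1P (ltW wu) (lexx u).
    exact: L2P (lexx u) (ltW uw') w'v.
  move=> s s01; have [i ix] := dom_cover (gamma s).
  have [r1 [C1 [r10 C10 B1]]] := rdist_bilipschitz conM fin_F ix.
  have [r2 [C2 [r20 C20 B2]]] := rdist_bilipschitz conM fin_g ix.
  have r0 : 0 < Num.min r1 r2 by rewrite lt_min r10.
  have [d d0 dP] := within_near minimizer_continuous s01 (chart_nbhs ix r0).
  exists d => // u v u0 v1 su uv vs.
  have CC0 : 0 <= C2 * (C1 * D) by rewrite !mulr_ge0// ltW.
  exists (C2 * (C1 * D) + 1); first by lra.
  move=> w w' uw ww w'v.
  have [||iw] := dP w; [lra|by rewrite ltr_distl; lra|rewrite lt_min => /andP[w1 w2]].
  have [||iw'] := dP w'; [lra|by rewrite ltr_distl; lra|rewrite lt_min => /andP[w1' w2']].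
  have [_ F1] := B1 _ _ iw w1 iw' w1'; have [g1 _] := B2 _ _ iw w2 iw' w2'.
  rewrite (gammaD (le_trans u0 uw) ww (le_trans w'v v1)) in F1.
  have := le_trans g1 (ler_wpM2l (ltW C20) F1).
  have -> : C2 * (C1 * ((w' - w) * D)) = C2 * (C1 * D) * (w' - w) by ring.
  by rewrite mulrDl mul1r; lra.
move=> e e0; exists (e / L); first by rewrite divr_gt0.
move=> k l r lr _ sd; under eq_bigr do rewrite (rdistE conM fin_g).
rewrite sumEFin lte_fin; apply: (@le_lt_trans _ _ (L * \sum_(i < k) (r i - l i))).
  by rewrite mulr_sumr; apply: ler_sum => i _; have [? [? ?]] := lr i; exact: LP.
by rewrite mulrC -ltr_pdivlMr.
Qed.

Section Calibrated.
Variables (G : forall x : M, tangent x -> R) (c : R).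
Hypothesis fin_G : finsler G.
Hypothesis c0 : 0 < c.
Hypothesis GF : forall x (v : tangent x), c * G v <= F v.
Hypothesis GD : c * rdist G (gamma 0) (gamma 1) = D.

(** On the intervals [0, u], [u, v] and [v, 1] the left-hand side is at most the
    right-hand side, and by the triangle inequality their sum over the three
    intervals is at least D. *)
Lemma calibrated_dist u v : 0 <= u -> u <= v -> v <= 1 ->
  c * rdist G (gamma u) (gamma v) = (v - u) * D.
Proof.
move=> u0 uv v1; apply/eqP; rewrite eq_le -{1}gammaD// le_rdist ?(ltW c0)//=.
have A1 := le_rdist conM fin_G fin_F (ltW c0) GF (gamma 0) (gamma u).
have A2 := le_rdist conM fin_G fin_F (ltW c0) GF (gamma v) (gamma 1).
have := rdist_triangle conM fin_G (gamma v) (gamma 0) (gamma 1).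
have := rdist_triangle conM fin_G (gamma u) (gamma 0) (gamma v).
move=> /(ler_wpM2l (ltW c0)) + /(ler_wpM2l (ltW c0)).
move: A1 A2; rewrite !gammaD ?mulrDr ?GD//; last lra; last lra.
by lra.
Qed.

Lemma calibrated_geodesic : geodesic G 0 1 gamma.
Proof.
have E : metric_length (finsler_dist G) 0 1 gamma = finsler_dist G (gamma 0) (gamma 1).
  have sumE k (t : nat -> R) : t 0%N = 0 -> t k.+1 = 1 ->
      (forall i, (i <= k)%N -> t i <= t i.+1) ->
      (\sum_(i < k.+1) finsler_dist G (gamma (t i)) (gamma (t i.+1)) = (D / c)%:E)%E.
    move=> t0 t1 tm.
    have mono i j : (i <= j)%N -> (j <= k.+1)%N -> t i <= t j.
      elim: j => [|j IH]; first by rewrite leqn0 => /eqP ->.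
      rewrite leq_eqVlt => /orP[/eqP -> //|]; rewrite ltnS => ij jk.
      by apply: le_trans (tm j jk); apply: IH => //; exact: ltnW.
    have distE (i : 'I_k.+1) : (finsler_dist G (gamma (t i)) (gamma (t i.+1)) =
        ((t i.+1 - t i) * (D / c))%:E)%E.
      rewrite (rdistE conM fin_G); congr EFin; apply: (mulfI (lt0r_neq0 c0)).
      rewrite calibrated_dist; first by rewrite mulrCA [c * _]mulrC divfK// gt_eqF.
      - by rewrite -t0; apply: mono => //; exact: ltnW.
      - by apply: tm; rewrite -ltnS.
      - by rewrite -t1; apply: mono.
    under eq_bigr do rewrite distE.
    rewrite sumEFin -mulr_suml; congr EFin.
    by rewrite -(big_mkord xpredT (fun i => t i.+1 - t i)) telescope_sumr// t1 t0 subr0 mul1r.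
  have -> : finsler_dist G (gamma 0) (gamma 1) = (D / c)%:E.
    by rewrite (rdistE conM fin_G) -GD mulrC mulKf// gt_eqF.
  rewrite /metric_length; apply/eqP; rewrite eq_le; apply/andP; split.
    by apply: ge_ereal_sup => _ [k [t [t0 t1 tm ->]]]; rewrite sumE.
  apply: ereal_sup_ubound; exists 0%N, (nth 1 [:: 0]); split => //.
    by case.
  rewrite sumE//.
  by case.
split=> //; first exact: minimizer_continuous.
by rewrite E (rdistE conM fin_G) ltry.
Qed.

Lemma calibrated_speed s : 0 < s < 1 ->
  F (velocity gamma s) = c * G (velocity gamma s).
Proof.
move=> s01; have [hv|->] := velocity_dichotomy gamma s; last first.
  have [_ wF] := fin_F; have [_ wG] := fin_G.
  by rewrite (weak_norm0 (wF _)) (weak_norm0 (wG _)) mulr0.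
have [s0 s1] := andP s01; have s1' : 0 < 1 - s by rewrite subr_gt0.
have FD : 1 * speed F gamma s = D.
  apply: (speed_of_linear fin_F hv ler01 s1') => h /andP[h0 h1].
  by rewrite mul1r gammaD; [congr (_ * _); ring|lra|lra|lra].
have GDs : c * speed G gamma s = D.
  apply: (speed_of_linear fin_G hv (ltW c0) s1') => h /andP[h0 h1].
  by rewrite calibrated_dist; [congr (_ * _); ring|lra|lra|lra].
by rewrite -[LHS]mul1r [LHS]FD -GDs.
Qed.

End Calibrated.

End Minimizers.
End Geodesics.

(** * Metrics of the maximum *)

Theorem theorem5p5 (R : realType) (n : nat) (M : smoothManifold R n)
    (F1 F2 : forall x : M, tangent x -> R) (t : R) :
  connected [set: M] ->
  finsler F1 -> finsler F2 -> finsler_complete F1 -> finsler_complete F2 ->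
  0 <= t <= 1 ->
  let dist_eq := forall x y : M,
    finsler_dist (max_finsler t F1 F2) x y =
    maxe ((1 - t)%:E * finsler_dist F1 x y)%E (t%:E * finsler_dist F2 x y)%E in
  (condition_star t F1 F2 -> dist_eq) /\
  (smooth_finsler F1 -> smooth_finsler F2 -> dist_eq ->
   condition_star t F1 F2).
Proof.
move=> conM fin1 fin2 comp1 comp2 t01 dist_eq.
have finF := max_finslerP fin1 fin2 t01.
have [t0 s0] : 0 <= t /\ 0 <= 1 - t by lra.
have le1 x (v : tangent x) : (1 - t) * F1 x v <= max_finsler t F1 F2 v by rewrite le_max lexx.
have le2 x (v : tangent x) : t * F2 x v <= max_finsler t F1 F2 v by rewrite le_max lexx orbT.
have distE x y : (finsler_dist (max_finsler t F1 F2) x y =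
    maxe ((1 - t)%:E * finsler_dist F1 x y) (t%:E * finsler_dist F2 x y))%E <->
    rdist (max_finsler t F1 F2) x y = Num.max ((1 - t) * rdist F1 x y) (t * rdist F2 x y).
  rewrite (rdistE conM finF) (rdistE conM fin1) (rdistE conM fin2) -!EFinM -EFin_max.
  by split=> [[]|->].
split=> [star x y|_ _ dE x y].
  apply/distE/eqP; rewrite eq_le ge_max; apply/and3P; split; last 2 first.
  - exact: (le_rdist conM fin1 finF s0 le1 x y).
  - exact: (le_rdist conM fin2 finF t0 le2 x y).
  have [gamma [ac <- <- alternatives]] := star x y.
  have by_F1 : geodesic F1 0 1 gamma -> (\forall s \ae lebesgue_measure, `[0, 1]%classic s ->
        t * F2 _ (velocity gamma s) <= (1 - t) * F1 _ (velocity gamma s)) ->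
      rdist (max_finsler t F1 F2) (gamma 0) (gamma 1) <=
      Num.max ((1 - t) * rdist F1 (gamma 0) (gamma 1)) (t * rdist F2 (gamma 0) (gamma 1)).
    move=> geo sp; rewrite le_max (dist_le_of_geodesic conM finF fin1 s0 ac geo)//.
    apply: filterS sp; first exact: (ae_filter_ringOfSetsType lebesgue_measure).
    by move=> s sp /sp le_s; rewrite /max_finsler ge_max lexx.
  have by_F2 : geodesic F2 0 1 gamma -> (\forall s \ae lebesgue_measure, `[0, 1]%classic s ->
        (1 - t) * F1 _ (velocity gamma s) <= t * F2 _ (velocity gamma s)) ->
      rdist (max_finsler t F1 F2) (gamma 0) (gamma 1) <=
      Num.max ((1 - t) * rdist F1 (gamma 0) (gamma 1)) (t * rdist F2 (gamma 0) (gamma 1)).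
    move=> geo sp; rewrite le_max (dist_le_of_geodesic conM finF fin2 t0 ac geo) ?orbT//.
    apply: filterS sp; first exact: (ae_filter_ringOfSetsType lebesgue_measure).
    by move=> s sp /sp le_s; rewrite /max_finsler ge_max lexx andbT.
  case: alternatives => [[geo1 geo2 [sp|sp]]|[geo sp]|[geo sp]].
  - apply: by_F1 => //; apply: filterS sp; first exact: (ae_filter_ringOfSetsType lebesgue_measure).
    by move=> s sp /sp; rewrite subr_ge0.
  - apply: by_F2 => //; apply: filterS sp; first exact: (ae_filter_ringOfSetsType lebesgue_measure).
    by move=> s sp /sp; rewrite subr_le0.
  - exact: by_F1.
  - exact: by_F2.
have compF : finsler_complete (max_finsler t F1 F2).
  have [t_lt1|t_ge1] := ltP t 1.
    by apply: (le_finsler_complete conM fin1 finF s0 le1) => //; rewrite subr_gt0.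
  exact: (le_finsler_complete conM fin2 finF t0 le2) (lt_le_trans ltr01 t_ge1) comp2.
have [gamma [g0 g1 gD]] := minimizer_exists conM finF x y compF.
have D0 := rdist_ge0 finF x y.
exists gamma; split => //; first exact: (minimizer_absolutely_continuous conM finF D0 gD).
have maxE := (distE x y).1 (dE x y).
have d1 := mulr_ge0 s0 (rdist_ge0 fin1 x y).
have d2 := mulr_ge0 t0 (rdist_ge0 fin2 x y).
(* a term of weight 0 is the larger one only if both are 0, and then the other
   one, of positive weight, does as well *)
have [[c0 E]|[c0 E]] : (0 < 1 - t /\ (1 - t) * rdist F1 x y = rdist (max_finsler t F1 F2) x y) \/
    (0 < t /\ t * rdist F2 x y = rdist (max_finsler t F1 F2) x y).
  rewrite maxE; have [le12|/ltW le21] := leP ((1 - t) * rdist F1 x y) (t * rdist F2 x y).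
    have [t_eq0|t_neq0] := eqVneq t 0; last by right; rewrite lt0r t_neq0.
    left; move: le12 d1; rewrite t_eq0 subr0 mul1r !mul0r => le12 d1.
    by split=> //; apply/eqP; rewrite eq_le le12.
  have [t_eq1|t_neq1] := eqVneq t 1; last by left; rewrite lt0r subr_eq0 eq_sym t_neq1.
  right; move: le21 d2; rewrite t_eq1 subrr mul1r !mul0r => le21 d2.
  by split=> //; apply/eqP; rewrite eq_le le21.
- apply: Or32; rewrite -{1}g0 -{1}g1 in E.
  split; first exact: (calibrated_geodesic conM finF D0 gD fin1 c0 le1).
  apply: ae_interior => s s01.
  by rewrite -(calibrated_speed conM finF gD fin1 c0 le1 E s01).
- apply: Or33; rewrite -{1}g0 -{1}g1 in E.
  split; first exact: (calibrated_geodesic conM finF D0 gD fin2 c0 le2).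
  apply: ae_interior => s s01.
  by rewrite -(calibrated_speed conM finF gD fin2 c0 le2 E s01).
Qed.
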